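(* For every $c>0$ and every positive integer $d$ there exists $n_0=n_0(c,d)$ with the following property. Let $\varepsilon>0$ and let $f(x,y,z)\in\mathbb{R}[x,y,z]$ be a polynomial of degree $d$ such that, for some $n>n_0$, the graph $w=f(x,y,z)$ contains at least $c\,n^{8/3+2\varepsilon}$ points of $A\times B\times C\times D$, where $A,B,C,D\subset\mathbb{R}$ with $|A|=n$, $|B|=|C|=n^{5/6+\varepsilon}$ and $|D|=n$. Then there exist polynomials $g,k,l,m\in\mathbb{R}[t]$ such that either $$f(x,y,z)=g(k(x)+l(y)+m(z))\quad\text{or}\quad f(x,y,z)=g(k(x)\cdot l(y)\cdot m(z)).$$
   Context: A point $(a,b,c',e)\in A\times B\times C\times D$ lies on the graph $w=f(x,y,z)$ if $e=f(a,b,c')$. *)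

(* Defs.v *)
From Stdlib Require Import Reals.
From HB Require Import structures.
From mathcomp Require Import all_boot all_order all_algebra.
From mathcomp Require Import Rstruct.
From mathcomp Require Import mpoly.
Set Implicit Arguments. Unset Strict Implicit. Unset Printing Implicit Defensive.
Import GRing.Theory.
Local Open Scope ring_scope.

Definition ev3 (f : {mpoly R[3]}) (x y z : R) : R :=
  f.@[fun i : 'I_3 => nth 0 [:: x; y; z] i].

(* Number of points (a,b,c',e) in A x B x C x D lying on the graph w = f(x,y,z),
   i.e. with e = f(a,b,c').  Finite sets are duplicate-free sequences. *)
Definition graph_points (f : {mpoly R[3]}) (A B C D : seq R) : nat :=
  (\sum_(a <- A) \sum_(b <- B) \sum_(c <- C) \sum_(e <- D)
      (e == ev3 f a b c : nat))%N.

(* Main.v *)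
(* Averaging replaces A, B, C by subsets of a common size m with n^5 <= m^6, still with a positive
   proportion of the m^3 triples having f(a, b, c) in D.  Suppose that all partial derivatives of f
   are nonzero.  Cauchy-Schwarz over the cells of a partition of C x D into blocks counts pairs
   f(a, b, c) = e, f(a, b, c') = e' with c, c' and e, e' close to each other; such a pair is an
   intersection point of two plane curves, and there are few of them, unless the curves are always
   tangent, i.e. f_x(x, y, z) f_y(x, y, z') = f_y(x, y, z) f_x(x, y, z') identically.  For n large
   the three identities of this kind hold, so every quotient of two partial derivatives is a product
   of functions of one variable each.  If f depends on x and y only, a double Cauchy-Schwarz
   argument gives the same conclusion.

   It remains to solve f_x p2(x) q1(y) = f_y p1(x) q2(y) in polynomials.  Comparing leading
   coefficients in either variable, p1 / p2 and q1 / q2 are either derivatives u', v' of polynomials,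
   so that f = g(u(x) + v(y) + ...), or constant multiples of logarithmic derivatives u' / u and
   v' / v, and f is a polynomial in a product of powers of u and v. *)
Require Import Defs.
From Stdlib Require Import Reals.
From HB Require Import structures.
From Stdlib Require Import Classical.
From mathcomp Require Import all_boot all_order all_algebra.
From mathcomp Require Import Rstruct.
From mathcomp Require Import mpoly.
From mathcomp Require Import polyXY polyrcf complex ring lra zify.
Set Implicit Arguments. Unset Strict Implicit. Unset Printing Implicit Defensive.
Import Order.TTheory GRing.Theory Num.Theory.
Local Open Scope ring_scope.

(** * Counting *)

(** With blocks of length b there are at most about m^2 n / b occupied cells, while a common cell is
    shared by about (m b)(n b) pairs, a bounded number for each pair of curves, plus m^3 degenerate
    ones. Balancing by b^2 n ~ m^2 gives m^4 = O(n^3); the two-variable count gives m^5 = O(n^4).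
    The exponent 5/6 exceeds both 3/4 and 4/5, so either bound caps n. The two-variable case needs
    its own count because the tangency identity is trivially true when f does not involve z.

    Bézout's bound is applied to curves that may share components, hence it can count only common
    zeros with independent gradients. Everything but the last step is over a real closed field [K]:
    its order serves the monotone pieces, its closure [K[i]] serves Bézout.

    In the algebraic half the difficulty is the exponents: logarithmic derivatives determine powers
    only up to rational exponents, and those powers that are polynomials must be found. The
    equations are linear in f, so f is peeled off one top term at a time, each a multiple of a power
    of one product of least degree. *)

Lemma card_le_fiber (T U : finType) (A : {set T}) (g : T -> U) (k : nat) :
  (forall u, (#|[set x in A | g x == u]| <= k)%N) -> (#|A| <= k * #|g @: A|)%N.
Proof.
move=> hk.
have -> : #|A| = (\sum_(u in g @: A) #|[set x in A | g x == u]|)%N.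
  rewrite -sum1_card (partition_big_imset g) /=.
  by apply: eq_bigr => u _; rewrite -sum1_card; apply: eq_bigl => x; rewrite inE.
apply: leq_trans (leq_sum _ (fun u _ => hk u)) _.
by rewrite sum_nat_const mulnC.
Qed.

Lemma leq_card_imset (T U V : finType) (A : {set T}) (f : T -> U) (g : T -> V) :
  {in A &, forall x y, g x = g y -> f x = f y} -> (#|f @: A| <= #|g @: A|)%N.
Proof.
move=> h; rewrite -[leqRHS]mul1n.
have [->|[x0 x0A]] := set_0Vmem A; first by rewrite !imset0 !cards0.
pose k (v : V) := odflt (f x0) (omap f [pick x in A | g x == v]).
have -> : f @: A = k @: (g @: A).
  rewrite -imset_comp; apply: eq_in_imset => x xA /=; rewrite /k.
  case: pickP => [y /andP[yA /eqP e]|/(_ x)] /=; first by apply/esym/h.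
  by rewrite xA eqxx.
by rewrite mul1n leq_imset_card.
Qed.

(** Cauchy-Schwarz for the fibre sizes [N u]: they sum to [#|A|], and their squares sum to the
    number of colliding pairs. *)
Lemma card_collisions (T U : finType) (A : {set T}) (g : T -> U) :
  (#|A| ^ 2 <= #|g @: A| *
     #|[set p : T * T | [&& p.1 \in A, p.2 \in A & g p.1 == g p.2]]|)%N.
Proof.
pose N u := #|[set x in A | g x == u]|.
have eA : #|A| = (\sum_(u in g @: A) N u)%N.
  rewrite -sum1_card (partition_big_imset g) /=.
  by apply: eq_bigr => u _; rewrite /N -sum1_card; apply: eq_bigl => x; rewrite inE.
have eP : (#|[set p : T * T | [&& p.1 \in A, p.2 \in A & g p.1 == g p.2]]|
           = \sum_(u in g @: A) N u ^ 2)%N.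
  set B := [set p | _]; rewrite -sum1_card.
  rewrite (partition_big (fun p : T * T => g p.1) (fun u => u \in g @: A)) /=; last first.
    by move=> p; rewrite inE => /and3P[pA _ _]; apply: imset_f.
  apply: eq_bigr => u _; rewrite sum1_card /N expnS expn1 -cardsX.
  apply: eq_card => -[x y]; rewrite !inE /= unfold_in /= !inE /=.
  case xA: (x \in A); case yA: (y \in A); rewrite /= ?andbF //.
  by apply/andP/andP => -[/eqP e1 /eqP e2]; rewrite ?e1 ?e2 -?e1 ?e2; split; rewrite ?e1 ?e2 //; apply/eqP; congruence.
rewrite eA eP.
have cs : forall (x y : nat), (2 * (x * y) <= x ^ 2 + y ^ 2)%N.
  by move=> x y; have [] := nat_Cauchy x y.
set I := g @: A.
have e2 : ((\sum_(u in I) N u) ^ 2 = \sum_(u in I) \sum_(v in I) N u * N v)%N.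
  by rewrite expnS expn1 big_distrl /=; apply: eq_bigr => u _; rewrite big_distrr.
have e3 : (\sum_(u in I) \sum_(v in I) (N u ^ 2 + N v ^ 2) = 2 * (#|I| * \sum_(u in I) N u ^ 2))%N.
  under eq_bigr => u _ do rewrite big_split /= sum_nat_const.
  by rewrite big_split /= sum_nat_const -big_distrr /= mul2n addnn.
rewrite -(leq_pmul2l (isT : (0 < 2)%N)) -e3 e2 big_distrr /=.
by apply: leq_sum => u _; rewrite big_distrr /=; apply: leq_sum => v _; apply: cs.
Qed.

Lemma card_roots_le (F : idomainType) (T : finType) (A : {set T}) (h : T -> F)
    (p : {poly F}) : p != 0 -> {in A &, injective h} ->
  (forall t, t \in A -> root p (h t)) -> (#|A| < size p)%N.
Proof.
move=> p0 hi hr.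
have := @max_poly_roots F p [seq h t | t in A] p0; rewrite size_map -cardE.
apply.
  by apply/allP => u /mapP[t]; rewrite mem_enum => /hr ? ->.
by rewrite map_inj_in_uniq ?enum_uniq // => x y; rewrite !mem_enum; apply: hi.
Qed.

(** * Nondegenerate common zeros of two polynomials *)

Section NondegenerateZeros.
Variable F : closedFieldType.
Implicit Types P Q h : {poly {poly F}}.

(** P(x, y) is encoded with y outside and x in the coefficients, so that [P.[y, x]] substitutes y
    first. This is the derivative in x; the ordinary [deriv] is the one in y. *)
Definition deriv_inner (A : comNzRingType) (P : {poly {poly A}}) :=
  swapXY (swapXY P)^`().

Lemma deriv_innerM (A : comNzRingType) (P Q : {poly {poly A}}) :
  deriv_inner (P * Q) = deriv_inner P * Q + P * deriv_inner Q.
Proof. by rewrite /deriv_inner !(rmorphM, derivM, rmorphD) /= !swapXYK. Qed.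

(** Primitivity over F[x]: as F is algebraically closed, a nonconstant content would have a root
    rho, and the line x = rho would be a component of P = 0. *)
Definition primitiveX P := forall rho : F, (swapXY P).[rho%:P] != 0.

Lemma primitive_part h : h != 0 ->
  exists (c : {poly F}) h0, h = c *: h0 /\ primitiveX h0.
Proof.
have [n] := ubnP (sizeY h); elim: n h => // n IH h ltn h0.
have [prim|nprim] := classic (primitiveX h).
  by exists 1, h; rewrite scale1r.
have [rho /eqP] : exists rho, (swapXY h).[rho%:P] = 0.
  apply: NNPP => ne; apply: nprim => rho; apply/eqP => e0; apply: ne.
  by exists rho.
rewrite -rootE => /factor_theorem[q eq].
have q0 : q != 0.
  by apply: contra_neq h0 => q0; rewrite -[h]swapXYK eq q0 mul0r raddf0.
have [||c [h1 [e1 p1]]] := IH (swapXY q).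
- rewrite -ltnS; apply: leq_trans ltn.
  by rewrite ltnS !sizeYE swapXYK eq size_Mmonic ?monicXsubC // size_XsubC addn2.
- by rewrite swapXY_eq0.
exists (('X - rho%:P) * c), h1; split=> //.
rewrite -[LHS]swapXYK eq rmorphM /= mulrC -scalerA -e1 -mul_polyC; congr (_ * _).
by rewrite rmorphB /= swapXY_X swapXY_polyC map_polyC /= polyCB.
Qed.

(** Gauss's lemma, one root rho of [c] at a time: on the line x = rho the left side vanishes and h
    does not, so x - rho divides [Q] and can be cancelled. *)
Lemma primitive_dvd h P Q (c : {poly F}) : primitiveX h -> c != 0 ->
  c *: P = h * Q -> exists Q', P = h * Q'.
Proof.
move=> prim; have [n] := ubnP (size c); elim: n c Q => // n IH c Q ltn c0 e.
have [c1|cn1] := eqVneq (size c) 1.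
  have /size_poly1P[a a0 ea] : size c == 1 by rewrite c1.
  exists (a^-1%:P *: Q); rewrite -scalerAr -e ea scalerA -polyCM mulVf //.
  by rewrite scale1r.
have /closed_rootP[rho] := cn1.
move/factor_theorem=> [c' ec].
have c'0 : c' != 0 by apply: contra_neq c0 => c'0; rewrite ec c'0 mul0r.
have sXC : swapXY ('X - rho%:P)%:P = 'X - rho%:P%:P :> {poly {poly F}}.
  by rewrite swapXY_polyC rmorphB /= map_polyX map_polyC.
have /factor_theorem[q eq] : root (swapXY Q) rho%:P.
  have /(congr1 (fun p => (swapXY p).[rho%:P])) := e.
  rewrite -mul_polyC ec rmorphM /= polyCM rmorphM /= sXC rmorphM /= !hornerM.
  rewrite hornerXsubC subrr mulr0 mul0r => /esym/eqP; rewrite mulf_eq0.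
  by rewrite (negPf (prim rho)) /= rootE.
have eQ : Q = ('X - rho%:P) *: swapXY q.
  by rewrite -[LHS]swapXYK eq rmorphM /= mulrC -sXC swapXYK mul_polyC.
apply: (IH c' (swapXY q)) => //.
  by move: ltn; rewrite ec size_Mmonic ?monicXsubC // size_XsubC addn2.
have X0 : ('X - rho%:P)%:P != 0 :> {poly {poly F}} by rewrite polyC_eq0 polyXsubC_eq0.
apply: (mulfI X0); rewrite !mul_polyC scalerA mulrC -ec e eQ.
by rewrite scalerAr.
Qed.

(** [gcdp] is a gcd only over the fraction field F(x): dividing by it costs a factor in F[x]. Its
    primitive part [h] divides without that factor, and leaves cofactors coprime over F(x). *)
Lemma coprime_cofactors P Q : P != 0 -> Q != 0 -> exists h P1 Q1,
  [/\ P = h * P1, Q = h * Q1 & coprimep P1 Q1].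
Proof.
move=> P0 Q0; set g := gcdp P Q.
have g0 : g != 0 by rewrite gcdp_eq0 negb_and P0.
have [c [h [eg prim]]] := primitive_part g0.
have c0 : c != 0 by apply: contra_neq g0 => c0; rewrite eg c0 scale0r.
have h0 : h != 0 by apply: contra_neq g0 => h0; rewrite eg h0 scaler0.
have dvd (S : {poly {poly F}}) : g %| S -> exists S1, S = h * S1.
  move/Pdiv.Idomain.dvdpP => [[a q] /= a0 e].
  by apply: (primitive_dvd prim a0 (Q := c *: q)); rewrite e eg -!scalerAr [q * h]mulrC.
have [P1 eP] := dvd _ (dvdp_gcdl P Q).
have [Q1 eQ] := dvd _ (dvdp_gcdr P Q).
exists h, P1, Q1; split=> //.
have := gcdp_mul2l h P1 Q1; rewrite -eP -eQ -/g => /eqp_size.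
have gg0 : gcdp P1 Q1 != 0.
  rewrite gcdp_eq0 negb_and; apply/orP; left.
  by apply: contra_neq P0 => P10; rewrite eP P10 mulr0.
rewrite eg size_scale // size_mul // => e.
have ar (u v : nat) : (0 < u -> 0 < v -> u = (u + v).-1 -> v = 1)%N by lia.
by rewrite coprimep_def; apply/eqP; apply: ar e; rewrite size_poly_gt0.
Qed.

Lemma size_det_le (A : comNzRingType) n D (M : 'M[{poly A}]_n) :
  (forall i j, (size (M i j) <= D.+1)%N) -> (size (\det M) <= (n * D).+1)%N.
Proof.
move=> hM; rewrite /determinant; apply: leq_trans (size_sum _ _ _) _.
apply/bigmax_leqP => s _; rewrite mulr_sign.
have sgn (b : bool) (p : {poly A}) : size (if b then - p else p) = size p.
  by case: b; rewrite ?size_polyN.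
rewrite sgn.
apply: leq_trans (size_prod_leq _ _) _.
rewrite leq_subLR addnS ltnS.
apply: leq_trans (leq_sum _ (fun i _ => hM i _)) _.
by rewrite sum_nat_const mulnS leq_add2l card_ord.
Qed.

Lemma size_resultant_le P Q D : (size P <= D.+1)%N -> (size Q <= D.+1)%N ->
  (sizeY P <= D.+1)%N -> (sizeY Q <= D.+1)%N ->
  (size (resultant P Q) <= (2 * D * D).+1)%N.
Proof.
move=> sP sQ yP yQ; apply: leq_trans (size_det_le (D := D) _) _; last first.
  by rewrite ltnS leq_mul2r; apply/orP; right; move: sP sQ; case: (size P) (size Q) => [|a] [|b] /=; lia.
move=> i j; rewrite Sylvester_mxE; case: split => k; rewrite mulrb; case: ifP => _;
  rewrite ?size_poly0 //; apply: leq_trans (max_size_coefXY _ _) _ => //.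
Qed.

(* At a common zero of h P1 and h Q1 where h vanishes, the two gradients are parallel to that of
   h; so the counted points are common zeros of the coprime cofactors, whose resultant in one
   variable is a nonzero polynomial in the other. *)
Lemma nondegenerate_zeros P Q D (T : finType) (A : {set T}) (x y : T -> F) :
  (size P <= D.+1)%N -> (size Q <= D.+1)%N ->
  (sizeY P <= D.+1)%N -> (sizeY Q <= D.+1)%N ->
  {in A &, forall s t, x s = x t -> y s = y t -> s = t} ->
  (forall t, t \in A -> [/\ P.[y t, x t] = 0, Q.[y t, x t] = 0 &
     (deriv_inner P).[y t, x t] * (Q^`()).[y t, x t]
     - (P^`()).[y t, x t] * (deriv_inner Q).[y t, x t] != 0]) ->
  (#|A| <= 2 * D ^ 3)%N.
Proof.
move=> sP sQ yP yQ inj hA.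
have [->|[t0 t0A]] := set_0Vmem A; first by rewrite cards0.
have h20 (S : {poly {poly F}}) t : S = 0 -> (deriv_inner S).[y t, x t] = 0 /\ (S^`()).[y t, x t] = 0.
  by move=> ->; rewrite /deriv_inner rmorph0 deriv0 rmorph0 !horner0.
have P0 : P != 0.
  apply/eqP => P0; have [_ _] := hA _ t0A; have [-> ->] := h20 _ t0 P0.
  by rewrite !mul0r subrr eqxx.
have Q0 : Q != 0.
  apply/eqP => Q0; have [_ _] := hA _ t0A; have [-> ->] := h20 _ t0 Q0.
  by rewrite !mulr0 subrr eqxx.
have [h [P1 [Q1 [eP eQ cop]]]] := coprime_cofactors P0 Q0.
have hP : h != 0 by apply: contra_neq P0 => z; rewrite eP z mul0r.
have P10 : P1 != 0 by apply: contra_neq P0 => z; rewrite eP z mulr0.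
have Q10 : Q1 != 0 by apply: contra_neq Q0 => z; rewrite eQ z mulr0.
have sz (S S1 : {poly {poly F}}) : S = h * S1 -> S1 != 0 -> (size S <= D.+1)%N -> (sizeY S <= D.+1)%N ->
    (size S1 <= D.+1)%N /\ (sizeY S1 <= D.+1)%N.
  move=> -> S10; rewrite !sizeYE rmorphM /= !size_mul ?swapXY_eq0 //.
  have : (0 < size h)%N by rewrite size_poly_gt0.
  have : (0 < size (swapXY h))%N by rewrite size_poly_gt0 swapXY_eq0.
  have ar (u v : nat) : (0 < u -> (u + v).-1 <= D.+1 -> v <= D.+1)%N by lia.
  by move=> a b c d; split; [apply: ar b c | apply: ar a d].
have [sP1 yP1] := sz _ _ eP P10 sP yP.
have [sQ1 yQ1] := sz _ _ eQ Q10 sQ yQ.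
have hA1 t : t \in A -> P1.[y t, x t] = 0 /\ Q1.[y t, x t] = 0.
  move=> tA; have [Pt Qt Jt] := hA t tA.
  have [ht|ht] := eqVneq h.[y t, x t] 0.
    case/eqP: Jt; rewrite eP eQ !deriv_innerM !derivM !(hornerD, hornerM) ht; ring.
  move: Pt Qt; rewrite eP eQ !hornerM => /eqP; rewrite mulf_eq0 (negPf ht) /= => /eqP ->.
  by move/eqP; rewrite mulf_eq0 (negPf ht) /= => /eqP ->.
(* A nonzero polynomial vanishing at the abscissae of all counted points: the resultant in y, or
   [P1] or [Q1] itself when it does not involve y. *)
have [r [r0 sr hr]] : exists r : {poly F}, [/\ r != 0, (size r <= (2 * D * D).+1)%N &
    forall t, t \in A -> root r (x t)].
  have const (S : {poly {poly F}}) : S != 0 -> (size S <= 1)%N -> (sizeY S <= D.+1)%N ->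
    (forall t, t \in A -> S.[y t, x t] = 0) -> (0 < D)%N -> exists r : {poly F},
    [/\ r != 0, (size r <= (2 * D * D).+1)%N & forall t, t \in A -> root r (x t)].
    move=> S0 S1 yS hS D0; have eS := size1_polyC S1; exists S`_0; split.
    - by apply: contra_neq S0 => z; rewrite eS z.
    - by apply: leq_trans (max_size_coefXY S 0) _; apply: leq_trans yS _; nia.
    - by move=> t tA; rewrite rootE -(hornerC S`_0 (y t)%:P) -eS hS.
  have D0 : (0 < D)%N.
    case: (D) sP yP => // sP yP; have [Pt _ _] := hA _ t0A.
    have e1 := size1_polyC sP; have e2 := size1_polyC (leq_trans (max_size_coefXY P 0) yP).
    have [a ea] : exists a, P = a%:P%:P by exists P`_0`_0; rewrite -e2 -e1.
    by move: Pt P0; rewrite ea !hornerC => ->; rewrite !rmorph0 eqxx.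
  have [p1|p1] := leqP (size P1) 1; first by apply: (const P1) => // t /hA1[].
  have [q1|q1] := leqP (size Q1) 1; first by apply: (const Q1) => // t /hA1[].
  exists (resultant P1 Q1); split; last 1 first.
  - move=> t tA; have [Pt Qt] := hA1 t tA.
    have [[u v] _ /=] := resultant_in_ideal p1 q1.
    move/(congr1 (fun p => p.[y t, x t])); rewrite hornerC !hornerD !hornerM Pt Qt.
    by rewrite !mulr0 addr0 rootE => ->.
  - by rewrite resultant_eq0 -leqNgt; move: cop; rewrite coprimep_def => /eqP ->.
  - exact: size_resultant_le.
(* [g] chooses one point on each vertical line: its image is bounded by the roots of [r], and its
   fibres are the points of a single line. *)
pose g t := odflt t [pick s in A | x s == x t].
have gP t : t \in A -> g t \in A /\ x (g t) = x t.
  by rewrite /g; case: pickP => [s /andP[sA /eqP]|/(_ t)] //= _; rewrite eqxx andbT => ->.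
have gx s t : s \in A -> t \in A -> x s = x t -> g s = g t.
  move=> sA tA e; rewrite /g e; case: pickP => [//|/(_ t)].
  by rewrite tA eqxx.
have gA : (#|g @: A| <= 2 * D * D)%N.
  rewrite -ltnS; apply: leq_trans sr; apply: (card_roots_le (h := x)) => //.
    move=> _ _ /imsetP[s sA ->] /imsetP[t tA ->].
    by rewrite (gP s sA).2 (gP t tA).2; apply: gx.
  by move=> _ /imsetP[s sA ->]; apply: hr; apply: (gP s sA).1.
have fib u : (#|[set t in A | g t == u]| <= D)%N.
  have [->|[t1]] := set_0Vmem [set t in A | g t == u]; first by rewrite cards0.
  rewrite !inE => /andP[t1A /eqP gt1].
  have xE t : t \in [set t in A | g t == u] -> t \in A /\ x t = x t1.
    rewrite !inE => /andP[tA /eqP gt]; split=> //.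
    by rewrite -(gP t tA).2 gt -gt1 (gP t1 t1A).2.
  pose e S := map_poly (horner_eval (x t1)) S.
  have eE (S : {poly {poly F}}) v : (e S).[v] = S.[v, x t1].
    have /= := horner_map (horner_eval (x t1)) S v%:P.
    by rewrite {2 3}/horner_eval hornerC => <-.
  have fibS (S : {poly {poly F}}) : (size S <= D.+1)%N -> e S != 0 -> (forall t, t \in A -> S.[y t, x t] = 0) ->
      (#|[set t in A | g t == u]| <= D)%N.
    move=> sS S0 hS; have seS : (size (e S) <= size S)%N by apply: size_poly.
    rewrite -ltnS; apply: leq_trans (leq_trans seS sS).
    apply: (card_roots_le (h := y)) => //.
      by move=> s t /xE[sA xs] /xE[tA xt] ys; apply: inj; rewrite ?xs ?xt.
    by move=> t /xE[tA xt]; rewrite rootE eE -xt hS.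
  (* If both restrictions to the line vanish, so do both derivatives in y, and the Jacobian is zero
     at [t1]. Otherwise a nonzero polynomial in y of degree at most D bounds the fibre. *)
  have [eP0|eP0] := eqVneq (e P) 0; last by apply: (fibS P) => // t /hA[].
  have [eQ0|eQ0] := eqVneq (e Q) 0; last by apply: (fibS Q) => // t /hA[].
  have [_ _] := hA _ t1A; rewrite -!eE /e -!deriv_map -!/(e _) eP0 eQ0.
  by rewrite !deriv0 !horner0 mulr0 mul0r subrr eqxx.
apply: leq_trans (card_le_fiber fib) _; apply: leq_trans (leq_mul (leqnn D) gA) _.
by rewrite !expnS; nia.
Qed.
End NondegenerateZeros.

(** Extension of scalars to the algebraic closure [K[i]]; the embedding is injective, so degrees and
    the nonvanishing of the Jacobian are preserved. *)
Lemma nondegenerate_zeros_rcf (K : rcfType) (P Q : {poly {poly K}}) D (T : finType)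
    (A : {set T}) (x y : T -> K) :
  (size P <= D.+1)%N -> (size Q <= D.+1)%N ->
  (sizeY P <= D.+1)%N -> (sizeY Q <= D.+1)%N ->
  {in A &, forall s t, x s = x t -> y s = y t -> s = t} ->
  (forall t, t \in A -> [/\ P.[y t, x t] = 0, Q.[y t, x t] = 0 &
     (deriv_inner P).[y t, x t] * (Q^`()).[y t, x t]
     - (P^`()).[y t, x t] * (deriv_inner Q).[y t, x t] != 0]) ->
  (#|A| <= 2 * D ^ 3)%N.
Proof.
move=> sP sQ yP yQ inj hA.
pose io : {rmorphism K -> K[i]} := real_complex K.
have ioI : injective io by apply: fmorph_inj.
pose phi := map_poly (map_poly io).
have phiE S u v : (phi S).[io u, io v] = io S.[u, v].
  by rewrite /phi -(map_polyC io) horner_map horner_map.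
have phiX S : deriv_inner (phi S) = phi (deriv_inner S).
  by rewrite /deriv_inner /phi !swapXY_map deriv_map swapXY_map.
have sphi S : size (phi S) = size S.
  by apply: size_map_inj_poly; [apply: map_inj_poly => //; apply: rmorph0|apply: rmorph0].
apply: (@nondegenerate_zeros _ (phi P) (phi Q) D T A (io \o x) (io \o y)) => //.
- by rewrite sphi.
- by rewrite sphi.
- by rewrite sizeYE /phi swapXY_map sphi -sizeYE.
- by rewrite sizeYE /phi swapXY_map sphi -sizeYE.
- by move=> s t sA tA /ioI xs /ioI ys; apply: inj.
move=> t /hA[Pt Qt Jt]; split; rewrite /= ?phiX ?deriv_map.
- by rewrite phiE Pt rmorph0.
- by rewrite phiE Qt rmorph0.
by rewrite -!/(phi _) !phiE -!rmorphM -rmorphB fmorph_eq0.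
Qed.

(** * Substitution morphisms on multivariate polynomials *)

Lemma mpoly_ringind n (A : nzRingType) (P : {mpoly A[n]} -> Prop) :
  (forall c, P c%:MP) -> (forall i, P 'X_i) ->
  (forall p q, P p -> P q -> P (p + q)) ->
  (forall p q, P p -> P q -> P (p * q)) -> forall p, P p.
Proof.
move=> PC PX PD PM p; rewrite [p]mpolyE; apply: big_ind => [||m _].
- by rewrite -mpolyC0.
- exact: PD.
rewrite -mul_mpolyC mpolyXE_id; apply: (PM) => //; apply: big_ind => [||i _].
- by rewrite -mpolyC1.
- exact: PM.
by elim: (m i) => [|k IH]; rewrite ?expr0 -?mpolyC1 // exprS; apply: PM.
Qed.

Section MmapFacts.
Variables (n : nat) (A B : comNzRingType).

Lemma mmap_deriv (h : {rmorphism A -> B}) (g : 'I_n -> B) (d : {additive B -> B}) i :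
  (forall x y, d (x * y) = d x * y + x * d y) -> (forall c, d (h c) = 0) ->
  (forall t, d (g t) = (t == i)%:R) ->
  forall f : {mpoly A[n]}, d (mmap h g f) = mmap h g f^`M(i).
Proof.
move=> dM dC dX; elim/mpoly_ringind => [c|t|p q ep eq|p q ep eq].
- by rewrite mderivC mmapC rmorph0 dC.
- rewrite mmapX mmap1U dX mderivX mmapZ mnm1E; case: eqP => [->|_].
    have -> : (U_(i) - U_(i) = 0)%MM by apply/mnmP => s; rewrite !mnmE subnn.
    by rewrite rmorph_nat mmapX mmap11 mulr1.
  by rewrite rmorph_nat; apply/esym/mul0r.
- by rewrite mderivD !rmorphD raddfD ep eq.
by rewrite mderivM !(rmorphD, rmorphM) /= dM ep eq.
Qed.

Lemma mmap_morph (C : comNzRingType) (h : {rmorphism A -> B}) (g : 'I_n -> B)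
    (h' : {rmorphism A -> C}) (g' : 'I_n -> C) (phi : {rmorphism B -> C}) :
  (forall c, phi (h c) = h' c) -> (forall t, phi (g t) = g' t) ->
  forall f, phi (mmap h g f) = mmap h' g' f.
Proof.
move=> eC eX; elim/mpoly_ringind => [c|t|p q ep eq|p q ep eq].
- by rewrite !mmapC eC.
- by rewrite !mmapX !mmap1U eX.
- by rewrite !rmorphD ep eq.
by rewrite !rmorphM /= ep eq.
Qed.

Lemma size_mmap (h : {rmorphism A -> {poly B}}) (g : 'I_n -> {poly B}) :
  (forall c, size (h c) <= 1)%N -> (forall t, size (g t) <= 2)%N ->
  forall f, (size (mmap h g f) <= msize f)%N.
Proof.
move=> sh sg f; rewrite /mmap; apply: leq_trans (size_sum _ _ _) _.
apply/bigmax_leqP_seq => m mf _; apply: leq_trans (size_polyMleq _ _) _.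
rewrite /mmap1; apply: leq_trans (msize_mdeg_lt mf).
have pw : (size (\prod_(i < n) g i ^+ m i)%R <= (mdeg m).+1)%N.
  rewrite mdegE; elim/big_rec2: _ => [|i p k _ IH]; first by rewrite size_poly1.
  apply: leq_trans (size_polyMleq _ _) _.
  have := size_poly_exp_leq (g i) (m i); move: IH (sg i).
  move: (size p) (size (g i)) (size (g i ^+ m i)) => a b c; nia.
move: pw (sh f@_m); move: (size _) (size (h _)) => a b; lia.
Qed.
End MmapFacts.

(** * Numerical consequences of the incidence bounds *)

(** [b] is the integer part of sqrt(q / n); the factor 4 comes from b + 1 <= 2 b. *)
Lemma block_size n q : (0 < n)%N -> (n <= q)%N ->
  exists2 b, (0 < b)%N & (b * b * n <= q <= 4 * (b * b * n))%N.
Proof.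
move=> n0 nq; pose P b := (b * b * n <= q)%N.
have P1 : exists b, P b by exists 1%N; rewrite /P !mul1n.
have Pq b : P b -> (b <= q)%N.
  by case: b => // b; apply: leq_trans; rewrite -mulnA leq_pmulr // muln_gt0.
case: (ex_maxnP P1 Pq) => b Pb bmax.
have b0 : (0 < b)%N by apply: bmax; rewrite /P !mul1n.
exists b => //; rewrite -[X in X && _]/(P b) Pb /=.
have : ~~ P b.+1 by apply/negP => /bmax; rewrite ltnn.
rewrite /P -ltnNge => /ltnW/leq_trans; apply.
by rewrite mulnA leq_mul2r; apply/orP; right; move: b0; clear; nia.
Qed.

Lemma leq_of_leq_expn m n C p q r : (0 < n)%N ->
  (n ^ p <= m ^ q)%N -> (m ^ q <= C * n ^ r)%N -> p = r.+1 -> (n <= C)%N.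
Proof.
move=> n0 h1 h2 pr; have := leq_trans h1 h2; rewrite pr expnS leq_mul2r.
by rewrite expn_eq0 eqn0Ngt n0.
Qed.

Lemma leq_sqr n m : (n ^ 5 <= m ^ 6)%N -> (n <= m ^ 2)%N.
Proof.
have [->|n0] := posnP n; first by [].
by move=> nm; rewrite -(leq_exp2r _ _ (e := 3)) // -expnM (leq_trans _ nm) // leq_pexp2l.
Qed.

(** The choice b ~ m / sqrt n makes both terms of the last factor O(m^3). With O(m^2 n / b) cells
    this leaves m b = O(n), and squaring gives m^4 = O(n^3). *)
Lemma incidence3_bound D N : exists C, forall m n s,
  (m <= n)%N -> (n ^ 5 <= m ^ 6)%N -> (m ^ 3 <= N * s)%N ->
  (forall b, (0 < b)%N -> (s ^ 2 <= m * m * (2 * D.+1 * (m %/ b + n %/ b).+1) *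
    (2 * D ^ 3 * ((m * b) * (n * b)) + 8 * D * m ^ 3))%N) -> (n <= C)%N.
Proof.
pose P := (2 * D.+1)%N; pose Q := (2 * D ^ 3 + 8 * D)%N.
pose A := (3 * N ^ 2 * P * Q)%N; exists ((4 * A ^ 2) ^ 3)%N => m n s mn nm ms hs.
have [->|n0] := posnP n; first by [].
have m0 : (0 < m)%N by case: m nm {mn ms hs} => //; rewrite exp0n // leqn0 expn_eq0 eqn0Ngt n0.
have nmm : (n <= m * m)%N := leq_sqr nm.
have [b b0 /andP[bm mb]] := block_size n0 nmm.
have {}hs := hs b b0.
have bb : (b <= m)%N.
  have : (b * b <= m * m)%N by apply: leq_trans bm; rewrite leq_pmulr.
  by clear; nia.
have h1 : ((m %/ b + n %/ b).+1 * b <= 3 * n)%N.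
  by move: (leq_divM m b) (leq_divM n b) bb mn; move: (m %/ b)%N (n %/ b)%N; clear; nia.
have h2 : ((m * b) * (n * b) <= m ^ 3)%N.
  by rewrite expnS expnS expn1; move: bm; clear; nia.
have h3 : (s ^ 2 * b <= m * m * P * (3 * n) * (Q * m ^ 3))%N.
  apply: leq_trans (leq_mul hs (leqnn b)) _; rewrite -/P.
  set t := (_ + _).+1 in h1 *; set w := (m * b * _)%N in h2 *.
  apply: (@leq_trans (m * m * P * (t * b) * (2 * D ^ 3 * w + 8 * D * m ^ 3))); first by clear; lia.
  apply: leq_mul; first by rewrite leq_mul2l h1 orbT.
  by rewrite /Q mulnDl leq_add2r leq_mul2l h2 orbT.
have h4 : (m * b <= A * n)%N.
  have : (m ^ 3 * m ^ 3 * b <= N * s * (N * s) * b)%N by rewrite leq_mul2r leq_mul ?orbT.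
  have : (N * s * (N * s) * b <= N ^ 2 * (m * m * P * (3 * n) * (Q * m ^ 3)))%N.
    apply: (@leq_trans (N ^ 2 * (s ^ 2 * b))); first by clear; lia.
    by rewrite leq_mul2l h3 orbT.
  move=> u1 u2; have := leq_trans u2 u1.
  rewrite (_ : m ^ 3 * m ^ 3 * b = m ^ 5 * (m * b))%N; last by clear; ring.
  rewrite (_ : N ^ 2 * _ = m ^ 5 * (A * n))%N; last by rewrite /A; clear; ring.
  by rewrite leq_mul2l expn_eq0 eqn0Ngt m0.
have h5 : (m ^ 4 <= 4 * A ^ 2 * n ^ 3)%N.
  apply: (@leq_trans (m * m * (4 * (b * b * n)))).
    by rewrite (_ : m ^ 4 = m * m * (m * m))%N ?leq_mul2l ?mb ?orbT //; clear; ring.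
  rewrite (_ : m * m * _ = (m * b) * (m * b) * (4 * n))%N; last by clear; ring.
  rewrite (_ : 4 * A ^ 2 * _ = (A * n) * (A * n) * (4 * n))%N; last by clear; ring.
  by rewrite leq_mul2r leq_mul ?orbT.
(* Both relations are raised to reach m^12: the hypothesis becomes n^10 <= m^12, the bound m^12 =
   O(n^9). *)
apply: (@leq_of_leq_expn m n _ 10 12 9) => //.
  by rewrite (expnM n 5 2) (expnM m 6 2) leq_exp2r.
by rewrite (expnM m 4 3) (expnM n 3 3) -expnMn leq_exp2r.
Qed.

(** The choice c ~ sqrt m balances (m c)^2 against m^3 and makes m / c = O(c), so m^8 = O(n^2 m^5
    c). Squaring m^3 = O(n^2 c) gives m^5 = O(n^4). *)
Lemma incidence2_bound D N : exists C, forall m n s,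
  (n ^ 5 <= m ^ 6)%N -> (m ^ 2 <= N * s)%N ->
  (forall c, (0 < c)%N -> (s ^ 4 <= n ^ 2 * (m * m * ((2 * D.+1) ^ 2 * (2 * (m %/ c)).+1) *
    (2 * D ^ 3 * ((m * c) * (m * c)) + 18 * D ^ 4 * m ^ 3)))%N) -> (n <= C)%N.
Proof.
pose P := ((2 * D.+1) ^ 2)%N; pose Q := (2 * D ^ 3 + 18 * D ^ 4)%N.
pose A := (N ^ 4 * P * 9 * Q)%N; exists ((A ^ 2) ^ 6)%N => m n s nm ms hs.
have [->|n0] := posnP n; first by [].
have m0 : (0 < m)%N by case: m nm {ms hs} => //; rewrite exp0n // leqn0 expn_eq0 eqn0Ngt n0.
have [c c0] := block_size (ltn0Sn 0) m0; rewrite !muln1 => /andP[cm mc].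
have {}hs := hs c c0.
have h1 : ((2 * (m %/ c)).+1 <= 9 * c)%N.
  have : (m %/ c * c <= 4 * (c * c))%N by apply: leq_trans mc; exact: leq_divM.
  by move: (m %/ c)%N c0; clear; nia.
have h2 : ((m * c) * (m * c) <= m ^ 3)%N.
  rewrite (_ : m ^ 3 = m * m * m)%N; last by clear; ring.
  by rewrite mulnACA leq_mul2l cm orbT.
have h3 : (s ^ 4 <= n ^ 2 * (m * m * (P * (9 * c)) * (Q * m ^ 3)))%N.
  apply: leq_trans hs _; rewrite leq_mul2l; apply/orP; right.
  apply: leq_mul; first by rewrite leq_mul2l leq_mul2l h1 !orbT.
  by rewrite /Q mulnDl leq_add2r leq_mul2l h2 orbT.
have h4 : (m ^ 3 <= A * n ^ 2 * c)%N.
  have : ((m ^ 2) ^ 4 <= (N * s) ^ 4)%N by rewrite leq_exp2r.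
  have : ((N * s) ^ 4 <= N ^ 4 * (n ^ 2 * (m * m * (P * (9 * c)) * (Q * m ^ 3))))%N.
    by rewrite expnMn leq_mul2l h3 orbT.
  move=> u1 u2; have := leq_trans u2 u1.
  rewrite (_ : (m ^ 2) ^ 4 = m ^ 5 * m ^ 3)%N; last by clear; ring.
  rewrite (_ : N ^ 4 * _ = m ^ 5 * (A * n ^ 2 * c))%N; last by rewrite /A; clear; ring.
  by rewrite leq_mul2l expn_eq0 eqn0Ngt m0.
have h5 : (m ^ 5 <= A ^ 2 * n ^ 4)%N.
  rewrite -(leq_pmul2l m0).
  apply: (@leq_trans ((A * n ^ 2 * c) * (A * n ^ 2 * c))).
    rewrite (_ : m * m ^ 5 = m ^ 3 * m ^ 3)%N; last by clear; ring.
    exact: leq_mul.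
  rewrite (_ : _ * (A * n ^ 2 * c) = c * c * (A ^ 2 * n ^ 4))%N; last by clear; ring.
  by rewrite leq_mul2r cm orbT.
apply: (@leq_of_leq_expn m n _ 25 30 24) => //.
  by rewrite (expnM n 5 5) (expnM m 6 5) leq_exp2r.
by rewrite (expnM m 5 6) (expnM n 4 6) -expnMn leq_exp2r.
Qed.

(** * Choosing subsets of equal size *)

(** The m elements of largest weight are kept: each weighs at least as much as any discarded one, so
    the average does not drop. *)
Lemma subsample (T : eqType) (h : T -> nat) (A : seq T) m : (m <= size A)%N -> exists B,
  [/\ size B = m, uniq A -> uniq B &
      (m * \sum_(a <- A) h a <= size A * \sum_(a <- B) h a)%N].
Proof.
move=> mA; pose r := [rel x y | (h y <= h x)%N]; pose s := sort r A.
have ps : perm_eq A s by rewrite perm_sym perm_sort.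
have rtr : transitive r by move=> y x z /= xy yz; apply: leq_trans yz xy.
have : sorted r s by apply: sort_sorted => x y /=; apply: leq_total.
rewrite (sorted_pairwise rtr) -(cat_take_drop m s) pairwise_cat => /and3P[/allrelP hr _ _].
exists (take m s); split.
- by rewrite size_takel // size_sort.
- by rewrite (perm_uniq ps) => us; apply: take_uniq.
have sz : size A = (m + size (drop m s))%N by rewrite size_drop size_sort subnKC.
have st : size (take m s) = m by rewrite size_takel // size_sort.
have -> : (\sum_(a <- A) h a = \sum_(a <- take m s) h a + \sum_(a <- drop m s) h a)%N.
  by rewrite -big_cat cat_take_drop; apply: perm_big.
rewrite sz mulnDl mulnDr leq_add2l.
have -> : (m * \sum_(a <- drop m s) h a = \sum_(x <- take m s) \sum_(a <- drop m s) h a)%N.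
  by rewrite big_const_seq count_predT st iter_addn_0 mulnC.
have -> : (size (drop m s) * \sum_(a <- take m s) h a =
           \sum_(x <- take m s) \sum_(a <- drop m s) h x)%N.
  rewrite big_distrr /=; apply: eq_bigr => x _.
  by rewrite big_const_seq count_predT iter_addn_0 mulnC.
rewrite big_seq [X in (_ <= X)%N]big_seq; apply: leq_sum => x xB.
rewrite big_seq [X in (_ <= X)%N]big_seq; apply: leq_sum => y yR.
exact: hr.
Qed.

Lemma sorted_indexing (T : realDomainType) (A : seq T) m : uniq A -> size A = m ->
  exists X : 'I_m -> T, [/\ {homo X : i j / (i < j)%N >-> i < j},
    forall a, a \in A -> exists i, a = X i &
    forall h : T -> nat, (\sum_(a <- A) h a = \sum_i h (X i))%N].
Proof.
move=> uA sA; pose s := sort <=%R A.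
have ss : size s = m by rewrite size_sort.
have ps : perm_eq A s by rewrite perm_sym perm_sort.
exists (fun i => nth 0 s i); split.
- move=> i j ij; apply: (sorted_ltn_nth lt_trans) => //; rewrite ?inE ?ss //.
  by rewrite sort_lt_sorted.
- move=> a; rewrite (perm_mem ps) => aS; have := aS; rewrite -index_mem ss => ia.
  by exists (Ordinal ia); rewrite /= nth_index.
by move=> h; rewrite (perm_big _ ps) (big_nth 0) ss big_mkord.
Qed.

Lemma sum_bool_card (T : finType) (P : pred T) : (\sum_p (P p : nat) = #|[set p | P p]|)%N.
Proof. by rewrite -sum1dep_card [RHS]big_mkcond; apply: eq_bigr => p _; case: (P p). Qed.

Lemma subsample3 (T : eqType) (P : T -> T -> T -> nat) (A B C : seq T) m :
  (m <= size A)%N -> (m <= size B)%N -> (m <= size C)%N -> uniq A -> uniq B -> uniq C ->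
  exists A' B' C', [/\ [/\ uniq A', uniq B' & uniq C'],
    [/\ size A' = m, size B' = m & size C' = m] &
    (m ^ 3 * \sum_(a <- A) \sum_(b <- B) \sum_(c <- C) P a b c <=
     size A * size B * size C * \sum_(a <- A') \sum_(b <- B') \sum_(c <- C') P a b c)%N].
Proof.
move=> mA mB mC uA uB uC.
have [A' [sA' /(_ uA) uA' hA]] := subsample (fun a => \sum_(b <- B) \sum_(c <- C) P a b c)%N mA.
have [B' [sB' /(_ uB) uB' hB]] := subsample (fun b => \sum_(a <- A') \sum_(c <- C) P a b c)%N mB.
have [C' [sC' /(_ uC) uC' hC]] := subsample (fun c => \sum_(a <- A') \sum_(b <- B') P a b c)%N mC.
exists A', B', C'; split=> //.
have e1 : (\sum_(a <- A') \sum_(b <- B) \sum_(c <- C) P a b c =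
           \sum_(b <- B) \sum_(a <- A') \sum_(c <- C) P a b c)%N by rewrite exchange_big.
have e2 X Y : (\sum_(b <- X) \sum_(a <- A') \sum_(c <- Y) P a b c =
               \sum_(c <- Y) \sum_(a <- A') \sum_(b <- X) P a b c)%N.
  rewrite exchange_big [RHS]exchange_big /=; apply: eq_bigr => a _; exact: exchange_big.
have e3 : (\sum_(a <- A') \sum_(b <- B') \sum_(c <- C') P a b c =
           \sum_(c <- C') \sum_(a <- A') \sum_(b <- B') P a b c)%N.
  by rewrite [RHS]exchange_big /=; apply: eq_bigr => a _; exact: exchange_big.
rewrite e1 in hA; rewrite (e2 B' C) in hB; rewrite -e3 in hC; move: hA hB hC.
set g0 := (\sum_(a <- A) _)%N; set g1 := (\sum_(b <- B) _)%N; set g2 := (\sum_(c <- C) _)%N.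
set g3 := (\sum_(a <- A') _)%N => h1 h2 h3.
apply: (@leq_trans (m ^ 2 * (size A * g1))).
  by rewrite expnSr -mulnA leq_mul2l h1 orbT.
apply: (@leq_trans (m * size A * (size B * g2))).
  by rewrite (_ : m ^ 2 * _ = m * size A * (m * g1))%N ?leq_mul2l ?h2 ?orbT //; clear; ring.
rewrite (_ : m * size A * _ = size A * size B * (m * g2))%N; last by clear; ring.
by rewrite -[X in (_ <= X)%N]mulnA leq_mul2l h3 orbT.
Qed.

Section RealClosedField.
Variable K : rcfType.

(** * Slices of a trivariate polynomial *)

Definition upd (v : 'I_3 -> K) i x := fun t => if t == i then x else v t.

Definition slice i (v : 'I_3 -> K) : {mpoly K[3]} -> {poly K} :=
  mmap (@polyC K) (fun t => if t == i then 'X else (v t)%:P).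
HB.instance Definition _ i v := GRing.RMorphism.on (slice i v).

Lemma sliceE i v f x : (slice i v f).[x] = f.@[upd v i x].
Proof.
rewrite /slice /meval.
have e c : horner_eval x c%:P = c by rewrite /horner_eval hornerC.
apply: (mmap_morph (phi := horner_eval x) (h' := idfun)) => [c|t]; first exact: e.
by rewrite /upd /= /horner_eval; case: eqP => _; rewrite ?hornerX ?hornerC.
Qed.

Lemma slice_deriv i v f : (slice i v f)^`() = slice i v f^`M(i).
Proof.
apply: (mmap_deriv (d := @deriv K)) => [p q|c|t]; first exact: derivM.
  exact: derivC.
by case: eqP => _ /=; rewrite ?derivX ?derivC.
Qed.

Lemma size_slice i v f : (size (slice i v f) <= msize f)%N.
Proof.
apply: size_mmap => [c|t]; first by rewrite size_polyC leq_b1.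
by case: eqP => _; rewrite ?size_polyX // (leq_trans (size_polyC_leq1 _)).
Qed.

(** The variable i becomes the inner one and j the outer one, so in [P.[y, x]] the value of i is x
    and that of j is y. *)
Definition slice2 i j (v : 'I_3 -> K) : {mpoly K[3]} -> {poly {poly K}} :=
  mmap (@polyC {poly K} \o @polyC K)
    (fun t => if t == i then 'X%:P else if t == j then 'X else (v t)%:P%:P).
HB.instance Definition _ i j v := GRing.RMorphism.on (slice2 i j v).

Section Slice2.
Variables (i j : 'I_3) (v : 'I_3 -> K).
Hypothesis ij : i != j.

Lemma slice2E f x y : (slice2 i j v f).[y, x] = f.@[upd (upd v j y) i x].
Proof.
rewrite /slice2 /meval.
pose phi : {rmorphism {poly {poly K}} -> K} := horner_eval x \o horner_eval y%:P.
apply: (mmap_morph (phi := phi) (h' := idfun)) => [c|t].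
  by rewrite /phi /= /horner_eval !hornerC.
rewrite /upd /phi /= /horner_eval; case: eqP => _; first by rewrite hornerC hornerX.
by case: eqP => _; rewrite ?hornerX !hornerC.
Qed.

Lemma slice2_deriv f : (slice2 i j v f)^`() = slice2 i j v f^`M(j).
Proof.
apply: (mmap_deriv (d := @deriv {poly K})) => [p q|c|t]; first exact: derivM.
  exact: derivC.
case: eqP => [->|_] /=; first by rewrite derivC (negPf ij).
by case: eqP => _ /=; rewrite ?derivX ?derivC.
Qed.

Lemma swap_slice2 f : swapXY (slice2 i j v f) = slice2 j i v f.
Proof.
pose phi : {rmorphism {poly {poly K}} -> {poly {poly K}}} := @swapXY K.
apply: (mmap_morph (phi := phi)) => [c|t]; rewrite /phi /=.
  by rewrite swapXY_polyC map_polyC.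
case: (eqVneq t i) => [->|_]; first by rewrite (negPf ij) swapXY_Y.
by case: eqP => _; rewrite ?swapXY_X // swapXY_polyC map_polyC.
Qed.

Lemma size_slice2 f : (size (slice2 i j v f) <= msize f)%N.
Proof.
apply: size_mmap => [c|t]; first by rewrite size_polyC leq_b1.
by do 2?[case: eqP => _]; rewrite ?size_polyX // (leq_trans (size_polyC_leq1 _)).
Qed.
End Slice2.

Lemma deriv_inner_slice2 i j v f : i != j ->
  deriv_inner (slice2 i j v f) = slice2 i j v f^`M(i).
Proof.
by move=> ij; rewrite /deriv_inner swap_slice2 // slice2_deriv 1?eq_sym // swap_slice2 1?eq_sym.
Qed.

(** There are two base points because the curves are cut out at different heights: [v] and [v'] may
    differ in the third coordinate, while i and j are shared. *)
Lemma nondegenerate_zeros_mpoly i j v v' (P Q : {mpoly K[3]}) D (T : finType)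
    (A : {set T}) (x y : T -> K) : i != j ->
  (msize P <= D.+1)%N -> (msize Q <= D.+1)%N ->
  {in A &, forall s t, x s = x t -> y s = y t -> s = t} ->
  (forall t, t \in A -> let w := upd (upd v j (y t)) i (x t) in
     let w' := upd (upd v' j (y t)) i (x t) in
     [/\ P.@[w] = 0, Q.@[w'] = 0 &
     P^`M(i).@[w] * Q^`M(j).@[w'] - P^`M(j).@[w] * Q^`M(i).@[w'] != 0]) ->
  (#|A| <= 2 * D ^ 3)%N.
Proof.
move=> ij sP sQ inj hA.
have ji : j != i by rewrite eq_sym.
apply: (@nondegenerate_zeros_rcf _ (slice2 i j v P) (slice2 i j v' Q) D T A x y) => //.
- exact: leq_trans (size_slice2 _ _ _ _) sP.
- exact: leq_trans (size_slice2 _ _ _ _) sQ.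
- by rewrite sizeYE swap_slice2 //; apply: leq_trans (size_slice2 _ _ _ _) sP.
- by rewrite sizeYE swap_slice2 //; apply: leq_trans (size_slice2 _ _ _ _) sQ.
by move=> t /hA; rewrite !deriv_inner_slice2 // !slice2_deriv // !slice2E.
Qed.

Lemma nondegenerate_zeros_separated (p1 q1 p2 q2 : {poly K}) D (T : finType)
    (A : {set T}) (x y : T -> K) :
  (size p1 <= D.+1)%N -> (size q1 <= D.+1)%N ->
  (size p2 <= D.+1)%N -> (size q2 <= D.+1)%N ->
  {in A &, forall s t, x s = x t -> y s = y t -> s = t} ->
  (forall t, t \in A -> [/\ p1.[x t] = q1.[y t], p2.[x t] = q2.[y t] &
     p1^`().[x t] * q2^`().[y t] != q1^`().[y t] * p2^`().[x t]]) ->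
  (#|A| <= 2 * D ^ 3)%N.
Proof.
move=> s1 t1 s2 t2 inj hA.
pose S (p q : {poly K}) : {poly {poly K}} := p%:P - q^:P.
have sS (p q : {poly K}) : (size p <= D.+1)%N -> (size q <= D.+1)%N -> (size (S p q) <= D.+1)%N.
  move=> sp sq; apply: leq_trans (size_polyD _ _) _; rewrite size_polyN geq_max.
  by rewrite (leq_trans (size_polyC_leq1 _)) // (leq_trans (size_poly _ _)).
have swS p q : swapXY (S p q) = - S q p.
  by rewrite /S rmorphB /= swapXY_polyC swapXY_map_polyC opprB.
have SE p q u v : (S p q).[v, u] = p.[u] - q.[v].
  by rewrite /S !hornerD !hornerN hornerC horner_map /= hornerC.
have dS p q : (S p q)^`() = - q^`()^:P by rewrite /S derivB derivC deriv_map sub0r.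
have dXS p q : deriv_inner (S p q) = p^`()%:P.
  by rewrite /deriv_inner swS derivN dS opprK swapXY_map_polyC.
apply: (@nondegenerate_zeros_rcf _ (S p1 q1) (S p2 q2) D T A x y) => //.
- exact: sS.
- exact: sS.
- by rewrite sizeYE swS size_polyN sS.
- by rewrite sizeYE swS size_polyN sS.
move=> t /hA[e1 e2 ne]; rewrite !SE e1 e2 !subrr; split=> //.
rewrite !dXS !dS !hornerN !hornerC !horner_map /= !hornerC mulrN mulNr opprK addrC subr_eq0 eq_sym.
exact: ne.
Qed.

(** * Monotone pieces and blocks *)

Definition rootrank (p : {poly K}) (t : K) :=
  count (fun r => r < t) (undup (rootsR p)).

Lemma mem_rootsR (p : {poly K}) r : p != 0 -> (r \in rootsR p) = root p r.
Proof. by move=> p0; have := roots_on_rootsR p0 r; rewrite in_itv /= => ->. Qed.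

Lemma rootrank_le p t : (rootrank p t <= size p)%N.
Proof.
have [->|p0] := eqVneq p 0; first by rewrite /rootrank rootsR0.
apply: leq_trans (count_size _ _) _; apply/ltnW/max_poly_roots => //.
  by apply/allP => r; rewrite mem_undup mem_rootsR.
exact: undup_uniq.
Qed.

Lemma count_lt (T : eqType) (P1 P2 : pred T) (l : seq T) r :
  (forall u, P1 u -> P2 u) -> r \in l -> ~~ P1 r -> P2 r -> (count P1 l < count P2 l)%N.
Proof.
move=> h + n1 p2; have le l' : (count P1 l' <= count P2 l')%N by apply: sub_count.
elim: l => // a l IH; rewrite inE => /orP[/eqP <-|/IH] /=.
  by rewrite (negPf n1) p2 ltnS le.
by have := h a; case: (P1 a) => [-> //|_]; case: (P2 a) => // ?; apply: ltnW.
Qed.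

(* The rank is constant on the intervals between consecutive roots of p', so equal ranks
   put no root of p' in [s, t) and p' has the sign of p'(s) there. *)
Lemma rootrank_mono (p : {poly K}) s t : s < t ->
  rootrank p^`() s = rootrank p^`() t ->
  [\/ 0 < p^`().[s] /\ p.[s] < p.[t], p^`().[s] < 0 /\ p.[t] < p.[s] |
      p^`() = 0 /\ p.[s] = p.[t]].
Proof.
move=> st er; have [c cin ec] := poly_mvt p st; set q := p^`() in er ec *.
have [q0|q0] := eqVneq q 0.
  by apply: Or33; split=> //; move/eqP: ec; rewrite q0 horner0 mul0r subr_eq0 => /eqP ->.
have noroot r : s <= r < t -> ~~ root q r.
  move=> /andP[sr rt]; apply/negP => qr.
  suff : (rootrank q s < rootrank q t)%N by rewrite er ltnn.
  apply: (@count_lt _ _ _ _ r) => //=.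
  - by move=> u us; apply: lt_trans st.
  - by rewrite mem_undup mem_rootsR.
  - by rewrite -leNgt.
move: cin; rewrite in_itv /= => /andP[sc ct].
have : {in `[s, c]%R &, forall x y : K, (0 < q.[x] * q.[y])%R}.
  apply: noroot_noivt => r; rewrite in_itv /= => /andP[sr rc].
  by apply: noroot; rewrite sr (le_lt_trans rc ct).
move/(_ s c); rewrite !in_itv /= !lexx (ltW sc) => /(_ isT isT).
have ts : 0 < t - s by rewrite subr_gt0.
have [qs|qs|->] := ltgtP q.[s] 0; last by rewrite mul0r ltxx.
- rewrite nmulr_rgt0 // => qc; apply: Or32; split=> //.
  by rewrite -subr_lt0 ec pmulr_llt0.
- rewrite pmulr_rgt0 // => qc; apply: Or31; split=> //.
  by rewrite -subr_gt0 ec mulr_gt0.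
Qed.

(** The rank isolates an interval between critical points together with its right end. The boolean
    gives the direction, [true] for increasing, and cuts off the right end of an increasing
    interval, where the derivative is zero. *)
Definition piece D (p : {poly K}) (t : K) : 'I_D.+1 * bool :=
  (inord (rootrank p^`() t), 0 < p^`().[t]).

Arguments piece : simpl never.

Lemma rootrank_piece D (p : {poly K}) s t : (size p <= D.+1)%N ->
  piece D p s = piece D p t -> rootrank p^`() s = rootrank p^`() t.
Proof.
move=> sp [] /(congr1 val) /=.
have lt u : (rootrank p^`() u < D.+1)%N.
  rewrite ltnS; apply: leq_trans (rootrank_le _ _) _.
  have [->|p0] := eqVneq p 0; first by rewrite deriv0 size_poly0.
  by rewrite -ltnS; apply: leq_trans (lt_size_deriv p0) _.
by rewrite !inordK.
Qed.

(** The weak inequalities admit constant polynomials, whose pieces carry [false]: a trivariate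
    polynomial may become constant when restricted to a line. *)
Lemma piece_monoW D (p : {poly K}) s t : (size p <= D.+1)%N ->
  piece D p s = piece D p t -> s < t ->
  if (piece D p s).2 then p.[s] <= p.[t] else p.[t] <= p.[s].
Proof.
move=> sp e st /=; case: (rootrank_mono st (rootrank_piece sp e)).
- by move=> [-> /ltW].
- by move=> [/ltW]; rewrite leNgt => /negPf -> /ltW.
- by move=> [_ ->]; case: ifP.
Qed.

Lemma piece_mono D (p : {poly K}) s t : (size p <= D.+1)%N -> p^`() != 0 ->
  piece D p s = piece D p t -> s < t ->
  if (piece D p s).2 then p.[s] < p.[t] else p.[t] < p.[s].
Proof.
move=> sp p0 e st /=; case: (rootrank_mono st (rootrank_piece sp e)).
- by move=> [-> ?].
- by move=> [/ltW]; rewrite leNgt => /negPf ->.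
- by move=> [p'0]; rewrite p'0 eqxx in p0.
Qed.

(** Lets the Jacobian be treated as a polynomial in one coordinate at a time, without forming a
    polynomial in four variables. *)
Definition polyfun D (g : K -> K) :=
  exists2 p : {poly K}, (size p <= D.+1)%N & forall t, g t = p.[t].

Lemma polyfun_ext D g h : g =1 h -> polyfun D g -> polyfun D h.
Proof. by move=> e [p sp hp]; exists p => // t; rewrite -e hp. Qed.

Lemma polyfunM D E g h : polyfun D g -> polyfun E h -> polyfun (D + E) (fun t => g t * h t).
Proof.
move=> [p sp hp] [q sq hq]; exists (p * q) => [|t]; last by rewrite hp hq hornerM.
apply: leq_trans (size_polyMleq _ _) _; move: sp sq.
by move: (size p) (size q) => a b; lia.
Qed.

Lemma polyfunB D g h : polyfun D g -> polyfun D h -> polyfun D (fun t => g t - h t).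
Proof.
move=> [p sp hp] [q sq hq]; exists (p - q) => [|t]; last by rewrite hp hq hornerD hornerN.
by apply: leq_trans (size_polyD _ _) _; rewrite size_polyN geq_max sp sq.
Qed.

Lemma polyfun_upd i v (f : {mpoly K[3]}) D : (msize f <= D.+1)%N ->
  polyfun D (fun t => f.@[upd v i t]).
Proof.
move=> sf; exists (slice i v f); first exact: leq_trans (size_slice _ _ _) sf.
by move=> t; rewrite sliceE.
Qed.

Lemma card_polyfun_zeros m D g (X : 'I_m -> K) t0 : injective X -> polyfun D g ->
  g t0 != 0 -> (#|[set a | g (X a) == 0%R]| <= D)%N.
Proof.
move=> Xi [p sp hp] g0; rewrite -ltnS; apply: leq_trans sp.
apply: (card_roots_le (h := X)); last by move=> a; rewrite inE hp => /eqP; rewrite rootE => ->.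
  by apply: contra_neq g0 => p0; rewrite hp p0 horner0.
exact: in2W.
Qed.

(** Adds one coordinate: where [G t t0] vanishes all m values are allowed, elsewhere a nonzero
    polynomial has at most D zeros. *)
Lemma schwartz_zippel_step m (T : finType) D (G : T -> K -> K) (X : 'I_m -> K) t0 :
  injective X -> (forall t, polyfun D (G t)) ->
  (#|[set p : T * 'I_m | G p.1 (X p.2) == 0%R]|
    <= #|[set t | G t t0 == 0%R]| * m + D * #|T|)%N.
Proof.
move=> Xi hG; set W := [set t | G t t0 == 0]; set Z := [set p | _].
rewrite -(cardsID [set p : T * 'I_m | p.1 \in W] Z); apply: leq_add.
  rewrite -[m in leqRHS]card_ord -cardsT -cardsX; apply: subset_leq_card.
  by apply/subsetP => p; rewrite !inE andbT => /andP[].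
set A := _ :\: _.
apply: leq_trans (card_le_fiber (g := fst) (k := D) _) _; last first.
  by rewrite leq_mul2l max_card orbT.
move=> t; have [tW|tW] := boolP (G t t0 == 0).
  suff -> : [set p in A | p.1 == t] = set0 by rewrite cards0.
  apply/setP => p; rewrite !inE.
  by apply/negP => /andP[/andP[+ _]] /eqP e; rewrite e tW.
apply: leq_trans (card_polyfun_zeros Xi (hG t) tW).
rewrite -(card_in_imset (f := snd)); last first.
  by move=> [a b] [c d]; rewrite !inE /= => /andP[_ /eqP ->] /andP[_ /eqP ->] ->.
apply/subset_leq_card/subsetP => _ /imsetP[p + ->]; rewrite !inE.
by move=> /andP[/andP[_ h] /eqP <-].
Qed.

Lemma card_same_block m b : (0 < b)%N ->
  (#|[set p : 'I_m * 'I_m | (p.1 %/ b == p.2 %/ b)%N]| <= m * b)%N.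
Proof.
move=> b0; apply: leq_trans (card_le_fiber (g := fst) (k := b) _) _; last first.
  rewrite mulnC; apply: leq_mul => //.
  by apply: leq_trans (max_card _) _; rewrite card_ord.
move=> c; pose h (p : 'I_m * 'I_m) : 'I_b := Ordinal (ltn_pmod p.2 b0).
rewrite -(card_in_imset (f := h)); first by rewrite (leq_trans (max_card _)) // card_ord.
move=> [a d] [a' d']; rewrite !inE /= => /andP[/eqP e /eqP ea] /andP[/eqP e' /eqP ea'].
move=> /(congr1 val) /= em; congr pair; first by rewrite ea ea'.
by apply: val_inj => /=; rewrite (divn_eq d b) (divn_eq d' b) em -e -e' ea ea'.
Qed.

(* Index of a cell (a, b) along a monotone staircase: distinct cells of one staircase have
   distinct indices. *)
Definition stair (s : bool) (N a b : nat) : nat := (if s then a + b else a + (N - b))%N.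

Lemma stair_inj s N a b a' b' : (b <= N)%N -> (b' <= N)%N -> (a <= a')%N ->
  (if s then b <= b' else b' <= b)%N -> stair s N a b = stair s N a' b' ->
  a = a' /\ b = b'.
Proof. by rewrite /stair; case: s => *; lia. Qed.

Lemma homo_leq m (X : 'I_m -> K) : {homo X : a b / (a < b)%N >-> a < b} ->
  {mono X : a b / (a <= b)%N >-> a <= b}.
Proof.
move=> h a b; have [|ba] := leqP a b; last by apply/negbTE; rewrite -ltNge h.
by rewrite leq_eqVlt => /orP[/eqP/val_inj ->|/h/ltW //]; rewrite lexx.
Qed.

Lemma homo_inj m (X : 'I_m -> K) : {homo X : a b / (a < b)%N >-> a < b} -> injective X.
Proof.
move=> h a b e; apply/val_inj/eqP; rewrite eqn_leq.
by rewrite -!(homo_leq h) e lexx.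
Qed.

(** * Incidences of a polynomial in three variables *)

Lemma msize_mderiv n (A : nzRingType) i (f : {mpoly A[n]}) : (msize f^`M(i) <= (msize f).-1)%N.
Proof.
rewrite msizeE; apply/bigmax_leqP_seq => m + _.
rewrite mcoeff_msupp mcoeff_mderiv => h.
have : (m + U_(i))%MM \in msupp f.
  by rewrite mcoeff_msupp; apply: contra_neq h => ->; rewrite mul0rn.
by move/msize_mdeg_lt; rewrite mdegD mdeg1 addn1; case: (msize f).
Qed.

Lemma ord3_cases (i j k t : 'I_3) : i != j -> i != k -> j != k -> [\/ t = i, t = j | t = k].
Proof.
move=> ij ik jk; have [->|ti] := eqVneq t i; first exact: Or31.
have [->|tj] := eqVneq t j; first exact: Or32.
apply: Or33; apply: val_inj; move: ij ik jk ti tj; rewrite -!val_eqE /=.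
by case: i j k t => [[|[|[|?]]] ?] [[|[|[|?]]] ?] [[|[|[|?]]] ?] [[|[|[|?]]] ?].
Qed.

Definition pt3 (i j : 'I_3) (x y z : K) : 'I_3 -> K := upd (upd (fun=> z) j y) i x.

Definition jacobian i j (f : {mpoly K[3]}) x y z z' : K :=
  f^`M(i).@[pt3 i j x y z] * f^`M(j).@[pt3 i j x y z']
  - f^`M(j).@[pt3 i j x y z] * f^`M(i).@[pt3 i j x y z'].

Section Pt3.
Variables (i j k : 'I_3).
Hypotheses (ij : i != j) (ik : i != k) (jk : j != k).

Lemma pt3_updj x y z : pt3 i j x y z =1 upd (upd (fun=> z) i x) j y.
Proof.
move=> t; rewrite /pt3 /upd; case: (eqVneq t i) => [->|//].
by rewrite (negPf ij).
Qed.

Lemma pt3_updk x y z z0 : pt3 i j x y z =1 upd (pt3 i j x y z0) k z.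
Proof.
move=> t; rewrite /pt3 /upd.
case: (ord3_cases t ij ik jk) => ->; rewrite ?eqxx ?(negPf ij) ?(negPf ik) ?(negPf jk) //.
by rewrite !(eq_sym k) (negPf ik) (negPf jk).
Qed.

Lemma pt3E (w : 'I_3 -> K) : w =1 pt3 i j (w i) (w j) (w k).
Proof.
move=> t; rewrite /pt3 /upd.
case: (ord3_cases t ij ik jk) => ->; rewrite ?eqxx // ?(eq_sym j i) ?(negPf ij) //.
by rewrite !(eq_sym k) (negPf ik) (negPf jk).
Qed.

(** The Jacobian has degree at most 2 D in each of its four arguments, and each argument contributes
    2 D m^3. *)
Lemma card_jacobian_zeros D f m (X : 'I_3 -> 'I_m -> K) x0 y0 z0 w0 :
  (msize f <= D.+1)%N -> (forall t, injective (X t)) ->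
  jacobian i j f x0 y0 z0 w0 != 0 ->
  (#|[set q : 'I_m * 'I_m * 'I_m * 'I_m |
      jacobian i j f (X i q.1.1.1) (X j q.1.1.2) (X k q.1.2) (X k q.2) == 0%R]|
   <= 8 * D * m ^ 3)%N.
Proof.
move=> sf Xi J0.
have sd t : (msize f^`M(t) <= D.+1)%N.
  by apply: leq_trans (msize_mderiv _ _) _; apply: leq_trans (leq_pred _) sf.
have px t y z : polyfun D (fun x => f^`M(t).@[pt3 i j x y z]) by apply: polyfun_upd.
have py t x z : polyfun D (fun y => f^`M(t).@[pt3 i j x y z]).
  apply: polyfun_ext (polyfun_upd j (upd (fun=> z) i x) (sd t)) => y.
  exact/esym/meval_eq/pt3_updj.
have pz t x y : polyfun D (fun z => f^`M(t).@[pt3 i j x y z]).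
  apply: polyfun_ext (polyfun_upd k (pt3 i j x y 0) (sd t)) => z.
  exact/esym/meval_eq/pt3_updk.
have pc c : polyfun D (fun=> c).
  by exists c%:P => [|t]; rewrite ?hornerC // (leq_trans (size_polyC_leq1 _)).
have qx y z w : polyfun (D + D) (fun x => jacobian i j f x y z w).
  by apply: polyfunB; apply: polyfunM; apply: px.
have qy x z w : polyfun (D + D) (fun y => jacobian i j f x y z w).
  by apply: polyfunB; apply: polyfunM; apply: py.
have qz x y w : polyfun (D + D) (fun z => jacobian i j f x y z w).
  by apply: polyfunB; apply: polyfunM; first [apply: pz | apply: pc].
have qw x y z : polyfun (D + D) (fun w => jacobian i j f x y z w).
  by apply: polyfunB; apply: polyfunM; first [apply: pz | apply: pc].
have N1 := card_polyfun_zeros (Xi i) (qx y0 z0 w0) J0.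
have N2 := @schwartz_zippel_step _ _ _ (fun a y => jacobian i j f (X i a) y z0 w0) (X j) y0
  (Xi j) (fun a => qy (X i a) z0 w0).
have N3 := @schwartz_zippel_step _ _ _
  (fun (a : 'I_m * 'I_m) z => jacobian i j f (X i a.1) (X j a.2) z w0) (X k) z0
  (Xi k) (fun a => qz (X i a.1) (X j a.2) w0).
have N4 := @schwartz_zippel_step _ _ _
  (fun (a : 'I_m * 'I_m * 'I_m) w => jacobian i j f (X i a.1.1) (X j a.1.2) (X k a.2) w) (X k) w0
  (Xi k) (fun a => qw (X i a.1.1) (X j a.1.2) (X k a.2)).
rewrite !(card_prod, card_ord) /= in N2 N3 N4.
have ar c1 c2 c3 E : (c1 <= E -> c2 <= c1 * m + E * m -> c3 <= c2 * m + E * (m * m) ->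
    c3 * m + E * (m * m * m) <= 4 * E * m ^ 3)%N.
  move=> h1 h2 h3; have h2' : (c2 <= 2 * E * m)%N by nia.
  have h3' : (c3 <= 3 * E * (m * m))%N by nia.
  by rewrite !expnS expn0; nia.
apply: leq_trans N4 _; apply: leq_trans (ar _ _ _ _ N1 N2 N3) _.
by rewrite leq_mul2r; apply/orP; right; lia.
Qed.
End Pt3.

Lemma msize_subC n (A : nzRingType) (f : {mpoly A[n]}) c D :
  (msize f <= D.+1)%N -> (msize (f - c%:MP) <= D.+1)%N.
Proof.
move=> sf; apply: leq_trans (msizeD_le _ _) _; rewrite geq_max sf msizeN msizeC.
by case: (c != 0).
Qed.

Lemma eq_inord m b (c c' : 'I_m) :
  ((inord (c %/ b) : 'I_m.+1) == inord (c' %/ b)) = (c %/ b == c' %/ b)%N.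
Proof. by rewrite -val_eqE /= !inordK // ltnS (leq_trans (leq_div _ _)) // ltnW. Qed.

Section Incidence3.
Variables (D : nat) (f : {mpoly K[3]}) (i j k : 'I_3) (m n b : nat).
Variables (X : 'I_3 -> 'I_m -> K) (delta : 'I_n -> K).
Variables (S : {set {ffun 'I_3 -> 'I_m}}) (lab : {ffun 'I_3 -> 'I_m} -> 'I_n).
Hypotheses (ij : i != j) (ik : i != k) (jk : j != k).
Hypotheses (sf : (msize f <= D.+1)%N) (b0 : (0 < b)%N).
Hypothesis Xlt : forall t, {homo X t : a c / (a < c)%N >-> a < c}.
Hypothesis dlt : {homo delta : a c / (a < c)%N >-> a < c}.
Hypothesis hS : forall s, s \in S -> f.@[fun t => X t (s t)] = delta (lab s).

Let Xi t : injective (X t) := homo_inj (@Xlt t).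
(* Cauchy-Schwarz bounds |S|^2 by the number of occupied cells times the number of pairs of points
   in a common cell.  For fixed coordinates i and j the points lie on the graph of the univariate
   polynomial [fibre s]; along each of its monotone pieces the occupied blocks form a staircase.
   A pair of points in a common cell gives a common zero of the two curves f(., ., z) = w and
   f(., ., z') = w', nondegenerate unless the jacobian vanishes. *)
Let cellp (s : {ffun 'I_3 -> 'I_m}) : 'I_m * 'I_m * ('I_m.+1 * 'I_n.+1) :=
  (s i, s j, (inord (s k %/ b), inord (lab s %/ b)))%N.
Let fibre s := slice k (pt3 i j (X i (s i)) (X j (s j)) 0) f.
Let stairp (s : {ffun 'I_3 -> 'I_m}) :
    'I_m * 'I_m * ('I_D.+1 * bool) * 'I_(m %/ b + n %/ b).+1 :=
  let p := piece D (fibre s) (X k (s k)) in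
  (s i, s j, p, inord (stair p.2 (n %/ b) (s k %/ b) (lab s %/ b)))%N.

Let fibreE s : s \in S -> (fibre s).[X k (s k)] = delta (lab s).
Proof.
move=> sS; rewrite /fibre sliceE -hS //; apply: meval_eq => t.
by rewrite -pt3_updk // -(pt3E ij ik jk (fun t => X t (s t))).
Qed.

Let stair_le s N a c M : (a <= M)%N -> (c <= N)%N -> (stair s N a c < (M + N).+1)%N.
Proof. by rewrite /stair; case: s => h1 h2; rewrite ltnS leq_add // leq_subr. Qed.

Let stair_cell_le s s' : s \in S -> s' \in S -> (s k <= s' k)%N ->
  stairp s = stairp s' -> cellp s = cellp s'.
Proof.
move=> sS s'S le [ei ej e1 e2 /(congr1 val)] /=.
have ef : fibre s = fibre s' by rewrite /fibre ei ej.
have ep : piece D (fibre s) (X k (s k)) = piece D (fibre s) (X k (s' k)).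
  by rewrite /piece e1 e2 ef.
have dv (c : 'I_m) : (c %/ b <= m %/ b)%N by rewrite leq_div2r // ltnW.
have dn (c : 'I_n) : (c %/ b <= n %/ b)%N by rewrite leq_div2r // ltnW.
rewrite !inordK ?stair_le // -e2 => est.
(* [delta] is increasing, so along a monotone piece the index [lab] moves in the same direction as
   the value of the fibre. *)
have mono : if 0 < (fibre s)^`().[X k (s k)] then (lab s <= lab s')%N else (lab s' <= lab s)%N.
  move: le; rewrite leq_eqVlt => /orP[/eqP/val_inj ek|lt].
    suff -> : lab s = lab s' by case: ifP.
    by apply: (homo_inj dlt); rewrite -!fibreE // ef ek.
  have := piece_monoW (leq_trans (size_slice _ _ _) sf) ep (@Xlt k _ _ lt).
  have -> : (fibre s).[X k (s' k)] = delta (lab s') by rewrite ef fibreE.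
  rewrite /= fibreE //.
  by case: ifP; rewrite homo_leq.
have [||||ek el] := stair_inj _ _ _ _ est; rewrite ?dn //.
- by rewrite leq_div2r.
- by move: mono; case: ifP => _ h; rewrite leq_div2r.
by rewrite /cellp ei ej ek el.
Qed.

Let card_cells : (#|cellp @: S| <= m * m * (2 * D.+1 * (m %/ b + n %/ b).+1))%N.
Proof.
apply: leq_trans (leq_card_imset (g := stairp) _) _.
  move=> s s' sS s'S e; have [le|/ltnW le] := leqP (s k) (s' k).
    exact: stair_cell_le.
  exact/esym/(stair_cell_le s'S sS le)/esym.
apply: leq_trans (max_card _) _; rewrite !(card_prod, card_ord, card_bool).
by rewrite -!mulnA leq_mul2l; apply/orP; right; rewrite leq_mul2l (mulnCA 2) leqnn orbT.
Qed.

Variables (x0 y0 z0 w0 : K).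
Hypothesis J0 : jacobian i j f x0 y0 z0 w0 != 0.

Let pairs := [set p : _ * _ | [&& p.1 \in S, p.2 \in S & cellp p.1 == cellp p.2]].
Let degenerate := [set p : {ffun 'I_3 -> 'I_m} * {ffun 'I_3 -> 'I_m} |
  jacobian i j f (X i (p.1 i)) (X j (p.1 j)) (X k (p.1 k)) (X k (p.2 k)) == 0%R].

Let pairsP p : p \in pairs -> [/\ p.1 \in S, p.2 \in S, p.1 i = p.2 i, p.1 j = p.2 j &
  (p.1 k %/ b == p.2 k %/ b)%N && (lab p.1 %/ b == lab p.2 %/ b)%N].
Proof.
rewrite inE => /and3P[s1 s2]; rewrite /cellp !xpair_eqE !eq_inord => /andP[/andP[/eqP ei /eqP ej] h].
by split.
Qed.

Let ffun_eq (s s' : {ffun 'I_3 -> 'I_m}) : s i = s' i -> s j = s' j -> s k = s' k -> s = s'.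
Proof. by move=> ei ej ek; apply/ffunP => t; case: (ord3_cases t ij ik jk) => ->. Qed.

Let card_degenerate : (#|pairs :&: degenerate| <= 8 * D * m ^ 3)%N.
Proof.
pose h (p : {ffun 'I_3 -> 'I_m} * {ffun 'I_3 -> 'I_m}) := (p.1 i, p.1 j, p.1 k, p.2 k).
rewrite -(card_in_imset (f := h)); last first.
  move=> [p p'] [q q'] /setIP[/pairsP[_ _ /= pi pj _] _] /setIP[/pairsP[_ _ /= qi qj _] _].
  by move=> [] /= ei ej ek ek'; congr pair; apply: ffun_eq => //; congruence.
apply: leq_trans (card_jacobian_zeros ij ik jk sf Xi J0).
apply/subset_leq_card/subsetP => _ /imsetP[p /setIP[_ +] ->].
by rewrite !inE.
Qed.

Let card_nondegenerate : (#|pairs :\: degenerate| <= 2 * D ^ 3 * ((m * b) * (n * b)))%N.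
Proof.
(* The two heights and the two values determine the two plane curves. Closeness within blocks bounds
   the number of such data. *)
pose g (p : {ffun 'I_3 -> 'I_m} * {ffun 'I_3 -> 'I_m}) := ((p.1 k, p.2 k), (lab p.1, lab p.2)).
apply: leq_trans (card_le_fiber (g := g) (k := (2 * D ^ 3)%N) _) _; last first.
  rewrite leq_mul2l; apply/orP; right.
  apply: leq_trans (leq_mul (card_same_block m b0) (card_same_block n b0)).
  rewrite -cardsX; apply/subset_leq_card/subsetP => _ /imsetP[p /setDP[/pairsP[_ _ _ _ /andP[h1 h2]] _] ->].
  by rewrite !inE h1 h2.
move=> u.
pose xi (p : {ffun 'I_3 -> 'I_m} * {ffun 'I_3 -> 'I_m}) := X i (p.1 i).
pose yj (p : {ffun 'I_3 -> 'I_m} * {ffun 'I_3 -> 'I_m}) := X j (p.1 j).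
apply: (@nondegenerate_zeros_mpoly i j (fun=> X k u.1.1) (fun=> X k u.1.2)
  (f - (delta u.2.1)%:MP) (f - (delta u.2.2)%:MP) D _ _ xi yj) => //; try exact: msize_subC.
  move=> [p p'] [q q'].
  move=> /setIdP[/setDP[hp _] /eqP up] /setIdP[/setDP[hq _] /eqP uq] /Xi /= ei /Xi /= ej.
  have [_ _ /= pi pj _] := pairsP hp; have [_ _ /= qi qj _] := pairsP hq.
  by move: up; rewrite -uq => -[ek ek' _ _]; congr pair; apply: ffun_eq => //; congruence.
move=> p /setIdP[/setDP[hp dp] /eqP <-]; rewrite inE in dp.
have [s1 s2 ei ej _] := pairsP hp.
rewrite /= !mderivB !mderivC !subr0; split; last exact: dp.
  rewrite mevalB mevalC -hS // (meval_eq _ (pt3E ij ik jk (fun t => X t (p.1 t)))).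
  by rewrite /pt3 /xi /yj subrr.
rewrite mevalB mevalC -hS // (meval_eq _ (pt3E ij ik jk (fun t => X t (p.2 t)))).
by rewrite /pt3 /xi /yj ei ej subrr.
Qed.

Lemma incidence3 : (#|S| ^ 2 <= m * m * (2 * D.+1 * (m %/ b + n %/ b).+1) *
  (2 * D ^ 3 * ((m * b) * (n * b)) + 8 * D * m ^ 3))%N.
Proof.
apply: leq_trans (card_collisions S cellp) _; apply: leq_mul; first exact: card_cells.
rewrite -/pairs -(cardsID degenerate pairs) addnC.
exact: leq_add card_nondegenerate card_degenerate.
Qed.
End Incidence3.

(** * Incidences of a polynomial in two variables *)

Lemma msize_mulD n (A : idomainType) (p q : {mpoly A[n]}) a b :
  (msize p <= a.+1)%N -> (msize q <= b.+1)%N -> (msize (p * q) <= (a + b).+1)%N.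
Proof.
have [->|p0] := eqVneq p 0; first by rewrite mul0r msize0.
have [->|q0] := eqVneq q 0; first by rewrite mulr0 msize0.
by rewrite msizeM //; lia.
Qed.

Lemma msize_subD n (A : nzRingType) (p q : {mpoly A[n]}) a :
  (msize p <= a)%N -> (msize q <= a)%N -> (msize (p - q) <= a)%N.
Proof.
by move=> sp sq; apply: leq_trans (msizeD_le _ _) _; rewrite geq_max msizeN sp sq.
Qed.

Lemma piece_lt D (p : {poly K}) s t : (size p <= D.+1)%N -> p^`() != 0 ->
  piece D p s = piece D p t ->
  (p.[s] < p.[t]) = (if (piece D p s).2 then s < t else t < s).
Proof.
move=> sp p0 e; case: (ltgtP s t) => [st|ts|->]; last by rewrite ltxx if_same.
  by have := piece_mono sp p0 e st; case: ifP => _ // h; apply/negbTE; rewrite -leNgt ltW.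
have := piece_mono sp p0 (esym e) ts; rewrite -e; case: ifP => _ // h.
by apply/negbTE; rewrite -leNgt ltW.
Qed.

Lemma piece_inj D (p : {poly K}) s t : (size p <= D.+1)%N -> p^`() != 0 ->
  piece D p s = piece D p t -> p.[s] = p.[t] -> s = t.
Proof.
move=> sp p0 e est; have := piece_lt sp p0 e; have := piece_lt sp p0 (esym e).
by rewrite -e est ltxx; case: ifP => _; case: ltgtP.
Qed.

Section Incidence2.
Variables (D : nat) (f : {mpoly K[3]}) (i j : 'I_3) (v : 'I_3 -> K) (m n c : nat).

(* Up to sign, the numerator of the mixed logarithmic derivative of f_i / f_j: it vanishes
   identically when f_i / f_j is a product of functions of one variable each. *)
Definition separation : {mpoly K[3]} :=
  let fx := f^`M(i) in let fy := f^`M(j) in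
  let fxx := fx^`M(i) in let fxy := fx^`M(j) in let fyy := fy^`M(j) in
  fx ^+ 2 * (fxy^`M(j) * fy - fxy * fyy) - fy ^+ 2 * (fxy^`M(i) * fx - fxy * fxx).

Variables (al be : 'I_m -> K) (delta : 'I_n -> K).
Variables (S : {set 'I_m * 'I_m}) (lab : 'I_m * 'I_m -> 'I_n).
Let ev (g : {mpoly K[3]}) (s : 'I_m * 'I_m) := g.@[upd (upd v j (be s.2)) i (al s.1)].
Hypotheses (ij : i != j) (sf : (msize f <= D.+1)%N) (c0 : (0 < c)%N).
Hypothesis ali : injective al.
Hypothesis belt : {homo be : a b / (a < b)%N >-> a < b}.
Hypothesis hS : forall s, s \in S -> ev f s = delta (lab s).
Hypothesis hS0 : forall s, s \in S ->
  [/\ ev f^`M(i) s != 0, ev f^`M(j) s != 0 & ev separation s != 0].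

Let bei : injective be := homo_inj belt.
Notation quad := (('I_m * 'I_m) * ('I_m * 'I_m))%type.
(* Cauchy-Schwarz twice: first over the values of f, producing quadruples with
   f(a, b) = f(a', b'), then, for fixed (a, a'), over the cells of the plane of (b, b').  A pair of
   quadruples in a common cell is a common zero, in (a, a'), of two separated equations.  When that
   zero is degenerate, the vanishing of its jacobian is a new equation for (b, b'), and when it is
   degenerate as well, the last jacobian that can be formed is controlled by [separation]. *)
Let quads := [set q : quad | [&& q.1 \in S, q.2 \in S & lab q.1 == lab q.2]].

Let col (g : {mpoly K[3]}) (a : 'I_m) := slice j (upd v i (al a)) g.
Let row (g : {mpoly K[3]}) (b : 'I_m) := slice i (upd v j (be b)) g.

Let colE g a b : (col g a).[be b] = ev g (a, b).
Proof.
rewrite /col sliceE; apply: meval_eq => t; rewrite /upd /=.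
by case: (eqVneq t i) => [->|//]; rewrite (negPf ij).
Qed.

Let rowE g a b : (row g b).[al a] = ev g (a, b).
Proof. by rewrite /row sliceE. Qed.

Let size_col a : (size (col f a) <= D.+1)%N.
Proof. exact: leq_trans (size_slice _ _ _) sf. Qed.

Let col_deriv s : s \in S -> (col f s.1)^`() != 0.
Proof.
case: s => a b /= sS; have [_ + _] := hS0 sS; apply: contra_neq => e.
by rewrite -colE /col -slice_deriv -/(col f a) e horner0.
Qed.

Let quadP q : q \in quads -> [/\ q.1 \in S, q.2 \in S & ev f q.1 = ev f q.2].
Proof. by rewrite inE => /and3P[s1 s2 /eqP e]; split=> //; rewrite !hS // e. Qed.

Let cellp (q : quad) : 'I_m * 'I_m * ('I_m.+1 * 'I_m.+1) :=
  (q.1.1, q.2.1, (inord (q.1.2 %/ c), inord (q.2.2 %/ c)))%N.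
Let stairp (q : quad) :
    'I_m * 'I_m * (('I_D.+1 * bool) * ('I_D.+1 * bool)) * 'I_(m %/ c + m %/ c).+1 :=
  let p := piece D (col f q.1.1) (be q.1.2) in
  let p' := piece D (col f q.2.1) (be q.2.2) in
  (q.1.1, q.2.1, (p, p'),
   inord (stair (p.2 == p'.2) (m %/ c) (q.1.2 %/ c) (q.2.2 %/ c)))%N.

Let stair_cell_le q r : q \in quads -> r \in quads -> (q.1.2 <= r.1.2)%N ->
  stairp q = stairp r -> cellp q = cellp r.
Proof.
case: q r => [[a b] [a' b']] [[a2 b2] [a2' b2']] /quadP /= [s1 s2 e] /quadP /= [r1 r2 e'] le.
move=> est; have ea : a = a2 := congr1 (fun t => t.1.1.1) est.
have ea' : a' = a2' := congr1 (fun t => t.1.1.2) est; subst a2 a2'.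
pose p := piece D (col f a) (be b); pose p' := piece D (col f a') (be b').
pose r := piece D (col f a) (be b2); pose r' := piece D (col f a') (be b2').
have ep : p = r := congr1 (fun t => t.1.2.1) est.
have ep' : p' = r' := congr1 (fun t => t.1.2.2) est.
have : inord (stair (p.2 == p'.2) (m %/ c) (b %/ c) (b' %/ c)) =
       inord (stair (r.2 == r'.2) (m %/ c) (b2 %/ c) (b2' %/ c)) :> 'I_(m %/ c + m %/ c).+1.
  exact: (congr1 snd est).
move/(congr1 (@nat_of_ord _)); rewrite -ep -ep' {est}.
have dv (u : 'I_m) : (u %/ c <= m %/ c)%N by rewrite leq_div2r // ltnW.
have sl s N u w M : (u <= M)%N -> (w <= N)%N -> (stair s N u w < (M + N).+1)%N.
  by rewrite /stair; case: s => h1 h2; rewrite ltnS leq_add // leq_subr.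
rewrite !inordK ?sl // => est.
have d1 := col_deriv s1; have d2 := col_deriv s2.
(* On monotone pieces f(a, b) = f(a', b') makes b' a monotone function of b, increasing exactly when
   the two pieces have the same direction. *)
have mono : if p.2 == p'.2 then (b' <= b2')%N else (b2' <= b')%N.
  rewrite -!colE in e e'.
  move: le; rewrite leq_eqVlt => /orP[/eqP/val_inj eb|/belt lt].
    suff -> : b' = b2' by case: ifP.
    by apply/bei/(piece_inj (size_col a') d2 ep'); rewrite -e -e' eb.
  have := piece_lt (size_col a) d1 ep; have := piece_lt (size_col a) d1 (esym ep).
  rewrite -/p -/r -ep e e' lt (lt_gtF lt).
  rewrite (piece_lt (size_col a') d2 ep') (piece_lt (size_col a') d2 (esym ep')).
  rewrite -/p' -/r' -ep' -!(homo_leq belt) !leNgt.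
  by case: p.2; case: p'.2 => /= h1 h2; rewrite ?h1 ?h2.
have [||||ek el] := stair_inj _ _ _ _ est; rewrite ?dv //.
- by rewrite leq_div2r.
- by move: mono; case: ifP => _ h; rewrite leq_div2r.
by rewrite /cellp /= ek el.
Qed.
Let card_cells :
  (#|cellp @: quads| <= m * m * ((2 * D.+1) ^ 2 * (2 * (m %/ c)).+1))%N.
Proof.
apply: leq_trans (leq_card_imset (g := stairp) _) _.
  move=> s s' sS s'S e; have [le|/ltnW le] := leqP s.1.2 s'.1.2.
    exact: stair_cell_le.
  exact/esym/(stair_cell_le s'S sS le)/esym.
apply: leq_trans (max_card _) _; rewrite !(card_prod, card_ord, card_bool) addnn -mul2n.
by rewrite -!mulnA leq_mul2l; apply/orP; right; rewrite leq_mul2l; apply/orP; right; nia.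
Qed.

Let pairs := [set p : quad * quad |
  [&& p.1 \in quads, p.2 \in quads & cellp p.1 == cellp p.2]].
(** For quadruples (a, b, a', b') and (a, b2, a', b2'), [degJ] is the vanishing of the Jacobian in
    (a, a') of the two equations. [degW] is the vanishing of the Jacobian in (b, b') of f(a, b) =
    f(a', b') and the equation of [degJ], with the second quadruple fixed. *)
Let degJ := [set p : quad * quad |
  ev f^`M(i) p.1.1 * ev f^`M(i) p.2.2 == ev f^`M(i) p.1.2 * ev f^`M(i) p.2.1].
Let degW := [set p : quad * quad |
  ev f^`M(j) p.1.2 * ev f^`M(i) p.2.2 * ev f^`M(i)^`M(j) p.1.1 ==
  ev f^`M(i)^`M(j) p.1.2 * ev f^`M(i) p.2.1 * ev f^`M(j) p.1.1].

Let pairsP p : p \in pairs -> [/\ p.1 \in quads, p.2 \in quads,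
  p.1.1.1 = p.2.1.1, p.1.2.1 = p.2.2.1 &
  (p.1.1.2 %/ c == p.2.1.2 %/ c)%N && (p.1.2.2 %/ c == p.2.2.2 %/ c)%N].
Proof.
rewrite inE => /and3P[s1 s2]; rewrite /cellp !xpair_eqE !eq_inord.
by move=> /andP[/andP[/eqP ei /eqP ej] h]; split.
Qed.

Let card_nondegenerate : (#|pairs :\: degJ| <= 2 * D ^ 3 * ((m * c) * (m * c)))%N.
Proof.
pose g (p : quad * quad) := ((p.1.1.2, p.2.1.2), (p.1.2.2, p.2.2.2)).
apply: leq_trans (card_le_fiber (g := g) (k := (2 * D ^ 3)%N) _) _; last first.
  rewrite leq_mul2l; apply/orP; right.
  apply: leq_trans (leq_mul (card_same_block m c0) (card_same_block m c0)).
  rewrite -cardsX; apply/subset_leq_card/subsetP => _ /imsetP[p /setDP[/pairsP[_ _ _ _ /andP[h1 h2]] _] ->].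
  by rewrite !inE h1 h2.
move=> u; pose x (p : quad * quad) := al p.1.1.1; pose y (p : quad * quad) := al p.1.2.1.
have sr b : (size (row f b) <= D.+1)%N by apply: leq_trans (size_slice _ _ _) sf.
apply: (@nondegenerate_zeros_separated (row f u.1.1) (row f u.2.1) (row f u.1.2) (row f u.2.2)
  D _ _ x y) => //.
  move=> p q /setIdP[/setDP[/pairsP[_ _ p1 p2 _] _] /eqP up].
  move=> /setIdP[/setDP[/pairsP[_ _ q1 q2 _] _] /eqP uq] /ali e1 /ali e2.
  move: p q p1 p2 q1 q2 e1 e2 up uq.
  move=> [[[? ?] [? ?]] [[? ?] [? ?]]] [[[? ?] [? ?]] [[? ?] [? ?]]] /=.
  by rewrite /g /= => *; subst; congruence.
move=> p /setIdP[/setDP[hp + /eqP <-]]; rewrite inE => J0.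
have [/quadP[_ _ e1] /quadP[_ _ e2] a1 a2 _] := pairsP hp.
rewrite /x /y /= /row !slice_deriv -!/(row _ _); split.
- by rewrite !rowE; case: (p.1) e1 => [[? ?] [? ?]].
- by rewrite a1 a2 !rowE; case: (p.2) e2 => [[? ?] [? ?]].
move: J0; rewrite {2}a1 {1}a2 !rowE.
by move: a1 a2; case: (p.1) (p.2) => [[? ?] [? ?]] [[? ?] [? ?]] /= -> ->.
Qed.

Let card_col_fibre (T : finType) (A : {set T}) (s : 'I_m * 'I_m) (y : T -> 'I_m) e :
  s \in S -> {in A &, injective y} -> (forall t, t \in A -> (col f s.1).[be (y t)] = e) ->
  (#|A| <= D)%N.
Proof.
move=> sS yi hA; have d := col_deriv sS.
have p0 : col f s.1 - e%:P != 0.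
  by apply: contra_neq d => h; rewrite -[col f s.1](subrK e%:P) h add0r derivC.
rewrite -ltnS; apply: (@leq_trans (size (col f s.1 - e%:P)%R)).
  apply: (card_roots_le (h := fun t => be (y t)) p0).
    by move=> t u tA uA /bei; apply: yi.
  by move=> t tA; rewrite rootE !hornerE hA // subrr.
apply: leq_trans (size_polyD _ _) _; rewrite size_polyN geq_max size_col.
by rewrite (leq_trans (size_polyC_leq1 _)).
Qed.

Let card_quads : (#|quads| <= D * m ^ 3)%N.
Proof.
pose g (q : quad) := (q.1, q.2.1).
apply: leq_trans (card_le_fiber (g := g) (k := D) _) _; last first.
  by rewrite leq_mul2l (leq_trans (max_card _)) ?orbT // !card_prod !card_ord !expnS expn0; lia.
move=> u; have [->|[q0]] := set_0Vmem [set q in quads | g q == u]; first by rewrite cards0.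
move=> /setIdP[/quadP[_ s2 _] /eqP g0].
apply: (@card_col_fibre _ _ q0.2 (fun q : quad => q.2.2) (ev f u.1)) => //.
  move=> [q1 [q2 q3]] [r1 [r2 r3]] /setIdP[_ /eqP <-] /setIdP[_ /eqP []] /= -> -> ->.
  by [].
move=> [q1 [q2 q3]] /setIdP[/quadP[_ _ /= e] /eqP gq].
by have -> : q0.2.1 = q2; [move: g0; rewrite -gq => -[] | rewrite colE -e -gq].
Qed.

(** The second quadruple has at most D m^3 choices and determines (a, a'); then (b, b') is a
    nondegenerate zero of two separated equations. *)
Let card_degenerate1 : (#|(pairs :&: degJ) :\: degW| <= 2 * D ^ 3 * (D * m ^ 3))%N.
Proof.
apply: leq_trans (card_le_fiber (g := snd) (k := (2 * D ^ 3)%N) _) _; last first.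
  rewrite leq_mul2l; apply/orP; right; apply: leq_trans card_quads.
  apply/subset_leq_card/subsetP => _ /imsetP[p /setDP[/setIP[/pairsP[_ h _ _ _] _] _] ->].
  exact: h.
move=> u; pose x (p : quad * quad) := be p.1.1.2; pose y (p : quad * quad) := be p.1.2.2.
have sc a : (size (col f a) <= D.+1)%N by apply: leq_trans (size_slice _ _ _) sf.
have sc' a e : (size (e *: col f^`M(i) a) <= D.+1)%N.
  apply: leq_trans (size_scale_leq _ _) _; apply: leq_trans (size_slice _ _ _) _.
  by apply: leq_trans (msize_mderiv _ _) _; apply: leq_trans (leq_pred _) sf.
apply: (@nondegenerate_zeros_separated (col f u.1.1) (col f u.2.1)
  (ev f^`M(i) u.2 *: col f^`M(i) u.1.1) (ev f^`M(i) u.1 *: col f^`M(i) u.2.1) D _ _ x y) => //.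
  move=> p q /setIdP[/setDP[/setIP[/pairsP[_ _ p1 p2 _] _] _] /eqP up].
  move=> /setIdP[/setDP[/setIP[/pairsP[_ _ q1 q2 _] _] _] /eqP uq] /bei e1 /bei e2.
  move: p q p1 p2 q1 q2 e1 e2 up uq.
  move=> [[[? ?] [? ?]] [[? ?] [? ?]]] [[[? ?] [? ?]] [[? ?] [? ?]]] /=.
  by move=> *; subst; congruence.
move=> p /setIdP[/setDP[/setIP[hp]]]; rewrite !inE => /eqP J0 W0 /eqP <-.
have [/quadP[_ _ e1] /quadP[_ _ e2] a1 a2 _] := pairsP hp.
rewrite /x /y /= !derivZ /col !slice_deriv -!/(col _ _) !hornerZ -a1 -a2 !colE.
move: e1 J0 W0; case: (p.1) => [[a b] [a' b']] /= e1 J0 W0; split=> //.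
  by rewrite mulrC J0 mulrC.
by apply: contra_neq W0 => h; apply: (etrans _ (etrans (esym h) _)); ring.
Qed.

(** The first quadruple and b2 leave at most D values of b2'. For fixed (a', b') and b2, the point
    (a, b) is a nondegenerate common zero of curves of degree at most 2 D, whence D * 2 (2 D)^3 = 16
    D^4. *)
Let card_degenerate2 : (#|pairs :&: degJ :&: degW| <= 16 * D ^ 4 * m ^ 3)%N.
Proof.
pose g (p : quad * quad) := (p.1, p.2.1.2).
apply: leq_trans (card_le_fiber (g := g) (k := D) _) _.
  move=> u; have [->|[q0]] := set_0Vmem [set q in pairs :&: degJ :&: degW | g q == u].
    by rewrite cards0.
  move=> /setIdP[/setIP[/setIP[/pairsP[_ /quadP[_ s0 _] _ b0 _] _] _] /eqP g0].
  apply: (@card_col_fibre _ _ q0.2.2 (fun q : quad * quad => q.2.2.2) (ev f (u.1.1.1, u.2))) => //.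
    move=> p q /setIdP[/setIP[/setIP[/pairsP[_ _ p1 p2 _] _] _] /eqP up].
    move=> /setIdP[/setIP[/setIP[/pairsP[_ _ q1 q2 _] _] _] /eqP uq].
    move: p q p1 p2 q1 q2 up uq.
    move=> [[[? ?] [? ?]] [[? ?] [? ?]]] [[[? ?] [? ?]] [[? ?] [? ?]]] /=.
    by rewrite /g /= => *; subst; congruence.
  move=> p /setIdP[/setIP[/setIP[/pairsP[_ /quadP[_ _ e] p1 p2 _] _] _] /eqP up].
  have -> : q0.2.2.1 = p.2.2.1 by rewrite -b0 -p2; move: g0; rewrite -up => -[->].
  rewrite colE -up /= p1; move: e; case: (p.2) => [[? ?] [? ?]] /= -> //.
set A := g @: _; pose h (t : quad * 'I_m) := (t.1.2, t.2).
have : (#|A| <= 2 * (2 * D) ^ 3 * #|h @: A|)%N; last first.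
  have : (#|h @: A| <= m ^ 3)%N.
    by apply: leq_trans (max_card _) _; rewrite !card_prod !card_ord !expnS expn0; lia.
  move=> h1 h2; apply: (@leq_trans (D * (2 * (2 * D) ^ 3 * m ^ 3))%N).
    by rewrite leq_mul2l (leq_trans h2) ?orbT // leq_mul2l h1 orbT.
  by rewrite !expnS !expn0; lia.
apply: card_le_fiber => u.
pose x (t : quad * 'I_m) := al t.1.1.1; pose y (t : quad * 'I_m) := be t.1.1.2.
set fx := f^`M(i); set fy := f^`M(j); set fxy := fx^`M(j).
(* Eliminating the second quadruple from [degJ] and [degW] leaves the condition that fxy / (fx fy)
   takes the same value at (a, b) and (a', b'). With (a', b') fixed, it reads [Q] = 0. *)
pose Q := (ev fx u.1 * ev fy u.1)%:MP * fxy - (ev fxy u.1)%:MP * (fx * fy).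
have sd (w : {mpoly K[3]}) t : (msize w <= D.+1)%N -> (msize w^`M(t) <= D.+1)%N.
  by move=> sg; apply: leq_trans (msize_mderiv _ _) _; apply: leq_trans (leq_pred _) sg.
have sfx : (msize fx <= D.+1)%N by apply: sd.
have sfy : (msize fy <= D.+1)%N by apply: sd.
have sfxy : (msize fxy <= D.+1)%N by apply: sd.
have sC (e : K) : (msize (e%:MP_[3]) <= 1)%N by rewrite msizeC; case: eqP.
apply: (@nondegenerate_zeros_mpoly i j v v (f - (ev f u.1)%:MP) Q (2 * D) _ _ x y) => //.
- by apply: msize_subC; apply: leq_trans sf _; rewrite ltnS; lia.
- apply: msize_subD.
    by apply: leq_trans (msize_mulD (sC _) sfxy) _; rewrite ltnS; lia.
  apply: leq_trans (msize_mulD (sC _) (msize_mulD sfx sfy)) _.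
  by rewrite ltnS; lia.
- move=> [[[a b] q] t] [[[a2 b2] q2] t2] /setIdP[_ /eqP <-] /setIdP[_ /eqP] [] /= -> ->.
  by rewrite /x /y /= => /ali -> /bei ->.
move=> t /setIdP[/imsetP[p /setIP[/setIP[hp]]]]; rewrite !inE => /eqP J0 /eqP W0 -> /eqP eu.
have {eu} eu : u.1 = p.1.2 by rewrite -eu.
have [/quadP[s1 s2 e1] /quadP[s3 s4 e2] a1 a2 _] := pairsP hp.
have [x1 y1 E1] := hS0 s1; have [x2 y2 _] := hS0 s2; have [x4 _ _] := hS0 s4.
have eQ : ev fx p.1.2 * ev fy p.1.2 * ev fxy p.1.1 = ev fxy p.1.2 * (ev fx p.1.1 * ev fy p.1.1).
  apply: (mulfI x4); move: J0 W0; rewrite -/fx -/fy -/fxy => J0 W0.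
  transitivity (ev fx p.1.2 * (ev fy p.1.2 * ev fx p.2.2 * ev fxy p.1.1)); first by ring.
  rewrite W0; transitivity (ev fxy p.1.2 * ev fy p.1.1 * (ev fx p.1.2 * ev fx p.2.1)); first by ring.
  by rewrite -J0; ring.
have evE w : w.@[upd (upd v j (y (g p))) i (x (g p))] = ev w p.1.1 by [].
rewrite /= !evE {evE} /Q !eu; split.
- by rewrite /ev mevalB mevalC -!/(ev _ _) e1 subrr.
- by rewrite /ev !(mevalB, mevalM, mevalC) -!/(ev _ _) eQ subrr.
have -> : (f - (ev f p.1.2)%:MP)^`M(i) = fx by rewrite mderivB mderivC subr0.
have -> : (f - (ev f p.1.2)%:MP)^`M(j) = fy by rewrite mderivB mderivC subr0.
rewrite !mderivB !mderiv_mulC !mderivM -[fy^`M(i)]mderiv_comm -/fxy.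
apply: contra_neq E1 => N0.
apply: (mulfI (mulf_neq0 x2 y2)); rewrite mulr0.
move: N0 eQ; rewrite /separation -/fx -/fy -/fxy /ev.
rewrite !expr2 !(mevalB, mevalM, mevalD, mevalC) -!/(ev _ _).
move: (ev fx p.1.1) (ev fy p.1.1) (ev fx p.1.2 * ev fy p.1.2) (ev fxy p.1.2) => a b k1 k2.
set N := (X in X = 0 -> _) => N0 eQ.
(* Where [Q] vanishes, fx fy times the Jacobian [N] of f and [Q] is the separation times the nonzero
   constant [k1]. *)
transitivity (N * (a * b) + (k2 * (a * b) - k1 * ev fxy p.1.1)
  * (a ^+ 2 * ev fy^`M(j) p.1.1 - b ^+ 2 * ev fx^`M(i) p.1.1)); first by rewrite /N; ring.
by rewrite N0 eQ subrr !mul0r addr0.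
Qed.

Lemma incidence2 : (#|S| ^ 4 <= n ^ 2 * (m * m * ((2 * D.+1) ^ 2 * (2 * (m %/ c)).+1) *
  (2 * D ^ 3 * ((m * c) * (m * c)) + 18 * D ^ 4 * m ^ 3)))%N.
Proof.
have h1 := card_collisions S lab.
have h2 := card_collisions quads cellp.
have hl : (#|lab @: S| <= n)%N by apply: leq_trans (max_card _) _; rewrite card_ord.
have hT : (#|pairs| <= 2 * D ^ 3 * ((m * c) * (m * c)) + 18 * D ^ 4 * m ^ 3)%N.
  rewrite -(cardsID degJ pairs) -(cardsID degW (pairs :&: degJ)) addnC.
  apply: leq_add card_nondegenerate _.
  apply: leq_trans (leq_add card_degenerate2 card_degenerate1) _.
  by rewrite mulnA -(mulnA 2) -expnSr -mulnDl -mulnDl.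
rewrite (_ : 4 = 2 * 2)%N // expnM.
apply: (@leq_trans ((n * #|quads|) ^ 2)%N).
  by rewrite leq_exp2r //; apply: leq_trans h1 _; rewrite leq_mul2r hl orbT.
rewrite expnMn leq_mul2l; apply/orP; right; apply: leq_trans h2 _.
exact: leq_mul card_cells hT.
Qed.
End Incidence2.

(** * Polynomials in one of the variables *)

Lemma poly_eq0_everywhere (p : {poly K}) : (forall x, p.[x] = 0) -> p = 0.
Proof.
move=> h; apply/eqP; apply: contraT => p0.
have := @max_poly_roots _ p [seq k%:R | k <- iota 0 (size p)] p0.
rewrite size_map size_iota ltnn; apply.
  by apply/allP => x _; rewrite rootE h.
by rewrite map_inj_uniq ?iota_uniq // => a b /eqP; rewrite eqr_nat => /eqP.
Qed.

Section Univariate.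
Variable i : 'I_3.
Implicit Types f g : {mpoly K[3]}.

(* f seen as a polynomial in the variable i, with coefficients not involving it *)
Fact unipoly_key : unit. Proof. by []. Qed.
Definition unipoly : {mpoly K[3]} -> {poly {mpoly K[3]}} := locked_with unipoly_key
  (mmap (@polyC {mpoly K[3]} \o @mpolyC 3 K) (fun t => if t == i then 'X else ('X_t)%:P)).

Lemma unipolyE : unipoly =
  mmap (@polyC {mpoly K[3]} \o @mpolyC 3 K) (fun t => if t == i then 'X else ('X_t)%:P).
Proof. by rewrite /unipoly unlock. Qed.

Lemma unipoly_is_zmod_morphism : zmod_morphism unipoly.
Proof. by move=> p q; rewrite unipolyE; apply: rmorphB. Qed.

Lemma unipoly_is_monoid_morphism : monoid_morphism unipoly.
Proof. by rewrite unipolyE; split; [apply: rmorph1 | move=> p q; apply: rmorphM]. Qed.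

HB.instance Definition _ := GRing.isZmodMorphism.Build {mpoly K[3]} {poly {mpoly K[3]}}
  unipoly unipoly_is_zmod_morphism.
HB.instance Definition _ := GRing.isMonoidMorphism.Build {mpoly K[3]} {poly {mpoly K[3]}}
  unipoly unipoly_is_monoid_morphism.

Lemma map_mderivM j (p q : {poly {mpoly K[3]}}) :
  map_poly (mderiv j) (p * q) = map_poly (mderiv j) p * q + p * map_poly (mderiv j) q.
Proof.
apply/polyP => k; rewrite coef_map /= coefD !coefM raddf_sum -big_split /=.
by apply: eq_bigr => l _; rewrite mderivM !coef_map.
Qed.

Lemma map_mderivX j : map_poly (mderiv j) ('X : {poly {mpoly K[3]}}) = 0.
Proof.
apply/polyP => k; rewrite coef_map coefX coef0.
rewrite (_ : (k == 1%N)%:R = ((k == 1%N)%:R)%:MP); first exact: mderivC.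
by rewrite rmorph_nat.
Qed.

Lemma mderivXU n (A : nzRingType) (s t : 'I_n) :
  ('X_s : {mpoly A[n]})^`M(t) = (s == t)%:R.
Proof.
rewrite mderivX mnm1E; case: eqP => [->|_]; last by rewrite scale0r.
have -> : (U_(t) - U_(t) = 0)%MM by apply/mnmP => u; rewrite !mnmE subnn.
by rewrite scale1r mpolyX0.
Qed.

Lemma unipolyC c : unipoly c%:MP = c%:MP%:P.
Proof. by rewrite unipolyE mmapC. Qed.

Lemma unipolyX t : unipoly 'X_t = if t == i then 'X else ('X_t)%:P.
Proof. by rewrite unipolyE mmapX mmap1U. Qed.

Lemma unipoly_deriv f : (unipoly f)^`() = unipoly f^`M(i).
Proof.
rewrite unipolyE; apply: (mmap_deriv (d := @deriv {mpoly K[3]})) => [p q|c|t]; first exact: derivM.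
  exact: derivC.
by case: eqP => _ /=; rewrite ?derivX ?derivC.
Qed.

Lemma unipoly_mderiv j f : j != i ->
  map_poly (mderiv j) (unipoly f) = unipoly f^`M(j).
Proof.
move=> ji; pose d : {additive {poly {mpoly K[3]}} -> {poly {mpoly K[3]}}} := map_poly (mderiv j).
rewrite unipolyE; apply: (mmap_deriv (d := d)) => [p q|c|t]; first exact: map_mderivM.
  by rewrite /d /= map_polyC /= mderivC.
rewrite /d /=; case: eqP => [->|_]; first by rewrite map_mderivX eq_sym (negPf ji).
by rewrite map_polyC /= mderivXU rmorph_nat.
Qed.

Lemma slice_unipoly v f : slice i v f = map_poly (meval v) (unipoly f).
Proof.
rewrite unipolyE; apply/esym; apply: (mmap_morph (phi := map_poly (meval v))) => [c|t] /=.
  by rewrite map_polyC /= mevalC.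
by case: eqP => _; rewrite ?map_polyX ?map_polyC /= ?mevalXU.
Qed.
Lemma unipolyK f : (unipoly f).['X_i] = f.
Proof.
elim/mpoly_ringind: f => [c|t|p q ep eq|p q ep eq].
- by rewrite unipolyC hornerC.
- by rewrite unipolyX; case: eqP => [->|_]; rewrite ?hornerX ?hornerC.
- by rewrite rmorphD hornerD ep eq.
by rewrite rmorphM hornerM ep eq.
Qed.

Lemma unipoly_eq0 f : (unipoly f == 0) = (f == 0).
Proof.
apply/eqP/eqP => [e|->]; last exact: rmorph0.
by rewrite -[f]unipolyK e horner0.
Qed.

Lemma coef_unipoly_mderiv f k : ((unipoly f)`_k)^`M(i) = 0.
Proof.
suff : map_poly (mderiv i) (unipoly f) = 0 by move=> /polyP/(_ k); rewrite coef_map coef0.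
elim/mpoly_ringind: f => [c|t|p q ep eq|p q ep eq].
- by rewrite unipolyC map_polyC /= mderivC.
- rewrite unipolyX; case: eqP => [_|/eqP ti]; first exact: map_mderivX.
  by rewrite map_polyC /= mderivXU (negPf ti).
- by rewrite rmorphD raddfD /= ep eq addr0.
by rewrite rmorphM map_mderivM ep eq mul0r mulr0 addr0.
Qed.

Lemma coef_unipoly_mderivN j f k : j != i -> ((unipoly f)`_k)^`M(j) = (unipoly f^`M(j))`_k.
Proof. by move=> ji; rewrite -unipoly_mderiv // coef_map. Qed.

End Univariate.

Lemma mpolyC_mderiv0 (f : {mpoly K[3]}) : (forall t, f^`M(t) = 0) -> f = (f@_0)%:MP.
Proof.
move=> h; apply/mpolyP => m; rewrite mcoeffC.
have [->|m0] := eqVneq m 0%MM; first by rewrite mulr1.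
rewrite mulr0.
have [t mt] : exists t, m t != 0%N.
  apply/existsP; apply: contraT; rewrite negb_exists => /forallP hm.
  case/eqP: m0; apply/mnmP => t; rewrite mnm0E; apply/eqP; move: (hm t).
  by rewrite negbK.
have := mcoeff_mderiv t f (m - U_(t)); rewrite h mcoeff0 submK ?lep1mP //.
by move/esym/eqP; rewrite mulrn_eq0 /= => /eqP.
Qed.

(** A coefficient with respect to one variable also vanishes everywhere, and no longer involves that
    variable; three extractions leave a constant. *)
Lemma mpoly_eq0_everywhere (f : {mpoly K[3]}) : (forall v, f.@[v] = 0) -> f = 0.
Proof.
have co i (g : {mpoly K[3]}) k : (forall v, g.@[v] = 0) ->
    forall v, ((unipoly i g)`_k).@[v] = 0.
  move=> h v; rewrite -(coef_map (meval v)) -slice_unipoly.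
  by rewrite (_ : slice i v g = 0) ?coef0 //; apply: poly_eq0_everywhere => x; rewrite sliceE h.
have un i (g : {mpoly K[3]}) : (forall k, (unipoly i g)`_k = 0) -> g = 0.
  by move=> h; apply/eqP; rewrite -(unipoly_eq0 i); apply/eqP/polyP => k; rewrite h coef0.
pose o0 : 'I_3 := ord0; pose o1 : 'I_3 := @Ordinal 3 1 isT; pose o2 : 'I_3 := @Ordinal 3 2 isT.
move=> h; apply: (un o0) => k0; apply: (un o1) => k1; apply: (un o2) => k2.
set g := (unipoly o2 _)`_k2.
have hg : forall v, g.@[v] = 0 by do 3!apply: (co _ _ _).
have dg t : g^`M(t) = 0.
  have [->|->|->] := @ord3_cases o0 o1 o2 t isT isT isT.
  - by rewrite 2?coef_unipoly_mderivN // coef_unipoly_mderiv !(rmorph0, coef0).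
  - by rewrite coef_unipoly_mderivN // coef_unipoly_mderiv !(rmorph0, coef0).
  - by rewrite coef_unipoly_mderiv.
have e0 : g@_0 = 0 by rewrite -(@mevalC 3 K (fun=> 0) (g@_0)) -mpolyC_mderiv0 ?hg.
by rewrite [LHS](mpolyC_mderiv0 dg) e0 mpolyC0.
Qed.

Section Lift.
Variable i : 'I_3.

Fact lift_poly_key : unit. Proof. by []. Qed.
Definition lift_poly : {poly K} -> {mpoly K[3]} :=
  locked_with lift_poly_key (horner_eval 'X_i \o map_poly (@mpolyC 3 K)).

Lemma lift_polyE : lift_poly = horner_eval 'X_i \o map_poly (@mpolyC 3 K).
Proof. by rewrite /lift_poly unlock. Qed.

Lemma lift_poly_is_zmod_morphism : zmod_morphism lift_poly.
Proof. by move=> p q; rewrite lift_polyE; apply: rmorphB. Qed.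

Lemma lift_poly_is_monoid_morphism : monoid_morphism lift_poly.
Proof. by rewrite lift_polyE; split; [apply: rmorph1 | move=> p q; apply: rmorphM]. Qed.

HB.instance Definition _ := GRing.isZmodMorphism.Build {poly K} {mpoly K[3]}
  lift_poly lift_poly_is_zmod_morphism.
HB.instance Definition _ := GRing.isMonoidMorphism.Build {poly K} {mpoly K[3]}
  lift_poly lift_poly_is_monoid_morphism.

Lemma lift_polyC c : lift_poly c%:P = c%:MP.
Proof. by rewrite lift_polyE /= map_polyC /horner_eval hornerC. Qed.

Lemma lift_polyX : lift_poly 'X = 'X_i.
Proof. by rewrite lift_polyE /= map_polyX /horner_eval hornerX. Qed.

Lemma meval_lift p v : (lift_poly p).@[v] = p.[v i].
Proof.
elim/poly_ind: p => [|p c IH]; first by rewrite rmorph0 meval0 horner0.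
rewrite rmorphD rmorphM /= lift_polyC lift_polyX mevalD mevalM mevalC mevalXU IH.
by rewrite hornerMXaddC.
Qed.

Lemma lift_poly_deriv p : (lift_poly p)^`M(i) = lift_poly p^`().
Proof.
elim/poly_ind: p => [|p c IH]; first by rewrite rmorph0 mderiv0 deriv0 rmorph0.
rewrite rmorphD rmorphM /= lift_polyC lift_polyX mderivD mderivM mderivC mderivXU eqxx IH.
by rewrite derivD derivC derivM derivX !addr0 mulr1 rmorphD rmorphM /= lift_polyX mulr1.
Qed.

Lemma lift_poly_derivN j p : j != i -> (lift_poly p)^`M(j) = 0.
Proof.
move=> ji; elim/poly_ind: p => [|p c IH]; first by rewrite rmorph0 mderiv0.
rewrite rmorphD rmorphM /= lift_polyC lift_polyX mderivD mderivM mderivC mderivXU IH.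
by rewrite eq_sym (negPf ji) mulr0 mul0r !addr0.
Qed.

Lemma lift_poly_inj : injective lift_poly.
Proof.
move=> p q e; apply/eqP; rewrite -subr_eq0; apply/eqP/poly_eq0_everywhere => x.
rewrite hornerD hornerN; have /(congr1 (meval (fun=> x))) := e.
by rewrite !meval_lift => ->; rewrite subrr.
Qed.

Lemma lift_poly_eq0 p : (lift_poly p == 0) = (p == 0).
Proof. by rewrite -(inj_eq lift_poly_inj) rmorph0. Qed.

Lemma unipoly_lift p : unipoly i (lift_poly p) = map_poly (@mpolyC 3 K) p.
Proof.
elim/poly_ind: p => [|p c IH]; first by rewrite !rmorph0.
rewrite !rmorphD !rmorphM /= lift_polyC lift_polyX IH map_polyX map_polyC /=.
by rewrite unipolyC unipolyX eqxx.
Qed.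

Lemma unipoly_liftN j p : j != i -> unipoly j (lift_poly p) = (lift_poly p)%:P.
Proof.
move=> ji; elim/poly_ind: p => [|p c IH]; first by rewrite !rmorph0.
rewrite !rmorphD !rmorphM /= lift_polyC lift_polyX IH.
by rewrite unipolyC unipolyX eq_sym (negPf ji).
Qed.

Lemma slice_lift v p : slice i v (lift_poly p) = p.
Proof.
apply/eqP; rewrite -subr_eq0; apply/eqP/poly_eq0_everywhere => x.
by rewrite hornerD hornerN sliceE meval_lift /upd eqxx subrr.
Qed.
End Lift.

(** * Polynomials with vanishing Wronskian *)

Lemma mpoly_char0 k : k.+1%:R != 0 :> {mpoly K[3]}.
Proof. by rewrite -mpolyC_nat mpolyC_eq0 pnatr_eq0. Qed.

Section Proportional.
Variables (A : idomainType) (char0 : forall k, k.+1%:R != 0 :> A).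
Implicit Types p q : {poly A}.

Lemma lead_coef_deriv p : (1 < size p)%N ->
  size p^`() = (size p).-1 /\ lead_coef p^`() = lead_coef p *+ (size p).-1.
Proof.
move=> sp; have [k ek] : exists k, size p = k.+2 by exists (size p).-2; lia.
have lc : p^`()`_k = lead_coef p *+ k.+1 by rewrite coef_deriv lead_coefE ek.
have lc0 : p^`()`_k != 0.
  rewrite lc -mulr_natr mulf_neq0 // lead_coef_eq0.
  by apply: contraTneq sp => ->; rewrite size_poly0.
have sz : size p^`() = k.+1.
  apply/eqP; rewrite eqn_leq -ltnS -ek lt_size_deriv -?size_poly_gt0 ?ek //=.
  by rewrite ltnNge; apply: contra lc0 => /leq_sizeP/(_ k (leqnn k)) ->.
by rewrite sz ek /=; split=> //; rewrite lead_coefE sz.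
Qed.

Lemma deriv_eq0_size p : p^`() = 0 -> (size p <= 1)%N.
Proof.
move=> p0; rewrite leqNgt; apply/negP => sp; have [s _] := lead_coef_deriv sp.
by move: s; rewrite p0 size_poly0; lia.
Qed.

Lemma wronskian0_size p q : p != 0 -> q != 0 -> p^`() * q = p * q^`() -> size p = size q.
Proof.
wlog: p q / (size p <= size q)%N.
  move=> W p0 q0 e; have [le|/ltnW le] := leqP (size p) (size q); first exact: W.
  by apply/esym/W => //; rewrite mulrC -e mulrC.
move=> le p0 q0 e; have sp : (0 < size p)%N by rewrite size_poly_gt0.
have [q1|q1] := leqP (size q) 1; first by lia.
have [sq' lq'] := lead_coef_deriv q1.
have q'0 : q^`() != 0 by rewrite -size_poly_gt0 sq'; lia.
have [p1|p1] := leqP (size p) 1.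
  have p'0 : p^`() = 0 by rewrite (size1_polyC p1) derivC.
  by move/eqP: e; rewrite p'0 mul0r eq_sym mulf_eq0 (negPf p0) (negPf q'0).
have [sp' lp'] := lead_coef_deriv p1.
have /(congr1 lead_coef) := e; rewrite !lead_coefM lp' lq' mulrnAl mulrnAr => /eqP.
rewrite -[X in X == _]mulr_natr -[X in _ == X]mulr_natr.
have lpq0 : lead_coef p * lead_coef q != 0 by rewrite mulf_neq0 ?lead_coef_eq0.
rewrite (inj_eq (mulfI lpq0)) => /eqP en.
have : ((size q).-1 - (size p).-1)%:R = 0 :> A by rewrite natrB ?en ?subrr //; lia.
case es : ((size q).-1 - (size p).-1)%N => [|k]; first by lia.
by move/eqP; rewrite (negPf (char0 k)).
Qed.

(** The combination [w] that cancels the leading terms also has zero Wronskian with q. If nonzero it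
    would have the degree of q, but its coefficient there is zero. *)
Lemma wronskian0_proportional p q : q != 0 -> p^`() * q = p * q^`() ->
  lead_coef q *: p = lead_coef p *: q.
Proof.
move=> q0 e; have [->|p0] := eqVneq p 0; first by rewrite lead_coef0 scaler0 scale0r.
have s := wronskian0_size p0 q0 e.
apply/eqP; rewrite -subr_eq0; set w := _ - _; apply: contraT => w0.
have : size w = size q.
  apply: wronskian0_size => //; rewrite /w derivB !derivZ !mulrBl -!scalerAl e.
  by rewrite [q^`() * q]mulrC.
have : w`_(size q).-1 = 0.
  by rewrite coefB !coefZ -s -lead_coefE s -lead_coefE mulrC subrr.
by rewrite -[X in _ -> X = _ -> _]/(size w) => w1 sw; move: w0; rewrite -lead_coef_eq0 lead_coefE sw w1 eqxx.
Qed.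
End Proportional.

(** * Additive form *)

Definition compose (g : {poly K}) (u : {mpoly K[3]}) : {mpoly K[3]} :=
  (map_poly (@mpolyC 3 K) g).[u].

Lemma meval_compose g u v : (compose g u).@[v] = g.[u.@[v]].
Proof.
rewrite /compose; elim/poly_ind: g => [|g c IH]; first by rewrite rmorph0 !horner0 meval0.
rewrite rmorphD rmorphM /= map_polyX map_polyC !hornerE mevalD mevalM IH mevalC.
by [].
Qed.

Lemma composeD g h u : compose (g + h) u = compose g u + compose h u.
Proof. by rewrite /compose rmorphD hornerD. Qed.

Lemma composeC c u : compose c%:P u = c%:MP.
Proof. by rewrite /compose map_polyC hornerC. Qed.

Lemma composeZXn c e u : compose (c *: 'X^e) u = c *: u ^+ e.
Proof.
rewrite /compose -mul_polyC rmorphM /= map_polyC map_polyXn hornerM hornerC hornerXn.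
by rewrite mul_mpolyC.
Qed.

Lemma mderiv_compose t g u : (compose g u)^`M(t) = compose g^`() u * u^`M(t).
Proof.
rewrite /compose; elim/poly_ind: g => [|g c IH].
  by rewrite deriv0 rmorph0 horner0 mderiv0 mul0r.
rewrite derivD derivM derivX derivC addr0 mulr1 !rmorphD !rmorphM /=.
rewrite map_polyX map_polyC !hornerD !hornerM !hornerX !hornerC.
by rewrite mderivD mderivM mderivC IH addr0; ring.
Qed.

Lemma poly_antideriv (g : {poly K}) : exists h : {poly K}, h^`() = g.
Proof.
exists (\poly_(n < (size g).+1) (g`_n.-1 / n%:R)); apply/polyP => n.
rewrite coef_deriv coef_poly ltnS /=; case: ltnP => [_|le].
  by rewrite -[LHS]mulr_natr divfK // pnatr_eq0.
by rewrite mul0rn nth_default.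
Qed.

Lemma unipoly_const i (q : {mpoly K[3]}) : q^`M(i) = 0 -> unipoly i q = ((unipoly i q)`_0)%:P.
Proof.
move=> q0; apply/size1_polyC/(deriv_eq0_size mpoly_char0).
by rewrite unipoly_deriv q0 rmorph0.
Qed.

(** The leading coefficient of p is invertible, so [a] can be divided by p as a polynomial in the
    variable i. The remainder times [q] is a multiple of p of too small a degree, hence zero. *)
Lemma lift_poly_dvd i (a b q : {mpoly K[3]}) p : p != 0 -> q != 0 -> q^`M(i) = 0 ->
  a * q = b * lift_poly i p -> exists h, a = lift_poly i p * h.
Proof.
move=> p0 q0 dq e; set c := (unipoly i q)`_0.
have eq : unipoly i q = c%:P by apply: unipoly_const.
have c0 : c != 0.
  by apply: contra_neq q0 => c0; apply/eqP; rewrite -(unipoly_eq0 i) eq c0 polyC0.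
set P := map_poly (@mpolyC 3 K) p.
have lcP : lead_coef P \is a GRing.unit.
  rewrite lead_coef_map_inj //; last exact: (can_inj (@mpolyCK 3 K)).
  by apply: rmorph_unit; rewrite unitfE lead_coef_eq0.
set Q := Pdiv.Idomain.divp (unipoly i a) P; set r := Pdiv.Idomain.modp (unipoly i a) P.
have P0 : P != 0 by rewrite -lead_coef_eq0; apply: contraTneq lcP => ->; rewrite unitr0.
have ea : unipoly i a = Q * P + r by apply: Pdiv.IdomainUnit.divp_eq.
have sr : (size r < size P)%N by rewrite ltn_modp.
have : r * c%:P = (unipoly i b - Q * c%:P) * P.
  have := congr1 (unipoly i) e; rewrite !rmorphM /= unipoly_lift -/P eq ea => e'.
  by rewrite mulrBl -e'; ring.
have [->|d0] := eqVneq (unipoly i b - Q * c%:P) 0.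
  rewrite mul0r => /eqP; rewrite mulf_eq0 polyC_eq0 (negPf c0) orbF => /eqP r0.
  exists Q.['X_i]; rewrite -[LHS](unipolyK i) ea r0 addr0 hornerM mulrC.
  by rewrite lift_polyE.
move/(congr1 (fun s : {poly _} => size s)); rewrite mulrC mul_polyC size_scale // size_mul //.
have ar (u w x : nat) : (w < x -> 0 < u -> w = (u + x).-1 -> False)%N by lia.
by move=> es; case: (ar _ _ _ sr _ es); rewrite size_poly_gt0.
Qed.

(** The partial derivatives of f are [h] times those of [u]. Since mixed derivatives commute, h
    satisfies the same equations, with smaller degree in j. So h = G(u) by induction, and f - G1(u),
    where G1' = G, is constant. *)
Lemma additive_form i j k (f : {mpoly K[3]}) (p q r : {poly K}) :
  i != j -> i != k -> j != k -> p^`() != 0 -> q^`() != 0 ->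
  f^`M(i) * lift_poly j q^`() = f^`M(j) * lift_poly i p^`() ->
  f^`M(i) * lift_poly k r^`() = f^`M(k) * lift_poly i p^`() ->
  exists g, f = compose g (lift_poly i p + lift_poly j q + lift_poly k r).
Proof.
move=> ij ik jk p0 q0; set u := _ + _ + _.
have [ji ki kj] : [/\ j != i, k != i & k != j] by rewrite !(eq_sym k) (eq_sym j).
have Lp0 : lift_poly i p^`() != 0 by rewrite lift_poly_eq0.
have Lq0 : lift_poly j q^`() != 0 by rewrite lift_poly_eq0.
have du t : u^`M(t) = if t == i then lift_poly i p^`() else
    if t == j then lift_poly j q^`() else lift_poly k r^`().
  rewrite /u !mderivD; have [->|->|->] := ord3_cases t ij ik jk.
  - by rewrite eqxx lift_poly_deriv !lift_poly_derivN // !addr0.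
  - by rewrite eqxx (negPf ji) lift_poly_deriv !lift_poly_derivN // add0r addr0.
  - by rewrite (negPf ki) (negPf kj) lift_poly_deriv !lift_poly_derivN // !add0r.
have fin (h : {mpoly K[3]}) : (forall t, h^`M(t) = 0) -> exists g, h = compose g u.
  by move=> h0; exists (h@_0)%:P; rewrite composeC; apply: mpolyC_mderiv0.
have [n] := ubnP (size (unipoly j f)); elim: n f => // n IH f ltn e1 e2.
have [h fi] := lift_poly_dvd p0 Lq0 (lift_poly_derivN _ ij) e1.
have fj : f^`M(j) = lift_poly j q^`() * h.
  by apply: (mulIf Lp0); rewrite -e1 fi; ring.
have fk : f^`M(k) = lift_poly k r^`() * h.
  by apply: (mulIf Lp0); rewrite -e2 fi; ring.
have [h0|h0] := eqVneq h 0.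
  apply: fin => t; have [->|->|->] := ord3_cases t ij ik jk.
  - by rewrite fi h0 mulr0.
  - by rewrite fj h0 mulr0.
  - by rewrite fk h0 mulr0.
have [||| G eG] := IH h.
- have fj0 : f^`M(j) != 0 by rewrite fj mulf_neq0.
  have s1 : (size (unipoly j h) <= size (unipoly j f^`M(j)))%N.
    rewrite fj rmorphM /= size_mul ?unipoly_eq0 // -[leqLHS]add0n.
    by case: (size _) (size_poly_gt0 (unipoly j (lift_poly j q^`()))) => [|z];
       rewrite ?unipoly_eq0 ?Lq0 // => _; rewrite addSn leq_addl.
  apply: leq_ltn_trans s1 _; rewrite -unipoly_deriv.
  apply: (leq_trans (lt_size_deriv _)) => //; rewrite unipoly_eq0.
  by apply: contra_neq fj0 => ->; rewrite mderiv0.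
- have := mderiv_comm i j f; rewrite fi fj !mderivM !lift_poly_derivN // !mul0r !add0r => e.
  by rewrite mulrC -e mulrC.
- have := mderiv_comm i k f; rewrite fi fk !mderivM !lift_poly_derivN // !mul0r !add0r => e.
  by rewrite mulrC -e mulrC.
have [G1 eG1] := poly_antideriv G.
have [|c ec] := fin (f - compose G1 u).
  move=> t; rewrite mderivB mderiv_compose eG1 -eG du.
  have [->|->|->] := ord3_cases t ij ik jk.
  - by rewrite eqxx fi mulrC subrr.
  - by rewrite eqxx (negPf ji) fj mulrC subrr.
  - by rewrite (negPf ki) (negPf kj) fk mulrC subrr.
by exists (c + G1); rewrite composeD -ec subrK.
Qed.

(** * Multiplicative form *)

Lemma coefM_top (A : nzRingType) (p q : {poly A}) a b :
  (size p <= a.+1)%N -> (size q <= b.+1)%N -> (p * q)`_(a + b) = p`_a * q`_b.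
Proof.
move=> sp sq; rewrite coefM.
have la : (a < (a + b).+1)%N by rewrite ltnS leq_addr.
rewrite (bigD1 (Ordinal la)) //= addKn big1 ?addr0 // => l nl.
have [al|al] := ltnP a l.
  by rewrite nth_default ?mul0r // (leq_trans sp).
have {al nl} al : (l < a)%N by move: nl; rewrite -val_eqE /= ltn_neqAle => ->.
by rewrite [q`__]nth_default ?mulr0 // (leq_trans sq) // ltn_subRL ltn_add2r.
Qed.

Lemma size_coef_unipoly i j (f : {mpoly K[3]}) n : i != j ->
  (size (unipoly i (unipoly j f)`_n) <= size (unipoly i f))%N.
Proof.
move=> ij; suff main : forall S (g : {mpoly K[3]}),
    (size (unipoly i g) <= S -> size (unipoly i (unipoly j g)`_n) <= S)%N by apply: main.
elim=> [|S IH] {}f.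
  rewrite leqn0 size_poly_eq0 unipoly_eq0 => /eqP ->.
  by rewrite rmorph0 coef0 rmorph0 size_poly0.
move=> sf; set p := unipoly i _; have [p1|p1] := leqP (size p) 1.
  by apply: leq_trans p1 _.
have [sp _] := lead_coef_deriv mpoly_char0 p1.
suff : (size p^`() <= S)%N by rewrite sp; case: (size p).
rewrite unipoly_deriv coef_unipoly_mderivN //; apply: IH; rewrite -unipoly_deriv.
have [->|f0] := eqVneq (unipoly i f) 0; first by rewrite deriv0 size_poly0.
by rewrite -ltnS; apply: leq_trans (lt_size_deriv f0) sf.
Qed.

Section LogDerivative.
Variables (p : {poly K}) (i : 'I_3).
Hypothesis pn0 : p != 0.

(* q behaves like the (possibly fractional) power p^s *)
Definition power_like s (q : {poly K}) := q^`() * p = s *: (p^`() * q).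

Lemma power_like_size s q : p^`() != 0 -> q != 0 -> power_like s q ->
  (size q).-1%:R = s * (size p).-1%:R.
Proof.
rewrite /power_like => p0 q0 e.
have p1 : (1 < size p)%N.
  by rewrite ltnNge; apply: contra p0 => /size1_polyC ->; rewrite derivC.
have char0 n : n.+1%:R != 0 :> K by rewrite pnatr_eq0.
have [sp lp] := lead_coef_deriv char0 p1.
have lq0 : lead_coef q != 0 by rewrite lead_coef_eq0.
have lp0 : lead_coef p != 0 by rewrite lead_coef_eq0.
have [q1|q1] := leqP (size q) 1.
  have -> : (size q).-1 = 0%N by lia.
  move/eqP: e; rewrite (size1_polyC q1) derivC mul0r eq_sym scaler_eq0 mulf_eq0 polyC_eq0.
  rewrite (negPf p0) /= => /orP[/eqP -> |]; first by rewrite mul0r.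
  by move: q0; rewrite {1}(size1_polyC q1) polyC_eq0 => /negPf ->.
have [sq lq] := lead_coef_deriv char0 q1.
have := congr1 lead_coef e; rewrite lead_coefZ !lead_coefM lp lq => e'.
have lqp : lead_coef q * lead_coef p != 0 by rewrite mulf_neq0.
apply: (mulfI lqp); rewrite -(mulr_natr (lead_coef q)) -(mulr_natr (lead_coef p)) in e'.
transitivity (lead_coef q * (size q).-1%:R * lead_coef p); first by ring.
by rewrite e'; ring.
Qed.

Lemma power_like_proportional s q r : q != 0 -> r != 0 ->
  power_like s q -> power_like s r -> exists2 c, c != 0 & r = c *: q.
Proof.
rewrite /power_like => q0 r0 eq er.
have char0 n : n.+1%:R != 0 :> K by rewrite pnatr_eq0.
have := wronskian0_proportional char0 q0 (p := r).
have -> : r^`() * q = r * q^`().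
  apply: (mulIf pn0); rewrite mulrAC er -mulrA eq -scalerAl -scalerAr.
  by congr (_ *: _); ring.
move=> /(_ erefl) e; exists ((lead_coef q)^-1 * lead_coef r).
  by rewrite mulf_neq0 ?invr_eq0 ?lead_coef_eq0.
by rewrite -scalerA -e scalerA mulVf ?scale1r // lead_coef_eq0.
Qed.

Lemma power_likeX s q e : power_like s q -> power_like (e%:R * s) (q ^+ e).
Proof.
rewrite /power_like => eq; elim: e => [|e IH].
  by rewrite expr0 derivC mul0r mul0r scale0r.
rewrite exprS derivM mulrDl -[q * _ * p]mulrA IH mulrAC eq -scalerAl -scalerAr.
rewrite -[in RHS]addn1 natrD mulrDl mul1r addrC scalerDl; congr (_ *: _ + _ *: _); ring.
Qed.

(** Both q^n' and r^n behave like the same power of p, so they are proportional. As n <= n', q^n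
    divides r^n, and q divides r. *)
Lemma power_like_dvd s s' q r n n' : q != 0 -> r != 0 ->
  power_like s q -> power_like s' r -> n'%:R * s = n%:R * s' -> (0 < n <= n')%N ->
  exists2 d, r = q * d & power_like (s' - s) d.
Proof.
move=> q0 r0 eq er es /andP[n0 le].
have [c c0 ec] : exists2 c, c != 0 & r ^+ n = c *: q ^+ n'.
  apply: (@power_like_proportional (n'%:R * s)); rewrite ?expf_neq0 //.
    exact: power_likeX.
  by rewrite es; apply: power_likeX.
have : q %| r.
  rewrite -(dvdp_pexp2r _ _ n0) ec dvdpZr //; exact: dvdp_exp2l.
move/dvdpP => [d ed]; exists d; first by rewrite ed mulrC.
move: er eq; rewrite /power_like ed derivM => er eq.
apply: (mulIf q0); rewrite -!scalerAl.
have -> : d^`() * p * q = (d^`() * q + d * q^`()) * p - d * (q^`() * p) by ring.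
rewrite er eq -scalerAr scalerBl; congr (_ *: _ - _ *: _); ring.
Qed.

(* a factorises as (function of the other variables) * (power of p in the variable i) *)
Lemma power_like_split s (a : {mpoly K[3]}) : a != 0 ->
  a^`M(i) * lift_poly i p = s *: (lift_poly i p^`() * a) ->
  exists al b, [/\ al != 0, power_like s al, a = b * lift_poly i al & b^`M(i) = 0].
Proof.
move=> a0 e.
have [v v0] : exists v, a.@[v] != 0.
  apply: NNPP => h; case/eqP: a0; apply: mpoly_eq0_everywhere => v.
  by apply/eqP; apply: contraT => v0; case: h; exists v.
(* A slice through a point where [a] is nonzero has the same logarithmic derivative in i as [a], so
   the quotient is free of i. *)
pose al := slice i v a; exists al.
have al0 : al != 0.
  apply: contra_neq v0 => h; rewrite -(meval_eq _ (v1 := upd v i (v i))).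
    by rewrite -sliceE -/al h horner0.
  by move=> t; rewrite /upd; case: eqP => [->|].
have eal : power_like s al.
  have := congr1 (slice i v) e.
  by rewrite -[s *: _]mul_mpolyC !rmorphM /= -slice_deriv !slice_lift /slice mmapC mul_polyC.
have Lp0 : lift_poly i p != 0 by rewrite lift_poly_eq0.
have Ual0 : unipoly i (lift_poly i al) != 0 by rewrite unipoly_eq0 lift_poly_eq0.
have := wronskian0_proportional mpoly_char0 Ual0 (p := unipoly i a).
rewrite !unipoly_deriv -!rmorphM lift_poly_deriv.
have -> : a^`M(i) * lift_poly i al = a * lift_poly i al^`().
  apply: (mulIf Lp0); rewrite mulrAC e -mulrA -rmorphM eal.
  by rewrite -[s *: (_ * al)]mul_polyC !rmorphM /= lift_polyC -mul_mpolyC; ring.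
move=> /(_ erefl); set b := lead_coef (unipoly i a).
have -> : lead_coef (unipoly i (lift_poly i al)) = (lead_coef al)%:MP.
  by rewrite unipoly_lift lead_coef_map_inj //; apply: (can_inj (@mpolyCK 3 K)).
move/(congr1 (fun q : {poly _} => q.['X_i])); rewrite !hornerZ !unipolyK => eab.
have la0 : lead_coef al != 0 by rewrite lead_coef_eq0.
exists ((lead_coef al)^-1%:MP * b); split=> //.
  by rewrite -mulrA -eab mulrA -mpolyCM mulVf // mpolyC1 mul1r.
by rewrite mderiv_mulC coef_unipoly_mderiv mulr0.
Qed.
End LogDerivative.

Lemma top_coef_deriv (A : idomainType) (char0 : forall n, n.+1%:R != 0 :> A)
    (F G W : {poly A}) c c' N L :
  size F = N.+1 -> (size G <= N.+1)%N -> size W = L.+2 ->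
  G * c%:P * W^`() = F^`() * c'%:P * W ->
  G`_N * c * L.+1%:R = N%:R * (c' * lead_coef F).
Proof.
move=> sF sG sW e.
have W1 : (1 < size W)%N by rewrite sW.
have [sW' lW'] := lead_coef_deriv char0 W1; rewrite sW /= in sW' lW'.
have lW0 : lead_coef W != 0 by rewrite lead_coef_eq0; apply: contraTneq W1 => ->; rewrite size_poly0.
have eG : (G * W^`())`_(N + L) = G`_N * (lead_coef W * L.+1%:R).
  by rewrite coefM_top ?sW' // mulr_natr -lW' lead_coefE sW'.
have eF : (F^`() * W)`_(N + L) = lead_coef F * N%:R * lead_coef W.
  have sF' : (size F^`() <= N)%N.
    by rewrite -ltnS -sF lt_size_deriv // -size_poly_gt0 sF.
  case: N sF sF' {sG eG} => [|N] sF sF'.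
    move: sF'; rewrite leqn0 size_poly_eq0 => /eqP ->.
    by rewrite mul0r coef0 mulr0 mul0r.
  rewrite addSnnS (coefM_top sF') ?sW // coef_deriv mulr_natr [lead_coef F]lead_coefE sF.
  by rewrite [lead_coef W]lead_coefE sW.
apply: (mulIf lW0).
transitivity (c * (G * W^`())`_(N + L)); first by rewrite eG; ring.
transitivity (c' * (F^`() * W)`_(N + L)); last by rewrite eF; ring.
rewrite -!coefZ; apply: (congr1 (fun g : {poly A} => g`_(N + L))); rewrite -!mul_polyC.
by rewrite mulrA [c%:P * G]mulrC e; ring.
Qed.

Section MultiplicativeForm.
Variables (i j k : 'I_3) (p q r : {poly K}).
Hypotheses (ij : i != j) (ik : i != k) (jk : j != k).
Hypotheses (p'0 : p^`() != 0) (q'0 : q^`() != 0) (r0 : r != 0).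

(** The gradient of f is parallel to that of log p(x) + log q(y) + log r(z), denominators cleared. A
    constant r encodes that f does not involve the variable k. *)
Definition log_separated (f : {mpoly K[3]}) :=
  f^`M(i) * lift_poly i p * lift_poly j q^`() = f^`M(j) * lift_poly i p^`() * lift_poly j q /\
  f^`M(i) * lift_poly i p * lift_poly k r^`() = f^`M(k) * lift_poly i p^`() * lift_poly k r.

(** The exponent is common to the three factors: their product stands for (p q r)^s, where s may be
    fractional. *)
Definition separated_power s (al be ga : {poly K}) :=
  [/\ al != 0, be != 0 & ga != 0] /\
  [/\ power_like p s al, power_like q s be & power_like r s ga].

Definition product_of (al be ga : {poly K}) : {mpoly K[3]} :=
  lift_poly i al * lift_poly j be * lift_poly k ga.

Let ji : j != i. Proof. by rewrite eq_sym. Qed.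
Let ki : k != i. Proof. by rewrite eq_sym. Qed.
Let kj : k != j. Proof. by rewrite eq_sym. Qed.
Let p0 : p != 0. Proof. by apply: contra_neq p'0 => ->; rewrite deriv0. Qed.
Let q0 : q != 0. Proof. by apply: contra_neq q'0 => ->; rewrite deriv0. Qed.
Let Lp0 : lift_poly i p != 0. Proof. by rewrite lift_poly_eq0. Qed.
Let Lq0 : lift_poly j q != 0. Proof. by rewrite lift_poly_eq0. Qed.
Let Lr0 : lift_poly k r != 0. Proof. by rewrite lift_poly_eq0. Qed.
Let Lp'0 : lift_poly i p^`() != 0. Proof. by rewrite lift_poly_eq0. Qed.
Let Lq'0 : lift_poly j q^`() != 0. Proof. by rewrite lift_poly_eq0. Qed.
Let char0 n : n.+1%:R != 0 :> K. Proof. by rewrite pnatr_eq0. Qed.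

Lemma log_separated_jk f : log_separated f ->
  f^`M(j) * lift_poly j q * lift_poly k r^`() = f^`M(k) * lift_poly j q^`() * lift_poly k r.
Proof.
move=> [e1 e2]; apply: (mulIf (mulf_neq0 Lp0 Lp'0)).
transitivity (f^`M(j) * lift_poly i p^`() * lift_poly j q * (lift_poly i p * lift_poly k r^`())).
  by ring.
rewrite -e1; transitivity (f^`M(i) * lift_poly i p * lift_poly k r^`() * (lift_poly i p * lift_poly j q^`())).
  by ring.
by rewrite e2; ring.
Qed.

Lemma log_separatedB f g : log_separated f -> log_separated g -> log_separated (f - g).
Proof. by move=> [e1 e2] [e3 e4]; split; rewrite !mderivB !mulrBl ?e1 ?e2 ?e3 ?e4. Qed.

Lemma lift_power_like t u s (al : {poly K}) : power_like u s al ->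
  lift_poly t al^`() * lift_poly t u = s *: (lift_poly t u^`() * lift_poly t al).
Proof.
rewrite /power_like -!rmorphM => ->; rewrite -mul_polyC rmorphM /= lift_polyC mul_mpolyC.
by rewrite rmorphM.
Qed.

Lemma log_separated_product s al be ga : separated_power s al be ga ->
  log_separated (product_of al be ga).
Proof.
move=> [_ [ea eb ec]].
have := lift_power_like i ea; have := lift_power_like j eb; have := lift_power_like k ec.
rewrite /log_separated /product_of !mderivM !lift_poly_deriv !lift_poly_derivN //.
rewrite !(mul0r, mulr0, addr0, add0r) -![s *: _]mul_mpolyC => ec' eb' ea'; split.
  transitivity (lift_poly i al^`() * lift_poly i p * (lift_poly j be * lift_poly j q^`() * lift_poly k ga)).
    by ring.
  rewrite ea'; transitivity (lift_poly j be^`() * lift_poly j q * (lift_poly i al * lift_poly i p^`() * lift_poly k ga)); last by ring.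
  by rewrite eb'; ring.
transitivity (lift_poly i al^`() * lift_poly i p * (lift_poly k ga * lift_poly k r^`() * lift_poly j be)).
  by ring.
rewrite ea'; transitivity (lift_poly k ga^`() * lift_poly k r * (lift_poly i al * lift_poly i p^`() * lift_poly j be)); last by ring.
by rewrite ec'; ring.
Qed.

Lemma separated_power_size s al be ga : separated_power s al be ga ->
  (size al).-1%:R = s * (size p).-1%:R /\ (size be).-1%:R = s * (size q).-1%:R.
Proof. by move=> [[? ? ?] [? ? ?]]; split; apply: power_like_size. Qed.

Let size_gt1 (u : {poly K}) : u^`() != 0 -> (1 < size u)%N.
Proof. by move=> u0; rewrite ltnNge; apply: contra u0 => /size1_polyC ->; rewrite derivC. Qed.

Lemma unipoly_mul3 b (x y z x' y' z' : {mpoly K[3]}) : x * y * z = x' * y' * z' ->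
  unipoly b x * unipoly b y * unipoly b z = unipoly b x' * unipoly b y' * unipoly b z'.
Proof. by move/(congr1 (unipoly b)); rewrite !rmorphM. Qed.

Lemma top_coef_log (a b : 'I_3) (u w : {poly K}) f N : a != b -> w^`() != 0 ->
  size (unipoly b f) = N.+1 ->
  f^`M(a) * lift_poly a u * lift_poly b w^`() = f^`M(b) * lift_poly a u^`() * lift_poly b w ->
  (lead_coef (unipoly b f))^`M(a) * lift_poly a u =
  (N%:R / (size w).-1%:R) *: (lift_poly a u^`() * lead_coef (unipoly b f)).
Proof.
move=> ab w0 sf e; have w1 := size_gt1 w0.
have [L eL] : exists L, size w = L.+2.
  by case: (size w) w1 => [|[|L]] // _; exists L.
have ba : b != a by rewrite eq_sym.
have := unipoly_mul3 b e.
rewrite (unipoly_liftN u ba) (unipoly_liftN u^`() ba).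
rewrite (unipoly_lift b w) (unipoly_lift b w^`()) -(unipoly_deriv b f) -(unipoly_mderiv f ab).
rewrite -(deriv_map (@mpolyC 3 K) w) => eU.
have sW : size (map_poly (@mpolyC 3 K) w) = L.+2.
  by rewrite size_map_inj_poly //; apply: (can_inj (@mpolyCK 3 K)).
have sMF : (size (map_poly (mderiv a) (unipoly b f)) <= N.+1)%N.
  by rewrite -sf; apply: size_poly.
have := top_coef_deriv mpoly_char0 sf sMF sW eU.
rewrite coef_map /= => e2; rewrite eL /=.
have nz : L.+1%:R != 0 :> {mpoly K[3]} by apply: mpoly_char0.
apply: (mulIf nz); rewrite {1}lead_coefE sf /= e2 -mul_mpolyC.
have -> : L.+1%:R = (L.+1%:R)%:MP :> {mpoly K[3]} by rewrite mpolyC_nat.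
have -> : N%:R = (N%:R / L.+1%:R)%:MP * (L.+1%:R)%:MP :> {mpoly K[3]}.
  by rewrite -mpolyCM divfK // mpolyC_nat.
by ring.
Qed.
Lemma power_likeZ (u : {poly K}) s c v : power_like u s v -> power_like u s (c *: v).
Proof.
by rewrite /power_like derivZ -scalerAl => ->; rewrite -scalerAr !scalerA mulrC.
Qed.

Let mderiv_mull t (b c : {mpoly K[3]}) : c^`M(t) = 0 -> (b * c)^`M(t) = b^`M(t) * c.
Proof. by move=> c0; rewrite mderivM c0 mulr0 addr0. Qed.

Let size_factor t (a b : {mpoly K[3]}) al : a = b * lift_poly t al -> a != 0 ->
  (size al <= size (unipoly t a))%N.
Proof.
move=> ea a0; have [b0 l0] : b != 0 /\ lift_poly t al != 0.
  by move: a0; rewrite ea mulf_eq0 negb_or => /andP.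
have -> : size al = size (unipoly t (lift_poly t al)).
  by rewrite unipoly_lift size_map_inj_poly //; apply: (can_inj (@mpolyCK 3 K)).
have -> : unipoly t a = unipoly t b * unipoly t (lift_poly t al) by rewrite ea; apply: rmorphM.
have ar (x y : nat) : (0 < x -> y <= (x + y).-1)%N by clear; lia.
by rewrite size_mul ?unipoly_eq0 // ar // size_poly_gt0 unipoly_eq0.
Qed.

(** The leading coefficient of f in j behaves like p^s in i and r^s in k, so it splits. That q^s is
    a polynomial too needs the leading coefficient of f in i, which supplies a power q^s2; degree
    bounds force s2 = s. *)
Lemma top_product f N : log_separated f -> size (unipoly j f) = N.+2 ->
  exists s al be ga, [/\ separated_power s al be ga, size be = N.+2, lead_coef be = 1 &
    lead_coef (unipoly j f) = lift_poly i al * lift_poly k ga].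
Proof.
move=> sep sf; have [e1 e2] := sep; have e3 := log_separated_jk sep.
have f0 : f != 0 by rewrite -(unipoly_eq0 j) -size_poly_gt0 sf.
have [M eM] : exists M, size (unipoly i f) = M.+1.
  have : (0 < size (unipoly i f))%N by rewrite size_poly_gt0 unipoly_eq0.
  by case: (size _) => // M _; exists M.
have [P eP] : exists P, size p = P.+2 by case: (size p) (size_gt1 p'0) => [|[|P]] // _; exists P.
have [Q eQ] : exists Q, size q = Q.+2 by case: (size q) (size_gt1 q'0) => [|[|Q]] // _; exists Q.
set a := lead_coef (unipoly j f); set s : K := N.+1%:R / Q.+1%:R.
have a0 : a != 0 by rewrite lead_coef_eq0 unipoly_eq0.
have ea : a^`M(i) * lift_poly i p = s *: (lift_poly i p^`() * a).
  by have := top_coef_log ij q'0 sf e1; rewrite eQ.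
have eak : a^`M(k) * lift_poly k r = s *: (lift_poly k r^`() * a).
  have : f^`M(k) * lift_poly k r * lift_poly j q^`() = f^`M(j) * lift_poly k r^`() * lift_poly j q.
    by rewrite mulrAC -e3 mulrAC.
  by move/(top_coef_log kj q'0 sf); rewrite eQ.
have [al [b [al0 pal eab bi]]] := power_like_split p0 a0 ea.
have Lal0 : lift_poly i al != 0 by rewrite lift_poly_eq0.
have b0 : b != 0 by apply: contra_neq a0 => h; rewrite eab h mul0r.
have ebk : b^`M(k) * lift_poly k r = s *: (lift_poly k r^`() * b).
  apply: (mulIf Lal0); rewrite mulrAC -mderiv_mull ?lift_poly_derivN //.
  by rewrite -eab eak {1}eab -scalerAl mulrA.
have [ga [b' [ga0 pga ebb bk]]] := power_like_split r0 b0 ebk.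
have Lga0 : lift_poly k ga != 0 by rewrite lift_poly_eq0.
have db' t : b'^`M(t) = 0.
  have [->|->|->] := ord3_cases t ij ik jk; last exact: bk.
    by apply: (mulIf Lga0); rewrite mul0r -mderiv_mull ?lift_poly_derivN // -ebb.
  apply: (mulIf Lga0); rewrite mul0r -mderiv_mull ?lift_poly_derivN // -ebb.
  apply: (mulIf Lal0); rewrite mul0r -mderiv_mull ?lift_poly_derivN // -eab.
  by rewrite /a lead_coefE coef_unipoly_mderiv.
have eb' := mpolyC_mderiv0 db'; set c := b'@_0 in eb'.
have c0 : c != 0.
  by apply: contra_neq b0 => h; rewrite ebb eb' h mpolyC0 mul0r.
set d := lead_coef (unipoly i f).
have d0 : d != 0 by rewrite lead_coef_eq0 unipoly_eq0.
set s2 : K := M%:R / P.+1%:R.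
have ed : d^`M(j) * lift_poly j q = s2 *: (lift_poly j q^`() * d).
  have : f^`M(j) * lift_poly j q * lift_poly i p^`() = f^`M(i) * lift_poly j q^`() * lift_poly i p.
    by rewrite mulrAC -e1 mulrAC.
  by move/(top_coef_log ji p'0 eM); rewrite eP.
have [be [d' [be0 pbe edd _]]] := power_like_split q0 d0 ed.
have sal : (size al <= M.+1)%N.
  apply: leq_trans (size_factor eab a0) _; rewrite -eM /a lead_coefE.
  exact: size_coef_unipoly.
have sbe : (size be <= N.+2)%N.
  apply: leq_trans (size_factor edd d0) _; rewrite -sf /d lead_coefE.
  exact: size_coef_unipoly.
have dal := power_like_size p0 p'0 al0 pal; rewrite eP /= in dal.
have dbe := power_like_size q0 q'0 be0 pbe; rewrite eQ /= in dbe.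
(* deg al = s deg p is at most the degree s2 deg p of f in i, and deg be = s2 deg q is at most the
   degree s deg q of f in j. *)
have es : s2 = s.
  have P0 : 0 < P.+1%:R :> K by rewrite ltr0n.
  have Q0 : 0 < Q.+1%:R :> K by rewrite ltr0n.
  apply/eqP; rewrite eq_le; apply/andP; split.
    rewrite -(ler_pM2r Q0) -dbe /s divfK ?pnatr_eq0 // ler_nat.
    by case: (size be) sbe.
  rewrite -(ler_pM2r P0) -dal /s2 divfK ?pnatr_eq0 // ler_nat.
  by case: (size al) sal.
have lbe0 : (lead_coef be)^-1 != 0 by rewrite invr_eq0 lead_coef_eq0.
exists s, al, ((lead_coef be)^-1 *: be), (c *: ga); split.
- by split; split; rewrite ?scaler_eq0 ?negb_or ?lbe0 ?c0 //; apply: power_likeZ => //; rewrite -es.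
- rewrite size_scale //; apply/eqP; move: dbe; rewrite es /s divfK ?pnatr_eq0 // => /eqP.
  rewrite eqr_nat; case: (size be) (be0) => [|[|x]] //.
- by rewrite lead_coefZ mulVf // lead_coef_eq0.
rewrite eab ebb eb' -mul_polyC rmorphM /= lift_polyC; ring.
Qed.
Lemma unipoly_subM3 t (x y z w : {mpoly K[3]}) : unipoly t (x - y * z * w) =
  unipoly t x - unipoly t y * unipoly t z * unipoly t w.
Proof. by rewrite rmorphB !rmorphM. Qed.

Lemma log_separated_const f : log_separated f -> (size (unipoly j f) <= 1)%N ->
  f = (f@_0)%:MP.
Proof.
move=> [e1 e2] sf.
have fj : f^`M(j) = 0.
  apply/eqP; rewrite -(unipoly_eq0 j) -unipoly_deriv (size1_polyC sf) derivC.
  exact: eqxx.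
have fi : f^`M(i) = 0.
  move/eqP: e1; rewrite fj !mul0r !mulf_eq0 (negPf Lp0) (negPf Lq'0) !orbF.
  by move/eqP.
have fk : f^`M(k) = 0.
  move/esym/eqP: e2; rewrite fi !mul0r !mulf_eq0 (negPf Lr0) (negPf Lp'0) !orbF.
  by move/eqP.
apply: mpolyC_mderiv0 => t.
by have [->|->|->] := ord3_cases t ij ik jk.
Qed.

Definition minimal_power s al be ga := [/\ separated_power s al be ga, (1 < size be)%N &
  forall s' al' be' ga', separated_power s' al' be' ga' -> (1 < size be')%N ->
    (size be <= size be')%N].

Lemma exists_minimal_power s al be ga : separated_power s al be ga -> (1 < size be)%N ->
  exists s' al' be' ga', minimal_power s' al' be' ga'.
Proof.
have [n] := ubnP (size be); elim: n s al be ga => // n IH s al be ga ltn h1 h2.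
have [mn|nm] := classic (minimal_power s al be ga); first by exists s, al, be, ga.
have [s' [al' [be' [ga' [h1' h2' lt]]]]] : exists s' al' be' ga',
    [/\ separated_power s' al' be' ga', (1 < size be')%N & (size be' < size be)%N].
  apply: NNPP => ne; apply: nm; split=> // s' al' be' ga' h1' h2'.
  rewrite leqNgt; apply/negP => lt; apply: ne; exists s', al', be', ga'.
  by split.
by apply: (IH s' al' be' ga') => //; apply: leq_trans lt _; rewrite -ltnS.
Qed.

(** By minimality the least triple divides any other nonconstant one, and the quotient is again a
    triple, with exponent s - s0. Repeated division ends at s = 0, where all factors are
    constant. *)
Lemma separated_power_minimal s0 al0 be0 ga0 s al be ga :
  minimal_power s0 al0 be0 ga0 -> separated_power s al be ga ->
  exists e c, product_of al be ga = c *: product_of al0 be0 ga0 ^+ e.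
Proof.
move=> [h0 sb0 mn]; have [n] := ubnP (size be).
elim: n s al be ga => // n IH s al be ga ltn h.
have [hn0 [pa0 pb0 pc0]] := h0; have [an0 bn0 cn0] := hn0.
have [[an bn cn] [pa pb pc]] := h.
have [_ sq] := separated_power_size h; have [_ sq0] := separated_power_size h0.
have Q0 : (size q).-1%:R != 0 :> K.
  by rewrite pnatr_eq0; case: (size q) (size_gt1 q'0) => [|[|]].
have [b1|b1] := leqP (size be) 1.
  have s_0 : s = 0.
    apply: (mulIf Q0); rewrite mul0r -sq.
    by case: (size be) b1 => [|[|]].
  have cst (u v : {poly K}) : u != 0 -> power_like u s v -> v = (v`_0)%:P.
    rewrite /power_like s_0 scale0r => u0 /eqP; rewrite mulf_eq0 (negPf u0) orbF.
    by move=> /eqP /(deriv_eq0_size char0) /size1_polyC.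
  exists 0%N, (al`_0 * be`_0 * ga`_0); rewrite expr0 /product_of.
  rewrite (cst _ _ p0 pa) (cst _ _ q0 pb) (cst _ _ r0 pc) !lift_polyC !coefC /=.
  by rewrite -!mpolyCM -mul_mpolyC mulr1.
have le := mn _ _ _ _ h b1.
have es : (size be).-1%:R * s0 = (size be0).-1%:R * s.
  by rewrite sq sq0; ring.
have bd : (0 < (size be0).-1 <= (size be).-1)%N.
  by case: (size be0) (size be) sb0 le => [|[|x]] // [|y].
have [d1 ea p1] := power_like_dvd p0 an0 an pa0 pa es bd.
have [d2 eb p2] := power_like_dvd q0 bn0 bn pb0 pb es bd.
have [d3 ec p3] := power_like_dvd r0 cn0 cn pc0 pc es bd.
have [||e [c ed]] := IH (s - s0) d1 d2 d3.
- rewrite -ltnS; apply: leq_trans ltn; rewrite ltnS eb.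
  have d20 : d2 != 0 by apply: contra_neq bn => z; rewrite eb z mulr0.
  by rewrite size_mul //; case: (size be0) sb0 => [|[|x]] // _; rewrite addSn /= addSn ltnS leq_addl.
- split; last by split.
  by move: an bn cn; rewrite ea eb ec !mulf_eq0 !negb_or => /andP[_ ->] /andP[_ ->] /andP[_ ->].
exists e.+1, c; rewrite exprS scalerAr -ed ea eb ec /product_of !rmorphM /=; ring.
Qed.

(** Subtracting the product that carries the top coefficient in j leaves a solution of smaller
    degree, and each such product is a multiple of a power of the minimal product [t]. *)
Lemma multiplicative_form f : log_separated f ->
  exists g al be ga, f = compose g (product_of al be ga).
Proof.
move=> sepf; have [sf|sf] := leqP (size (unipoly j f)) 1.
  by exists (f@_0)%:P, 0, 0, 0; rewrite composeC; apply: log_separated_const.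
have [s0 [al0 [be0 [ga0 mn]]]] : exists s al be ga, minimal_power s al be ga.
  have [N eN] : exists N, size (unipoly j f) = N.+2.
    by case: (size _) sf => [|[|N]] // _; exists N.
  have [s [al [be [ga [h sb _ _]]]]] := top_product sepf eN.
  by apply: (exists_minimal_power h); rewrite sb.
set t := product_of al0 be0 ga0.
suff [g eg] : exists g, f = compose g t by exists g, al0, be0, ga0.
have [n] := ubnP (size (unipoly j f)); elim: n f sepf {sf} => // n IH f sepf ltn.
have [sf|sf] := leqP (size (unipoly j f)) 1.
  by exists (f@_0)%:P; rewrite composeC; apply: log_separated_const.
have [N eN] : exists N, size (unipoly j f) = N.+2.
  by case: (size _) sf => [|[|N]] // _; exists N.
have [s [al [be [ga [h sb lb la]]]]] := top_product sepf eN.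
have [e [c ec]] := separated_power_minimal mn h; rewrite -/t in ec.
have [||g eg] := IH (f - product_of al be ga).
- by apply: log_separatedB => //; apply: log_separated_product h.
- apply: leq_trans (_ : N.+2 <= n)%N; last by move: ltn; rewrite eN.
  rewrite ltnS; apply/leq_sizeP => m; rewrite leq_eqVlt.
  have -> : unipoly j (f - product_of al be ga) = unipoly j f -
      (lift_poly i al * lift_poly k ga) *: map_poly (@mpolyC 3 K) be.
    transitivity (unipoly j f - unipoly j (lift_poly i al) * unipoly j (lift_poly j be) *
      unipoly j (lift_poly k ga)); first exact: unipoly_subM3.
    rewrite (unipoly_liftN al ji) (unipoly_liftN ga jk) (unipoly_lift j be).
    by rewrite -mul_polyC polyCM; ring.
  rewrite coefB coefZ coef_map => /orP[/eqP <-|lt].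
    have -> : be`_N.+1 = 1 by rewrite -lb lead_coefE sb.
    have -> : (unipoly j f)`_N.+1 = lead_coef (unipoly j f) by rewrite lead_coefE eN.
    by rewrite la /= mpolyC1 mulr1 subrr.
  rewrite [X in X - _]nth_default ?eN // [be`_m]nth_default ?sb //=.
  by rewrite mpolyC0 mulr0 subr0.
exists (g + c *: 'X^e); rewrite composeD -eg composeZXn -ec.
by rewrite subrK.
Qed.
End MultiplicativeForm.

(** * Dichotomy for separated ratios of partial derivatives *)

Lemma lead_coef_mul3 (A : idomainType) (G H P Q : {poly A}) c d :
  G * c%:P * P = H * d%:P * Q ->
  lead_coef G * c * lead_coef P = lead_coef H * d * lead_coef Q.
Proof. by move/(congr1 lead_coef); rewrite !lead_coefM !lead_coefC. Qed.

Lemma size_mul3 (A : idomainType) (G H P Q : {poly A}) c d :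
  G != 0 -> H != 0 -> P != 0 -> Q != 0 -> c != 0 -> d != 0 ->
  G * c%:P * P = H * d%:P * Q -> (size G <= size H)%N -> (size Q <= size P)%N.
Proof.
move=> G0 H0 P0 Q0 c0 d0; rewrite ![_ * _%:P]mulrC !mul_polyC -!scalerAl.
move/(congr1 (fun p : {poly A} => size p)); rewrite !size_scale // !size_mul //.
have ar (g h p q : nat) : (0 < g -> 0 < p -> 0 < q -> (g + p).-1 = (h + q).-1 -> g <= h -> q <= p)%N.
  by clear; lia.
by apply: ar; rewrite size_poly_gt0.
Qed.

(** Leading coefficients in j are compared. If differentiation in i keeps the degree in j, p1 / p2
    is a multiple of the logarithmic derivative of the leading coefficient. Otherwise that
    coefficient is free of i, and p1 / p2 is a multiple of the derivative of a lower one; the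
    recorded inequality of sizes serves to exclude mixed cases. *)
Lemma slice_dvd_lead i j (f : {mpoly K[3]}) (p1 p2 q1 q2 : {poly K}) : i != j ->
  f^`M(i) != 0 -> p1 != 0 -> p2 != 0 -> q1 != 0 -> q2 != 0 ->
  f^`M(i) * lift_poly i p2 * lift_poly j q1 = f^`M(j) * lift_poly i p1 * lift_poly j q2 ->
  (exists u, [/\ u^`() != 0, p1 = p2 * u^`() & (size q2 <= size q1)%N]) \/
  (exists al N, [/\ al^`() != 0, (0 < N)%N &
     (N%:R * lead_coef q2) *: (p1 * al) = lead_coef q1 *: (p2 * al^`())]).
Proof.
move=> ij fi0 p10 p20 q10 q20 e; have ji : j != i by rewrite eq_sym.
have := unipoly_mul3 j e.
rewrite (unipoly_liftN p2 ji) (unipoly_liftN p1 ji) (unipoly_lift j q1) (unipoly_lift j q2).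
rewrite -(unipoly_deriv j f) -(unipoly_mderiv f ij).
set F := unipoly j f; set G := map_poly (mderiv i) F.
have lcC (q : {poly K}) : lead_coef (map_poly (@mpolyC 3 K) q) = (lead_coef q)%:MP.
  by rewrite lead_coef_map_inj //; apply: (can_inj (@mpolyCK 3 K)).
have G0 : G != 0 by rewrite /G unipoly_mderiv // unipoly_eq0.
have F'0 : F^`() != 0.
  rewrite unipoly_deriv unipoly_eq0; apply: contra_neq fi0 => fj0; move/eqP: e.
  by rewrite fj0 !mul0r !mulf_eq0 !lift_poly_eq0 (negPf p20) (negPf q10) !orbF => /eqP.
have F1 : (1 < size F)%N by rewrite ltnNge; apply: contra F'0 => /size1_polyC ->; rewrite derivC.
have [_ lF'] := lead_coef_deriv mpoly_char0 F1.
have N0 : (0 < (size F).-1)%N by case: (size F) F1 => [|[|]].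
move=> eU; have szq : (size G < size F)%N -> (size q2 <= size q1)%N.
  have szC (q : {poly K}) : size (map_poly (@mpolyC 3 K) q) = size q.
    by rewrite size_map_inj_poly //; apply: (can_inj (@mpolyCK 3 K)).
  have nzC (q : {poly K}) : q != 0 -> map_poly (@mpolyC 3 K) q != 0.
    by rewrite -!size_poly_eq0 szC.
  have [sF' _] := lead_coef_deriv mpoly_char0 F1.
  move=> lt; rewrite -(szC q1) -(szC q2).
  apply: (size_mul3 G0 F'0 (nzC _ q10) (nzC _ q20) _ _ eU); rewrite ?lift_poly_eq0 //.
  by rewrite sF' -ltnS; case: (size F) lt.
move/lead_coef_mul3: eU; rewrite lF'.
rewrite (lcC q1) (lcC q2).
have -> : lead_coef G = (F`_(size G).-1)^`M(i) by rewrite lead_coefE coef_map.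
move: N0; set N := (size F).-1 => N0; set b := F`_(size G).-1.
have a0 : lead_coef F != 0 by rewrite lead_coef_eq0; apply: contraTneq F1 => ->; rewrite size_poly0.
have lFN : lead_coef F = F`_N by rewrite lead_coefE.
have sG : (size G <= size F)%N by apply: size_poly.
have abi : b = lead_coef F \/ (lead_coef F)^`M(i) = 0 /\ (size q2 <= size q1)%N.
  have [sGN|sGN] := eqVneq (size G) (size F); first by left; rewrite /b sGN lead_coefE.
  right; split; last by apply: szq; move: sG; rewrite leq_eqVlt (negPf sGN).
  rewrite lead_coefE -[LHS](coef_map (mderiv i)) nth_default // -/G.
  by move: sG; rewrite leq_eqVlt (negPf sGN) /= => h; rewrite -ltnS; case: (size F) h.
move: abi; move: b; move: (lead_coef F) a0 {lFN lF'} => a a0 b abi el.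
have [v v0] : exists v, a.@[v] != 0.
  apply: NNPP => h; case/eqP: a0; apply: mpoly_eq0_everywhere => v.
  by apply/eqP; apply: contraT => v0; case: h; exists v.
set al := slice i v a.
have al0 : al != 0.
  apply: contra_neq v0 => h; rewrite -(meval_eq _ (v1 := upd v i (v i))).
    by rewrite -sliceE -/al h horner0.
  by move=> t; rewrite /upd; case: eqP => [->|].
have slC c : slice i v c%:MP = c%:P by rewrite /slice mmapC.
have sle : (slice i v b)^`() * p2 * (lead_coef q1)%:P = al *+ N * p1 * (lead_coef q2)%:P.
  rewrite slice_deriv -!slC -{1}(slice_lift i v p2) -{1}(slice_lift i v p1) -rmorphMn -!rmorphM.
  by rewrite el.
have nl2 : N%:R * lead_coef q2 != 0 by rewrite mulf_neq0 ?lead_coef_eq0 // pnatr_eq0 -lt0n.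
have sle' : (N%:R * lead_coef q2) *: (p1 * al) = lead_coef q1 *: (p2 * (slice i v b)^`()).
  rewrite -!mul_polyC polyCM polyC_natr.
  transitivity (al *+ N * p1 * (lead_coef q2)%:P); first by rewrite -mulr_natr; ring.
  by rewrite -sle; ring.
have L0 : (N%:R * lead_coef q2) *: (p1 * al) != 0 by rewrite scaler_eq0 (negPf nl2) mulf_neq0.
have b'0 : (slice i v b)^`() != 0.
  by apply: contra_neq L0 => h; rewrite sle' h mulr0 scaler0.
case: abi => [eb|[ai szq']].
  by right; exists al, N; move: sle' b'0; rewrite eb -/al.
left; have [c c0 al1] : exists2 c, c != 0 & al = c%:P.
  have al1 : al = (al`_0)%:P.
    apply/size1_polyC/deriv_eq0_size; first by move=> n; rewrite pnatr_eq0.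
    by rewrite slice_deriv ai rmorph0.
  by exists al`_0 => //; apply: contra_neq al0 => h; rewrite al1 h.
have nc0 : N%:R * lead_coef q2 * c != 0 by rewrite mulf_neq0.
exists (((N%:R * lead_coef q2 * c)^-1 * lead_coef q1) *: slice i v b).
split=> //.
  by rewrite derivZ scaler_eq0 (negPf b'0) orbF mulf_eq0 invr_eq0 (negPf nc0) lead_coef_eq0.
rewrite derivZ -scalerAr -scalerA -sle' al1 [p1 * _]mulrC mul_polyC !scalerA.
by rewrite -mulrA mulVf ?scale1r.
Qed.

Lemma lift_polyZ t c (p : {poly K}) : lift_poly t (c *: p) = c%:MP * lift_poly t p.
Proof. by rewrite -mul_polyC rmorphM /= lift_polyC. Qed.

Lemma deriv_neq0_size (u : {poly K}) : u^`() != 0 -> (1 < size u)%N.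
Proof. by move=> u0; rewrite ltnNge; apply: contra u0 => /size1_polyC ->; rewrite derivC. Qed.

Lemma log_deriv_size (p1 p2 al : {poly K}) c : c != 0 -> p1 != 0 -> p2 != 0 -> al^`() != 0 ->
  p1 * al = c *: (p2 * al^`()) ->
  size p2 = (size p1).+1 /\ lead_coef p1 = c * (lead_coef p2 * (size al).-1%:R).
Proof.
move=> c0 p10 p20 al'0 e; have al1 := deriv_neq0_size al'0.
have char0 n : n.+1%:R != 0 :> K by rewrite pnatr_eq0.
have al0 : al != 0 by apply: contraTneq al1 => ->; rewrite size_poly0.
have [s l] := lead_coef_deriv char0 al1; split.
  have := congr1 (fun p : {poly K} => size p) e.
  rewrite size_scale // !size_mul // s.
  have ar (x y z : nat) : (0 < x -> 0 < y -> 1 < z -> (x + z).-1 = (y + z.-1).-1 -> y = x.+1)%N.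
    by clear; lia.
  by apply: ar; rewrite ?size_poly_gt0.
have := congr1 lead_coef e; rewrite lead_coefZ !lead_coefM l.
have la0 : lead_coef al != 0 by rewrite lead_coef_eq0.
by move=> h; apply: (mulIf la0); rewrite h -[_ *+ _ in LHS]mulr_natr; ring.
Qed.

Lemma pair_dichotomy i j (f : {mpoly K[3]}) (p1 p2 q1 q2 : {poly K}) : i != j ->
  f^`M(i) != 0 -> p1 != 0 -> p2 != 0 -> q1 != 0 -> q2 != 0 ->
  f^`M(i) * lift_poly i p2 * lift_poly j q1 = f^`M(j) * lift_poly i p1 * lift_poly j q2 ->
  (exists u v, [/\ u^`() != 0, v^`() != 0, p1 = p2 * u^`() &
     f^`M(i) * lift_poly j v^`() = f^`M(j) * lift_poly i u^`()]) \/
  (exists al be m n c, [/\ al^`() != 0, be^`() != 0, c != 0, p1 * al = c *: (p2 * al^`()) &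
     m.+1%:R * (f^`M(i) * lift_poly i al * lift_poly j be^`()) =
     n.+1%:R * (f^`M(j) * lift_poly i al^`() * lift_poly j be)]).
Proof.
move=> ij fi0 p10 p20 q10 q20 e.
have ji : j != i by rewrite eq_sym.
have Lp20 : lift_poly i p2 != 0 by rewrite lift_poly_eq0.
have Lq20 : lift_poly j q2 != 0 by rewrite lift_poly_eq0.
have fj0 : f^`M(j) != 0.
  apply: contra_neq fi0 => fj0; move/eqP: e.
  by rewrite fj0 !mul0r !mulf_eq0 !lift_poly_eq0 (negPf p20) (negPf q10) !orbF => /eqP.
have e' : f^`M(j) * lift_poly j q2 * lift_poly i p1 = f^`M(i) * lift_poly j q1 * lift_poly i p2.
  by rewrite mulrAC -e mulrAC.
have lc0 (p : {poly K}) : p != 0 -> lead_coef p != 0 by rewrite lead_coef_eq0.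
have cE (al u w : {poly K}) (N : nat) a b : a != 0 -> (0 < N)%N ->
    (N%:R * a) *: (u * al) = b *: (w * al^`()) -> u * al = ((N%:R * a)^-1 * b) *: (w * al^`()).
  move=> a0 N0 h; rewrite -scalerA -h scalerA mulVf ?scale1r // mulf_neq0 //.
  by rewrite pnatr_eq0 -lt0n.
have cN (N : nat) (a b : K) : (0 < N)%N -> a != 0 -> b != 0 -> (N%:R * a)^-1 * b != 0.
  by move=> N0 a0 b0; rewrite mulf_neq0 // invr_eq0 mulf_neq0 // pnatr_eq0 -lt0n.
case: (slice_dvd_lead ij fi0 p10 p20 q10 q20 e) => [[u [u0 eu su]]|[al [N [al0 N0 eal]]]];
  case: (slice_dvd_lead ji fj0 q10 q20 p10 p20 e') => [[v [v0 ev sv]]|[be [M [be0 M0 ebe]]]].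
- left; exists u, v; split=> //.
  apply: (mulIf (mulf_neq0 Lp20 Lq20)).
  transitivity (f^`M(i) * lift_poly i p2 * (lift_poly j q2 * lift_poly j v^`())); first by ring.
  rewrite -rmorphM -ev e eu rmorphM; ring.
- have := log_deriv_size (cN _ _ _ M0 (lc0 _ p20) (lc0 _ p10)) q10 q20 be0 (cE _ _ _ _ _ _ (lc0 _ p20) M0 ebe).
  by move=> [h _]; move: su; rewrite h ltnn.
- have := log_deriv_size (cN _ _ _ N0 (lc0 _ q20) (lc0 _ q10)) p10 p20 al0 (cE _ _ _ _ _ _ (lc0 _ q20) N0 eal).
  by move=> [h _]; move: sv; rewrite h ltnn.
right; set c := (N%:R * lead_coef q2)^-1 * lead_coef q1.
have c0 : c != 0 by apply: cN => //; apply: lc0.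
have eal' := cE _ _ _ _ _ _ (lc0 _ q20) N0 eal; rewrite -/c in eal'.
have [_ lp1] := log_deriv_size c0 p10 p20 al0 eal'.
set d := (M%:R * lead_coef p2)^-1 * lead_coef p1.
have d0 : d != 0 by apply: cN => //; apply: lc0.
have ebe' := cE _ _ _ _ _ _ (lc0 _ p20) M0 ebe; rewrite -/d in ebe'.
have al1 := deriv_neq0_size al0.
exists al, be, (size al).-2, M.-1, c; split=> //.
have eA : (size al).-2.+1 = (size al).-1 by case: (size al) al1 => [|[|]].
have eM : M.-1.+1 = M by case: M M0 {ebe d d0 ebe'}.
(* Both c and d are determined by the quotient of the leading coefficients of p1 and p2, so c / d is
   the rational number M / deg al. *)
have ed : (size al).-1%:R * c = M%:R * d.
  rewrite /d lp1; field.
  by rewrite lc0 // pnatr_eq0 -lt0n.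
have eL1 : lift_poly i p1 * lift_poly i al = c%:MP * (lift_poly i p2 * lift_poly i al^`()).
  by have := congr1 (lift_poly i) eal'; rewrite lift_polyZ !rmorphM.
have eL2 : lift_poly j q1 * lift_poly j be = d%:MP * (lift_poly j q2 * lift_poly j be^`()).
  by have := congr1 (lift_poly j) ebe'; rewrite lift_polyZ !rmorphM.
have d0' : d%:MP != 0 :> {mpoly K[3]} by rewrite mpolyC_eq0.
rewrite eA eM; apply: (mulIf (mulf_neq0 (mulf_neq0 Lp20 Lq20) d0')).
transitivity ((size al).-1%:R * (f^`M(i) * lift_poly i p2 * lift_poly i al *
  (d%:MP * (lift_poly j q2 * lift_poly j be^`())))); first by ring.
rewrite -eL2; transitivity ((size al).-1%:R * lift_poly i al * lift_poly j be *
  (f^`M(i) * lift_poly i p2 * lift_poly j q1)); first by ring.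
rewrite e; transitivity ((size al).-1%:R * lift_poly j be * f^`M(j) * lift_poly j q2 *
  (lift_poly i p1 * lift_poly i al)); first by ring.
rewrite eL1; have ed' : (size al).-1%:R * c%:MP = M%:R * d%:MP :> {mpoly K[3]}.
  by rewrite -!mpolyC_nat -!mpolyCM ed.
transitivity (((size al).-1%:R * c%:MP) * (lift_poly j be * f^`M(j) * lift_poly j q2 *
  lift_poly i p2 * lift_poly i al^`())); first by ring.
by rewrite ed'; ring.
Qed.

Definition special_form i j k (f : {mpoly K[3]}) := exists g u v w,
  f = compose g (lift_poly i u + lift_poly j v + lift_poly k w) \/
  f = compose g (product_of i j k u v w).

Lemma expr_deriv_neq0 (u : {poly K}) n : u^`() != 0 -> (u ^+ n.+1)^`() != 0.
Proof.
move=> u0; have u1 := deriv_neq0_size u0; rewrite deriv_exp /= -mulr_natr.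
rewrite !mulf_neq0 // ?expf_neq0 //; first by apply: contraTneq u1 => ->; rewrite size_poly0.
by rewrite -polyC_natr polyC_eq0 pnatr_eq0.
Qed.

Lemma lift_expr_deriv t (u : {poly K}) n :
  lift_poly t (u ^+ n.+1)^`() * lift_poly t u =
  n.+1%:R * (lift_poly t u^`() * lift_poly t (u ^+ n.+1)).
Proof.
rewrite deriv_exp /= -[_ *+ _]mulr_natr !rmorphM /= rmorph_nat.
by rewrite !rmorphXn /= exprS; ring.
Qed.

(** The logarithmic derivative of a power is a multiple of that of its base, so suitable powers of
    al and be absorb the rational ratio. *)
Lemma log_separated_of_ratio a b (f : {mpoly K[3]}) (al be : {poly K}) m n m' n' :
  al != 0 -> be != 0 ->
  m.+1%:R * (f^`M(a) * lift_poly a al * lift_poly b be^`()) =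
  n.+1%:R * (f^`M(b) * lift_poly a al^`() * lift_poly b be) ->
  (n'.+1 * m.+1 = m'.+1 * n.+1)%N ->
  f^`M(a) * lift_poly a (al ^+ n'.+1) * lift_poly b (be ^+ m'.+1)^`() =
  f^`M(b) * lift_poly a (al ^+ n'.+1)^`() * lift_poly b (be ^+ m'.+1).
Proof.
move=> al0 be0 e en.
have La : lift_poly a al != 0 by rewrite lift_poly_eq0.
have Lb : lift_poly b be != 0 by rewrite lift_poly_eq0.
have m0 : m.+1%:R != 0 :> {mpoly K[3]} by apply: mpoly_char0.
apply: (mulIf (mulf_neq0 (mulf_neq0 La Lb) m0)).
have e1 := lift_expr_deriv a al n'; have e2 := lift_expr_deriv b be m'.
set A := lift_poly a (al ^+ _) in e1 *; set B := lift_poly b (be ^+ _) in e2 *.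
set A' := lift_poly a (_)^`() in e1 *; set B' := lift_poly b (_)^`() in e2 *.
transitivity (f^`M(a) * A * (B' * lift_poly b be) * lift_poly a al * m.+1%:R); first by ring.
rewrite e2; transitivity (m'.+1%:R * A * B *
  (m.+1%:R * (f^`M(a) * lift_poly a al * lift_poly b be^`()))); first by ring.
rewrite e; transitivity ((m'.+1 * n.+1)%:R * A * B * (f^`M(b) * lift_poly a al^`() * lift_poly b be)).
  by rewrite natrM; ring.
rewrite -en; transitivity (f^`M(b) * (A' * lift_poly a al) * B * lift_poly b be * m.+1%:R).
  by rewrite e1 natrM; ring.
by ring.
Qed.

Lemma special_form_of_ratio i j k (f : {mpoly K[3]}) (p1 p2 q1 q2 s1 s2 : {poly K}) :
  i != j -> i != k -> j != k -> f^`M(i) != 0 ->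
  p1 != 0 -> p2 != 0 -> q1 != 0 -> q2 != 0 -> s2 != 0 ->
  f^`M(i) * lift_poly i p2 * lift_poly j q1 = f^`M(j) * lift_poly i p1 * lift_poly j q2 ->
  f^`M(i) * lift_poly i p2 * lift_poly k s1 = f^`M(k) * lift_poly i p1 * lift_poly k s2 ->
  special_form i j k f.
Proof.
move=> ij ik jk fi0 p10 p20 q10 q20 s20 e1 e2.
have nz (u : {poly K}) : u^`() != 0 -> u != 0 by apply: contra_neq => ->; rewrite deriv0.
have Lp20 : lift_poly i p2 != 0 by rewrite lift_poly_eq0.
have [fk0|fk0] := eqVneq f^`M(k) 0.
  case: (pair_dichotomy ij fi0 p10 p20 q10 q20 e1) => [[u [v [u0 v0 _ e]]]|].
    have [|g eg] := additive_form ij ik jk u0 v0 e (r := 0).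
      by rewrite fk0 deriv0 rmorph0 mulr0 mul0r.
    by exists g, u, v, 0; left.
  move=> [al [be [m [n [c [al0 be0 c0 eal e]]]]]].
  have h1 := log_separated_of_ratio (nz _ al0) (nz _ be0) e (mulnC n.+1 m.+1).
  have [|g [u [v [w eg]]]] := multiplicative_form ij ik jk
     (expr_deriv_neq0 n al0) (expr_deriv_neq0 m be0) (oner_neq0 _) (f := f); last first.
    by exists g, u, v, w; right.
  by split=> //; rewrite fk0 -polyC1 derivC rmorph0 mulr0 !mul0r.
have s10 : s1 != 0.
  apply: contra_neq fk0 => s10; move/esym/eqP: e2; rewrite s10 rmorph0 mulr0.
  by rewrite !mulf_eq0 !lift_poly_eq0 (negPf p10) (negPf s20) !orbF => /eqP.
(* In the additive alternative p2 divides p1; in the logarithmic one deg p2 = deg p1 + 1. Both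
   equations share p1 and p2, so they fall under the same alternative. *)
have mixed (u al : {poly K}) c : u^`() != 0 -> p1 = p2 * u^`() -> c != 0 -> al^`() != 0 ->
    p1 * al = c *: (p2 * al^`()) -> False.
  move=> u0 eu c0 al0 /(log_deriv_size c0 p10 p20 al0) [+ _]; rewrite eu size_mul //.
  have ar (x y : nat) : (0 < x -> 0 < y -> x = (x + y).-1.+1 -> False)%N by clear; lia.
  by apply: ar; rewrite size_poly_gt0.
case: (pair_dichotomy ij fi0 p10 p20 q10 q20 e1);
  case: (pair_dichotomy ik fi0 p10 p20 s10 s20 e2).
- move=> [u2 [w [u20 w0 eu2 ew]]] [u [v [u0 v0 eu ev]]].
  have euu : u^`() = u2^`() by apply: (mulfI p20); rewrite -eu -eu2.
  have [|g eg] := additive_form ij ik jk u0 v0 ev (r := w); first by rewrite euu.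
  by exists g, u, v, w; left.
- by move=> [al [ga [m [n [c [al0 _ c0 eal _]]]]]] [u [v [u0 _ eu _]]]; case: (mixed u al c).
- by move=> [u [v [u0 _ eu _]]] [al [ga [m [n [c [al0 _ c0 eal _]]]]]]; case: (mixed u al c).
move=> [al2 [ga [m2 [n2 [c2 [al20 ga0 c20 eal2 ek]]]]]] [al [be [m [n [c [al0 be0 c0 eal ej]]]]]].
have [_ l1] := log_deriv_size c0 p10 p20 al0 eal.
have [_ l2] := log_deriv_size c20 p10 p20 al20 eal2.
have pos (u : {poly K}) : u^`() != 0 -> (size u).-1 = (size u).-2.+1.
  by move/deriv_neq0_size; case: (size u) => [|[|]].
have ec : c * (size al).-1%:R = c2 * (size al2).-1%:R.
  have lp20 : lead_coef p2 != 0 by rewrite lead_coef_eq0.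
  apply: (mulIf lp20); transitivity (lead_coef p1); first by rewrite l1; ring.
  by rewrite l2; ring.
(* The logarithmic derivatives of al and al2 are both proportional to p1 / p2, with ratio that of
   the degrees. Hence the second equation can be rewritten with al in place of al2. *)
have eal' : (size al).-1%:R *: (al2^`() * al) = (size al2).-1%:R *: (al^`() * al2).
  have h : c2 *: (al2^`() * al) = c *: (al^`() * al2).
    apply: (mulfI p20); rewrite -!scalerAr.
    transitivity ((c2 *: (p2 * al2^`())) * al); first by rewrite -scalerAl mulrA.
    rewrite -eal2 mulrAC eal -scalerAl mulrA; congr (_ *: _); ring.
  have c00 : c != 0 by [].
  have : c *: ((size al).-1%:R *: (al2^`() * al)) = c *: ((size al2).-1%:R *: (al^`() * al2)).
    rewrite scalerA ec mulrC -scalerA h !scalerA; congr (_ *: _); ring.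
  by move/(scalerI c00).
have ek' : (((m2.+1 * (size al).-1).-1).+1)%:R * (f^`M(i) * lift_poly i al * lift_poly k ga^`()) =
    (((n2.+1 * (size al2).-1).-1).+1)%:R * (f^`M(k) * lift_poly i al^`() * lift_poly k ga).
  have := congr1 (lift_poly i) eal'; rewrite !lift_polyZ !rmorphM /= !mpolyC_nat => E.
  have La2 : lift_poly i al2 != 0 by rewrite lift_poly_eq0 nz.
  have prA a (u : {poly K}) : u^`() != 0 -> ((a.+1 * (size u).-1).-1.+1 = a.+1 * (size u).-1)%N.
    by move=> u0; rewrite prednK // muln_gt0 (pos _ u0).
  rewrite (prA _ _ al0) (prA _ _ al20) !natrM; apply: (mulIf La2).
  transitivity ((size al).-1%:R * lift_poly i al *
    (m2.+1%:R * (f^`M(i) * lift_poly i al2 * lift_poly k ga^`()))); first by ring.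
  rewrite ek; transitivity (n2.+1%:R * f^`M(k) * lift_poly k ga *
    ((size al).-1%:R * (lift_poly i al2^`() * lift_poly i al))); first by ring.
  by rewrite E; ring.
set m3 := (m2.+1 * _).-1 in ek'; set n3 := (n2.+1 * _).-1 in ek'.
have pr a b : ((a.+1 * b.+1).-1.+1 = a.+1 * b.+1)%N by rewrite prednK // muln_gt0.
(* The exponent (n + 1)(n3 + 1) of al is chosen to serve both ratios at once. *)
have h1 := log_separated_of_ratio (n' := (n.+1 * n3.+1).-1) (m' := (m.+1 * n3.+1).-1)
  (nz _ al0) (nz _ be0) ej.
have h2 := log_separated_of_ratio (n' := (n.+1 * n3.+1).-1) (m' := (m3.+1 * n.+1).-1)
  (nz _ al0) (nz _ ga0) ek'.
have [|g [u [v [w eg]]]] := multiplicative_form ij ik jk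
   (expr_deriv_neq0 (n.+1 * n3.+1).-1 al0) (expr_deriv_neq0 (m.+1 * n3.+1).-1 be0)
   (nz _ (expr_deriv_neq0 (m3.+1 * n.+1).-1 ga0)) (f := f); last first.
  by exists g, u, v, w; right.
split; first by apply: h1; rewrite !pr mulnC mulnA mulnAC.
by apply: h2; rewrite !pr mulnC mulnA.
Qed.

(** * Separating the ratios of partial derivatives *)

Definition specialize k (c : K) : {mpoly K[3]} -> {mpoly K[3]} :=
  mmap (@mpolyC 3 K) (fun t => if t == k then c%:MP else 'X_t).

Lemma meval_specialize k c f w : (specialize k c f).@[w] = f.@[upd w k c].
Proof.
rewrite /specialize {2}/meval.
pose phi : {rmorphism {mpoly K[3]} -> K} := meval w.
apply: (mmap_morph (phi := phi) (h' := idfun)) => [d|t]; rewrite /phi /=; first exact: mevalC.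
by rewrite /upd; case: eqP => _; rewrite ?mevalC ?mevalXU.
Qed.

Lemma mpoly_neq0_point (f : {mpoly K[3]}) : f != 0 -> exists v, f.@[v] != 0.
Proof.
move=> f0; apply: NNPP => h; case/eqP: f0; apply: mpoly_eq0_everywhere => v.
by apply/eqP; apply: contraT => v0; case: h; exists v.
Qed.

Lemma upd_id (v : 'I_3 -> K) t : upd v t (v t) =1 v.
Proof. by move=> u; rewrite /upd; case: eqP => [->|]. Qed.

Lemma meval_mderiv0 t (g : {mpoly K[3]}) w c : g^`M(t) = 0 -> g.@[upd w t c] = g.@[w].
Proof.
move=> g0; rewrite -(meval_eq g (upd_id w t)) -!sliceE.
have -> : slice t w g = ((slice t w g)`_0)%:P.
  apply/size1_polyC/deriv_eq0_size; first by move=> n; rewrite pnatr_eq0.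
  by rewrite slice_deriv g0 rmorph0.
by rewrite !hornerC.
Qed.

Section Ratio.
Variables (i j k : 'I_3).
Hypotheses (ij : i != j) (ik : i != k) (jk : j != k).

Lemma lift_slice v (g : {mpoly K[3]}) : g^`M(j) = 0 -> g^`M(k) = 0 ->
  g = lift_poly i (slice i v g).
Proof.
move=> gj gk; apply/eqP; rewrite -subr_eq0; apply/eqP/mpoly_eq0_everywhere => w.
rewrite mevalB meval_lift sliceE.
rewrite -(meval_mderiv0 w (v j) gj) -(meval_mderiv0 (upd w j (v j)) (v k) gk).
rewrite (@meval_eq _ _ _ (upd v i (w i))) ?subrr // => t.
rewrite /upd; case: (ord3_cases t ij ik jk) => ->; rewrite ?eqxx ?(negPf ij) ?(negPf ik) //.
  by rewrite (negPf jk) (eq_sym j i) (negPf ij).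
by rewrite (eq_sym k i) (negPf ik).
Qed.

(** By hypothesis f_i / f_j is independent of z, f_i / f_k of y and f_j / f_k of x. So f_i / f_j =
    (f_i / f_k)(f_k / f_j), taken at z = z0, is a function of x times a function of y; similarly for
    f_i / f_k at y = y0. *)
Lemma special_form_of_jacobians (f : {mpoly K[3]}) :
  f^`M(i) != 0 -> f^`M(j) != 0 -> f^`M(k) != 0 ->
  (forall x y z z', jacobian i j f x y z z' = 0) ->
  (forall x z y y', jacobian i k f x z y y' = 0) ->
  (forall y z x x', jacobian j k f y z x x' = 0) ->
  special_form i j k f.
Proof.
move=> fi0 fj0 fk0 Jij Jik Jjk.
have ki : k != i by rewrite eq_sym.
have kj : k != j by rewrite eq_sym.
have ji : j != i by rewrite eq_sym.
have [v] := mpoly_neq0_point (mulf_neq0 (mulf_neq0 fi0 fj0) fk0).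
rewrite !mevalM !mulf_eq0 !negb_or => /andP[/andP[vi vj] vk].
pose E (g : {mpoly K[3]}) x y z := g.@[pt3 i j x y z].
have Ew g w : g.@[w] = E g (w i) (w j) (w k) by apply/meval_eq/pt3E.
have Eik g x y z : g.@[pt3 i k x z y] = E g x y z.
  by rewrite Ew /pt3 /upd ?eqxx ?(negPf ki) ?(negPf ji) ?(negPf jk) ?(negPf ij) ?(negPf ik) ?(negPf kj) ?eqxx.
have Ejk g x y z : g.@[pt3 j k y z x] = E g x y z.
  by rewrite Ew /pt3 /upd ?eqxx ?(negPf ki) ?(negPf ji) ?(negPf jk) ?(negPf ij) ?(negPf ik) ?(negPf kj) ?eqxx.
set x0 := v i; set y0 := v j; set z0 := v k.
pose fi := E f^`M(i); pose fj := E f^`M(j); pose fk := E f^`M(k).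
have hij x y z z' : fi x y z * fj x y z' = fj x y z * fi x y z'.
  by apply/eqP; rewrite -subr_eq0; apply/eqP/Jij.
have hik x y z y' : fi x y z * fk x y' z = fk x y z * fi x y' z.
  by have := Jik x z y y'; rewrite /jacobian !Eik => /eqP; rewrite subr_eq0 => /eqP.
have hjk x y z x' : fj x y z * fk x' y z = fk x y z * fj x' y z.
  by have := Jjk y z x x'; rewrite /jacobian !Ejk => /eqP; rewrite subr_eq0 => /eqP.
have Si g x : (slice i v g).[x] = E g x y0 z0.
  by rewrite sliceE Ew /upd eqxx (negPf ji) (negPf ki).
have Sj g y : (slice j v g).[y] = E g x0 y z0.
  by rewrite sliceE Ew /upd eqxx (negPf ij) (negPf kj).
have Sk g z : (slice k v g).[z] = E g x0 y0 z.
  by rewrite sliceE Ew /upd eqxx (negPf ik) (negPf jk).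
have nz t (g : {mpoly K[3]}) : g.@[v] != 0 -> slice t v g != 0.
  by move=> g0; apply: contra_neq g0 => e; rewrite -(meval_eq g (upd_id v t)) -sliceE e horner0.
have fj000 : fj x0 y0 z0 != 0 by move: vj; rewrite Ew.
have fk000 : fk x0 y0 z0 != 0 by move: vk; rewrite Ew.
(* The partial derivatives are restricted to lines through [v], where none of them vanishes; the
   constants in [s1] and [s2] account for the value of f_k / f_j at [v]. *)
apply: (special_form_of_ratio (p1 := slice i v f^`M(i)) (p2 := slice i v f^`M(k))
  (q1 := slice j v f^`M(j)) (q2 := slice j v f^`M(k))
  (s1 := fj x0 y0 z0 *: slice k v f^`M(k)) (s2 := fk x0 y0 z0 *: slice k v f^`M(j)) ij ik jk) => //;
  try exact: nz.
- by rewrite scaler_eq0 negb_or fk000 nz.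
(* Multiplying by the nonzero polynomial f_k(x, y, z0) clears the denominators. *)
- have h0 : specialize k z0 f^`M(k) != 0.
    apply: contra_neq vk => h; rewrite -(meval_eq _ (upd_id v k)) -/z0.
    by rewrite -meval_specialize h meval0.
  apply: (mulfI h0); apply/eqP; rewrite -subr_eq0; apply/eqP/mpoly_eq0_everywhere => w.
  rewrite mevalB !mevalM meval_specialize !meval_lift !Si !Sj !Ew.
  rewrite /upd eqxx (negPf ik) (negPf jk) -/(fi _ _ _) -/(fj _ _ _) -/(fk _ _ _).
  move: (w i) (w j) (w k) => x y z; apply/eqP; rewrite subr_eq0; apply/eqP.
  rewrite -/fi -/fj -/fk.
  transitivity (fi x y z * fk x y0 z0 * (fk x y z0 * fj x0 y z0)); first by ring.
  rewrite -hjk; transitivity (fi x y z * fj x y z0 * fk x y0 z0 * fk x0 y z0); first by ring.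
  rewrite hij; transitivity (fj x y z * (fi x y z0 * fk x y0 z0) * fk x0 y z0); first by ring.
  by rewrite hik; ring.
have h0 : specialize j y0 f^`M(k) != 0.
  apply: contra_neq vk => h; rewrite -(meval_eq _ (upd_id v j)) -/y0.
  by rewrite -meval_specialize h meval0.
have h1 : specialize k z0 (specialize j y0 f^`M(k)) != 0.
  apply: contra_neq vk => h; rewrite -(meval_eq _ (upd_id v j)) -/y0.
  by rewrite -meval_specialize -(meval_eq _ (upd_id v k)) -meval_specialize h meval0.
apply: (mulfI (mulf_neq0 h0 h1)); apply/eqP; rewrite -subr_eq0; apply/eqP/mpoly_eq0_everywhere => w.
rewrite mevalB !mevalM !meval_specialize !meval_lift !hornerZ !Si !Sk !Ew.
rewrite /upd !(eqxx, negPf ik, negPf jk, negPf ij, negPf kj, negPf ki, negPf ji).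
rewrite -/fi -/fj -/fk; move: (w i) (w j) (w k) => x y z; apply/eqP; rewrite subr_eq0; apply/eqP.
transitivity (fi x y z * fk x y0 z * fk x y0 z0 ^+ 2 * fj x0 y0 z0 * fk x0 y0 z); first by ring.
rewrite hik.
transitivity (fk x y z * fk x0 y0 z * fi x y0 z * fk x y0 z0 * (fk x y0 z0 * fj x0 y0 z0)); first by ring.
rewrite -hjk.
transitivity (fk x y z * fk x0 y0 z * fk x y0 z0 * fk x0 y0 z0 * (fi x y0 z * fj x y0 z0)); first by ring.
rewrite hij.
transitivity (fk x y z * fk x y0 z0 * fk x0 y0 z0 * fi x y0 z0 * (fj x y0 z * fk x0 y0 z)); first by ring.
by rewrite hjk; ring.
Qed.
End Ratio.

(** The quotient f / g is free of the variable t, and leading coefficients in t represent it as b /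
    a. Variables absent from f and g stay absent. *)
Lemma mpoly_wronskian0 t (f g : {mpoly K[3]}) : g != 0 -> f^`M(t) * g = f * g^`M(t) ->
  exists a b : {mpoly K[3]}, [/\ a != 0, a * f = b * g, a^`M(t) = 0, b^`M(t) = 0 &
    forall s, s != t -> f^`M(s) = 0 -> g^`M(s) = 0 -> a^`M(s) = 0 /\ b^`M(s) = 0].
Proof.
move=> g0 e; exists (lead_coef (unipoly t g)), (lead_coef (unipoly t f)); split.
- by rewrite lead_coef_eq0 unipoly_eq0.
- have um (u v : {mpoly K[3]}) : unipoly t (u * v) = unipoly t u * unipoly t v by exact: rmorphM.
  have h : (unipoly t f)^`() * unipoly t g = unipoly t f * (unipoly t g)^`().
    by rewrite !unipoly_deriv -!um e.
  have := wronskian0_proportional mpoly_char0 _ h; rewrite unipoly_eq0 => /(_ g0).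
  by move/(congr1 (horner^~ 'X_t)); rewrite !hornerZ !unipolyK.
- exact: coef_unipoly_mderiv.
- exact: coef_unipoly_mderiv.
move=> s st fs gs; rewrite !lead_coefE !coef_unipoly_mderivN // fs gs.
by rewrite (rmorph0 (unipoly t)) !coef0.
Qed.

Section Separated.
Variables (i j k : 'I_3).
Hypotheses (ij : i != j) (ik : i != k) (jk : j != k).

(* The vanishing of the separation says that the logarithmic derivative of f_i / f_j in the
   variable i does not depend on the variable j. *)
Lemma special_form_of_separation (f : {mpoly K[3]}) :
  f^`M(i) != 0 -> f^`M(j) != 0 -> f^`M(k) = 0 -> separation f i j = 0 ->
  special_form i j k f.
Proof.
move=> a0 b0 fk e.
have ji : j != i by rewrite eq_sym.
have ki : k != i by rewrite eq_sym.
have kj : k != j by rewrite eq_sym.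
have ak : f^`M(i)^`M(k) = 0 by rewrite mderiv_comm fk mderiv0.
have bk : f^`M(j)^`M(k) = 0 by rewrite mderiv_comm fk mderiv0.
have aik : f^`M(i)^`M(i)^`M(k) = 0 by rewrite mderiv_comm ak mderiv0.
have bik : f^`M(j)^`M(i)^`M(k) = 0 by rewrite mderiv_comm bk mderiv0.
have bi : f^`M(j)^`M(i) = f^`M(i)^`M(j) by rewrite mderiv_comm.
have aij : f^`M(i)^`M(i)^`M(j) = f^`M(i)^`M(j)^`M(i) by rewrite mderiv_comm.
move: e bi aij a0 b0 ak bk aik bik; rewrite /separation.
have main (a b : {mpoly K[3]}) :
    a ^+ 2 * (a^`M(j)^`M(j) * b - a^`M(j) * b^`M(j)) -
    b ^+ 2 * (a^`M(j)^`M(i) * a - a^`M(j) * a^`M(i)) = 0 ->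
    b^`M(i) = a^`M(j) -> a^`M(i)^`M(j) = a^`M(j)^`M(i) -> a != 0 -> b != 0 ->
    a^`M(k) = 0 -> b^`M(k) = 0 -> a^`M(i)^`M(k) = 0 -> b^`M(i)^`M(k) = 0 ->
    exists p1 p2 q1 q2 : {poly K}, [/\ p1 != 0, p2 != 0, q1 != 0, q2 != 0 &
      a * lift_poly i p2 * lift_poly j q1 = b * lift_poly i p1 * lift_poly j q2].
  move=> e bi aij a0 b0 ak bk aik bik.
  have [v] := mpoly_neq0_point (mulf_neq0 a0 b0); rewrite mevalM mulf_eq0 negb_or => /andP[va vb].
  have nz (g : {mpoly K[3]}) : g.@[v] != 0 -> slice i v g != 0.
    by move=> g0; apply: contra_neq g0 => h; rewrite -(meval_eq g (upd_id v i)) -sliceE h horner0.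
  (* n / d is the logarithmic derivative of a / b in the variable i; it depends on that variable
     alone. *)
  have [||d [n [d0 edn dj nj /(_ k kj)]]] :=
      @mpoly_wronskian0 j (a^`M(i) * b - a * b^`M(i)) (a * b).
  - exact: mulf_neq0.
  - rewrite mderivB !mderivM bi aij; apply/eqP; rewrite -subr_eq0; apply/eqP.
    by move: e => /(congr1 -%R); rewrite oppr0 => <-; ring.
  rewrite mderivB !mderivM ak bk aik bik !mulr0 !mul0r !addr0 subr0 => -[] // dk nk.
  set p1 := slice i v a; set p2 := slice i v b.
  have sm (g h : {mpoly K[3]}) : slice i v (g * h) = slice i v g * slice i v h by exact: rmorphM.
  have sb (g h : {mpoly K[3]}) : slice i v (g - h) = slice i v g - slice i v h by exact: rmorphB.
  have e0 : slice i v d * (p1^`() * p2 - p1 * p2^`()) = slice i v n * (p1 * p2).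
    by rewrite /p1 /p2 !slice_deriv -!sm -!sb -!sm edn !sm.
  have lm (g h : {poly K}) : lift_poly i (g * h) = lift_poly i g * lift_poly i h by exact: rmorphM.
  have lb (g h : {poly K}) : lift_poly i (g - h) = lift_poly i g - lift_poly i h by exact: rmorphB.
  have := congr1 (lift_poly i) e0; rewrite !lm lb !lm -(lift_slice ij ik jk v dj dk).
  rewrite -(lift_slice ij ik jk v nj nk) => e1.
  have L1 := lift_poly_deriv i p1; have L2 := lift_poly_deriv i p2.
  have L1k : (lift_poly i p1)^`M(k) = 0 by rewrite lift_poly_derivN.
  have L2k : (lift_poly i p2)^`M(k) = 0 by rewrite lift_poly_derivN.
  (* p1 / p2 is a slice of a / b with the same logarithmic derivative in i, so (a p2) / (b p1)
     depends on the variable j alone. *)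
  have [||d' [n' [d'0 edn' di' ni' /(_ k ki)]]] :=
      @mpoly_wronskian0 i (a * lift_poly i p2) (b * lift_poly i p1).
  - by rewrite mulf_neq0 ?lift_poly_eq0 ?nz.
  - rewrite !mderivM L1 L2; apply: (mulfI d0); apply/eqP; rewrite -subr_eq0; apply/eqP.
    move: edn e1; move: (lift_poly i p1) (lift_poly i p2) (lift_poly i p1^`()) (lift_poly i p2^`()).
    move: (a^`M(i)) (b^`M(i)) => ai bi' P1 P2 P1' P2' h1 h2.
    transitivity (P1 * P2 * (d * (ai * b - a * bi')) - a * b * (d * (P1' * P2 - P1 * P2'))).
      by ring.
    by rewrite h1 h2; ring.
  rewrite !mderivM ak bk L1k L2k !mulr0 !mul0r !addr0 => -[] // dk' nk'.
  have ed' := lift_slice ji jk ik v di' dk'.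
  have en' := lift_slice ji jk ik v ni' nk'.
  exists p1, p2, (slice j v d'), (slice j v n'); split; rewrite ?nz //.
  - by rewrite -(lift_poly_eq0 j) -ed'.
  - rewrite -(lift_poly_eq0 j) -en'; apply: contra_neq d'0 => n0.
    move/eqP: edn'; rewrite n0 mul0r !mulf_eq0 (negPf a0) lift_poly_eq0 (negPf (nz _ vb)) !orbF.
    by move/eqP.
  by rewrite -ed' -en' mulrC edn' mulrC.
move=> e bi aij a0 b0 ak bk aik bik.
have [p1 [p2 [q1 [q2 [p10 p20 q10 q20 h]]]]] := main _ _ e bi aij a0 b0 ak bk aik bik.
apply: (special_form_of_ratio (s1 := 0) (s2 := 1) ij ik jk a0 p10 p20 q10 q20 _ h).
  exact: oner_neq0.
by rewrite fk rmorph0 mulr0 !mul0r.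
Qed.
End Separated.

(** * Rich polynomials have a special form *)

Lemma special_form_swap i j k (f : {mpoly K[3]}) : special_form i j k f -> special_form j i k f.
Proof.
move=> [g [u [v [w [->|->]]]]]; exists g, v, u, w; [left|right]; first by rewrite [lift_poly i u + _]addrC.
by rewrite /product_of [lift_poly i u * _]mulrC.
Qed.

Lemma special_form_rot i j k (f : {mpoly K[3]}) : special_form i j k f -> special_form j k i f.
Proof.
move=> [g [u [v [w [->|->]]]]]; exists g, v, w, u; [left|right]; first by rewrite -addrA [lift_poly i u + _]addrC.
by rewrite /product_of -mulrA [lift_poly i u * _]mulrC.
Qed.

Section Rich.
Variables (D N : nat).

Lemma jacobian_eq0 : exists n0, forall (f : {mpoly K[3]}) (i j k : 'I_3) m n
    (X : 'I_3 -> 'I_m -> K) (delta : 'I_n -> K) (S : {set {ffun 'I_3 -> 'I_m}})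
    (lab : {ffun 'I_3 -> 'I_m} -> 'I_n),
  i != j -> i != k -> j != k -> (n0 < n)%N -> (msize f <= D.+1)%N ->
  (m <= n)%N -> (n ^ 5 <= m ^ 6)%N -> (m ^ 3 <= N * #|S|)%N ->
  (forall t, {homo X t : a c / (a < c)%N >-> a < c}) ->
  {homo delta : a c / (a < c)%N >-> a < c} ->
  (forall s, s \in S -> f.@[fun t => X t (s t)] = delta (lab s)) ->
  forall x y z w, jacobian i j f x y z w = 0.
Proof.
have [C hC] := incidence3_bound D N; exists C => f i j k m n X delta S lab ij ik jk Cn sf mn nm mS.
move=> Xlt dlt hS x y z w; apply/eqP; apply: contraT => J0.
have := hC _ _ _ mn nm mS (fun b b0 => incidence3 ij ik jk sf b0 Xlt dlt hS J0).
by rewrite leqNgt Cn.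
Qed.

Lemma separation_eq0 : exists n0, forall (f : {mpoly K[3]}) (i j k : 'I_3) m n
    (X : 'I_3 -> 'I_m -> K) (delta : 'I_n -> K) (S : {set {ffun 'I_3 -> 'I_m}})
    (lab : {ffun 'I_3 -> 'I_m} -> 'I_n),
  i != j -> i != k -> j != k -> (n0 < n)%N -> (msize f <= D.+1)%N ->
  (n ^ 5 <= m ^ 6)%N -> (m ^ 3 <= N * #|S|)%N ->
  (forall t, {homo X t : a c / (a < c)%N >-> a < c}) ->
  {homo delta : a c / (a < c)%N >-> a < c} ->
  (forall s, s \in S -> f.@[fun t => X t (s t)] = delta (lab s)) ->
  f^`M(i) != 0 -> f^`M(j) != 0 -> f^`M(k) = 0 -> separation f i j = 0.
Proof.
(* [2 * N] allows for losing half of the points. The square in the threshold, with n <= m^2, gives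
   24 D N <= m, which keeps the loss below that. *)
have [C hC] := incidence2_bound D (2 * N); exists (C + (24 * D * N) ^ 2)%N.
move=> f i j k m n X delta S lab ij ik jk Cn sf nm mS Xlt dlt hS fi0 fj0 fk0.
apply/eqP; apply: contraT => sep0.
have m0 : (0 < m)%N.
  case: m nm {X S lab mS Xlt hS} => //; rewrite exp0n // leqn0 expn_eq0 andbT => /eqP n0.
  by rewrite n0 in Cn.
have ji : j != i by rewrite eq_sym.
have [w] := mpoly_neq0_point (mulf_neq0 (mulf_neq0 fi0 fj0) sep0).
set Om := _ * _ => Omw.
pose ev (g : {mpoly K[3]}) (p : 'I_m * 'I_m) := g.@[upd (upd w j (X j p.2)) i (X i p.1)].
have sd t (g : {mpoly K[3]}) : (msize g <= D.+1)%N -> (msize g^`M(t) <= D.+1)%N.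
  by move=> sg; apply: leq_trans (msize_mderiv _ _) _; apply: leq_trans (leq_pred _) sg.
have ms (a b aa ab bb abi abj : {mpoly K[3]}) : all (fun g => msize g <= D.+1)%N
    [:: a; b; aa; ab; bb; abi; abj] ->
    (msize (a * b * (a ^+ 2 * (abj * b - ab * bb) - b ^+ 2 * (abi * a - ab * aa)))
      <= (D + D + (D + D + (D + D))).+1)%N.
  rewrite !expr2 => /and5P[sa sb saa sab /and4P[sbb sabi sabj _]].
  by apply: msize_mulD; [|apply: msize_subD]; do 3?apply: msize_mulD => //;
    apply: msize_subD; apply: msize_mulD.
have sOm : (msize Om <= (D + D + (D + D + (D + D))).+1)%N.
  by apply: ms; rewrite /= !sd.
pose E := (D + D + (D + D + (D + D)))%N.
set Z := [set p | ev Om p == 0].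
(* [Om], the product of both derivatives and the separation, has degree at most 6 D, and each of the
   two coordinates contributes 6 D m zeros. *)
have cZ : (#|Z| <= 12 * D * m)%N.
  have swap y x : upd (upd w j y) i x =1 upd (upd w i x) j y.
    by move=> t; rewrite /upd; case: (eqVneq t i) => [->|//]; rewrite (negPf ij).
  have py a : polyfun E (fun y => Om.@[upd (upd w j y) i (X i a)]).
    by apply: polyfun_ext (polyfun_upd j (upd w i (X i a)) sOm) => y; apply/esym/meval_eq/swap.
  have h0 : Om.@[upd (upd w j (w j)) i (w i)] != 0.
    rewrite (@meval_eq _ _ _ w) // => t; rewrite /upd.
    by case: eqP => [->//|_]; case: eqP => [->|].
  have c1 := card_polyfun_zeros (homo_inj (Xlt i)) (polyfun_upd i (upd w j (w j)) sOm) h0.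
  have := schwartz_zippel_step (G := fun a y => Om.@[upd (upd w j y) i (X i a)]) (w j)
    (homo_inj (Xlt j)) py.
  rewrite -/Z card_ord => /leq_trans; apply.
  apply: leq_trans (leq_add (leq_mul c1 (leqnn m)) (leqnn _)) _.
  by rewrite /E; clear; nia.
pose mk t (p : 'I_m * 'I_m) : {ffun 'I_3 -> 'I_m} :=
  [ffun u => if u == i then p.1 else if u == j then p.2 else t].
pose F t := [set p | mk t p \in S].
(* Pigeonhole: since f does not involve the variable k, a richest layer is a planar configuration
   holding at least a share 1 / m of [S]. *)
have [t cF] : exists t, (#|S| <= m * #|F t|)%N.
  have [|t et] := @bigop.eq_bigmax 'I_m (fun t => #|F t|); first by rewrite card_ord.
  exists t; have cS : (#|S| <= #|F t| * #|(fun s : {ffun 'I_3 -> 'I_m} => s k) @: S|)%N; last first.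
    by apply: leq_trans cS _; rewrite mulnC leq_mul2r (leq_trans (max_card _)) ?card_ord ?orbT.
  apply: card_le_fiber.
  move=> u; rewrite -et; apply: leq_trans (leq_bigmax (F := fun t => #|F t|) u).
  have mkK (s : {ffun 'I_3 -> 'I_m}) : s k = u -> mk u (s i, s j) = s.
    move=> su; apply/ffunP => r; rewrite ffunE /=.
    case: (ord3_cases r ij ik jk) => ->; rewrite ?eqxx // ?(negPf ji) //.
    by rewrite !(eq_sym k) (negPf ik) (negPf jk).
  rewrite -(card_in_imset (f := fun s : {ffun 'I_3 -> 'I_m} => (s i, s j))).
    apply/subset_leq_card/subsetP => _ /imsetP[s + ->]; rewrite !inE => /andP[sS /eqP su].
    by rewrite mkK.
  move=> s s'; rewrite !inE => /andP[_ /eqP su] /andP[_ /eqP su'] e.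
  by rewrite -(mkK s su) -(mkK s' su') e.
pose S' := F t :\: Z.
have cS' : (#|F t| <= #|S'| + 12 * D * m)%N.
  rewrite -(cardsID Z) addnC leq_add2l; apply: leq_trans cZ.
  by apply/subset_leq_card/subsetIr.
have mS' : (m ^ 2 <= 2 * N * #|S'|)%N.
  have hm : (24 * D * N <= m)%N.
    rewrite -(leq_exp2r _ _ (e := 2)) //; apply: leq_trans (leq_sqr nm).
    by apply: leq_trans (ltnW Cn); rewrite leq_addl.
  have : (m * m ^ 2 <= m * (N * (#|S'| + 12 * D * m)))%N.
    apply: leq_trans mS _; apply: leq_trans (leq_mul (leqnn N) cF) _.
    by rewrite mulnCA leq_mul2l leq_mul2l cS' !orbT.
  rewrite leq_mul2l eqn0Ngt m0 /=; move: hm; move: #|S'| => c'; clear; nia.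
have hS' p : p \in S' -> ev f p = delta (lab (mk t p)).
  rewrite !inE => /andP[_ pS]; rewrite -hS // /ev -(meval_mderiv0 _ (X k t) fk0).
  apply: meval_eq => r; rewrite /upd ffunE.
  case: (ord3_cases r ij ik jk) => ->; rewrite ?eqxx ?(negPf ji) ?(negPf ij) ?(negPf ik) ?(negPf jk) //.
  by rewrite !(eq_sym k) (negPf ik) (negPf jk).
have hS0 p : p \in S' ->
    [/\ ev f^`M(i) p != 0, ev f^`M(j) p != 0 & ev (separation f i j) p != 0].
  by rewrite !inE /ev !mevalM !mulf_eq0 !negb_or => /andP[/andP[/andP[]]].
have := hC _ _ _ nm mS' (fun c c0 =>
  incidence2 ij sf c0 (homo_inj (Xlt i)) (Xlt j) hS' hS0).
by rewrite leqNgt (leq_ltn_trans _ Cn) // leq_addr.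
Qed.
End Rich.

Lemma special_form_univariate (i j k : 'I_3) (f : {mpoly K[3]}) :
  i != j -> i != k -> j != k -> f^`M(j) = 0 -> f^`M(k) = 0 -> special_form i j k f.
Proof.
move=> ij ik jk fj fk; rewrite (lift_slice ij ik jk (fun=> 0) fj fk).
exists (slice i (fun=> 0) f), 'X, 0, 0; left.
by rewrite lift_polyX !rmorph0 !addr0 lift_polyE.
Qed.

Lemma special_form_of_incidences D N : exists n0, forall (f : {mpoly K[3]}) (i j k : 'I_3) m n
    (X : 'I_3 -> 'I_m -> K) (delta : 'I_n -> K) (S : {set {ffun 'I_3 -> 'I_m}})
    (lab : {ffun 'I_3 -> 'I_m} -> 'I_n),
  i != j -> i != k -> j != k -> (n0 < n)%N -> (msize f <= D.+1)%N ->
  (m <= n)%N -> (n ^ 5 <= m ^ 6)%N -> (m ^ 3 <= N * #|S|)%N ->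
  (forall t, {homo X t : a c / (a < c)%N >-> a < c}) ->
  {homo delta : a c / (a < c)%N >-> a < c} ->
  (forall s, s \in S -> f.@[fun t => X t (s t)] = delta (lab s)) ->
  special_form i j k f.
Proof.
have [n1 h1] := jacobian_eq0 D N; have [n2 h2] := separation_eq0 D N.
exists (n1 + n2)%N => f i j k m n X delta S lab ij ik jk nn sf mn nm mS Xlt dlt hS.
have n1n : (n1 < n)%N by apply: leq_ltn_trans nn; rewrite leq_addr.
have n2n : (n2 < n)%N by apply: leq_ltn_trans nn; rewrite leq_addl.
have ji : j != i by rewrite eq_sym.
have ki : k != i by rewrite eq_sym.
have kj : k != j by rewrite eq_sym.
have J (a b c : 'I_3) (ab : a != b) (ac : a != c) (bc : b != c) :=
  h1 f a b c m n X delta S lab ab ac bc n1n sf mn nm mS Xlt dlt hS.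
have W (a b c : 'I_3) (ab : a != b) (ac : a != c) (bc : b != c) :=
  h2 f a b c m n X delta S lab ab ac bc n2n sf nm mS Xlt dlt hS.
have [fi|fi] := eqVneq f^`M(i) 0; have [fj|fj] := eqVneq f^`M(j) 0;
  have [fk|fk] := eqVneq f^`M(k) 0.
- exact: special_form_univariate.
- exact/special_form_rot/special_form_univariate.
- exact/special_form_swap/special_form_univariate.
- do 2!apply: special_form_rot.
  by apply: special_form_of_separation => //; apply: W jk ji ki fj fk fi.
- exact: special_form_univariate.
- apply/special_form_rot/special_form_swap.
  by apply: special_form_of_separation => //; apply: W ik ij kj fi fk fj.
- by apply: special_form_of_separation => //; apply: W ij ik jk fi fj fk.
apply: special_form_of_jacobians => //; [exact: J ij ik jk|exact: J ik ij kj|exact: J jk ji ki].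
Qed.

Lemma special_form_of_grid D N : exists n0, forall (f : {mpoly K[3]}) m n (A B C E : seq K),
  (n0 < n)%N -> (msize f <= D.+1)%N -> (m <= n)%N -> (n ^ 5 <= m ^ 6)%N ->
  [/\ uniq A, uniq B, uniq C & uniq E] ->
  [/\ size A = m, size B = m, size C = m & size E = n] ->
  (m ^ 3 <= N * \sum_(a <- A) \sum_(b <- B) \sum_(c <- C)
    (f.@[fun t : 'I_3 => nth 0%R [:: a; b; c] t] \in E))%N ->
  special_form ord0 (@Ordinal 3 1 isT) ord_max f.
Proof.
have [n0 h0] := special_form_of_incidences D N.
exists n0 => f m n A B C E nn sf mn nm [uA uB uC uE] [sA sB sC sE].
have [XA [ltA _ ->]] := sorted_indexing uA sA.
have [XB [ltB _ eB]] := sorted_indexing uB sB.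
have [XC [ltC _ eC]] := sorted_indexing uC sC.
have [delta [ltE codE _]] := sorted_indexing uE sE.
pose v a b c := f.@[fun t : 'I_3 => nth 0 [:: a; b; c] t].
have -> : (\sum_i \sum_(b <- B) \sum_(c <- C) (v (XA i) b c \in E) =
    \sum_i \sum_j \sum_l (v (XA i) (XB j) (XC l) \in E))%N.
  by apply: eq_bigr => i _; rewrite eB; apply: eq_bigr => j _; rewrite eC.
pose X (t : 'I_3) := nth XA [:: XA; XB; XC] t.
pose S := [set s : {ffun 'I_3 -> 'I_m} | f.@[fun t => X t (s t)] \in E].
have [lab hlab] : exists lab : {ffun 'I_3 -> 'I_m} -> 'I_n, forall s, s \in S ->
    f.@[fun t => X t (s t)] = delta (lab s).
  apply: (@fin_all_exists _ (fun=> 'I_n) (fun s l => s \in S -> f.@[_] = delta l)) => s.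
  have [|_] := boolP (s \in S); first by rewrite inE => /codE[l hl]; exists l.
  by exists (Ordinal (leq_ltn_trans (leq0n _) nn)).
pose P (p : 'I_m * 'I_m * 'I_m) := v (XA p.1.1) (XB p.1.2) (XC p.2) \in E.
have -> : (\sum_i \sum_j \sum_l (v (XA i) (XB j) (XC l) \in E) = #|[set p | P p]|)%N.
  by rewrite -sum_bool_card pair_bigA pair_bigA.
pose mk (p : 'I_m * 'I_m * 'I_m) : {ffun 'I_3 -> 'I_m} := [ffun t : 'I_3 => nth p.2 [:: p.1.1; p.1.2] t].
have cS : (#|[set p | P p]| <= #|S|)%N.
  rewrite -(card_imset _ (f := mk)).
    apply/subset_leq_card/subsetP => _ /imsetP[p + ->]; rewrite !inE /P /v.
    congr (_ \in E); apply: meval_eq => t; rewrite /X ffunE.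
    by case: t => [[|[|[|?]]] ?].
  move=> [[a b] c] [[a' b'] c'] e; have et t : mk (a, b, c) t = mk (a', b', c') t by rewrite e.
  move: (et ord0) (et (@Ordinal 3 1 isT)) (et ord_max).
  by rewrite !ffunE /= => -> -> ->.
move=> hm; apply: (h0 f _ _ _ m n X delta S lab) => //.
  by apply: leq_trans hm _; rewrite leq_mul2l cS orbT.
by case=> [[|[|[|?]]] ?] //; rewrite /X.
Qed.

Lemma special_form_horner (f : {mpoly K[3]}) :
  special_form ord0 (@Ordinal 3 1 isT) ord_max f -> exists g k l m : {poly K},
    (forall x y z, f.@[fun t : 'I_3 => nth 0 [:: x; y; z] t] = g.[k.[x] + l.[y] + m.[z]]) \/
    (forall x y z, f.@[fun t : 'I_3 => nth 0 [:: x; y; z] t] = g.[k.[x] * l.[y] * m.[z]]).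
Proof.
move=> [g [u [v [w [->|->]]]]]; exists g, u, v, w; [left|right] => x y z; rewrite meval_compose.
  by rewrite !mevalD !meval_lift.
by rewrite /product_of !mevalM !meval_lift.
Qed.

End RealClosedField.

(** * Real exponents *)

Lemma Rpower_mulrn (x y : R) k : Rpower x (y * k%:R) = Rpower x y ^+ k.
Proof. by rewrite -INRE -Rpower_mult Rpower_pow ?RpowE //; apply: exp_pos. Qed.

Lemma leq_exp_Rpower (n M p q : nat) (y : R) : (0 < n)%N -> p%:R <= y * q%:R ->
  M%:R = Rpower n%:R y -> (n ^ p <= M ^ q)%N.
Proof.
move=> n0 pq hM; have n1 : (1 <= n%:R :> R) by rewrite ler1n.
rewrite -(ler_nat R) !natrX hM -Rpower_mulrn.
have -> : n%:R ^+ p = Rpower n%:R p%:R :> R.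
  by rewrite -[p%:R]mul1r Rpower_mulrn Rpower_1 //; apply/RltP; rewrite ltr0n.
by apply/RleP/Rle_Rpower; apply/RleP.
Qed.

Lemma graph_pointsE (f : {mpoly R[3]}) (A B C D : seq R) : uniq D ->
  graph_points f A B C D =
  (\sum_(a <- A) \sum_(b <- B) \sum_(c <- C) (ev3 f a b c \in D))%N.
Proof.
move=> uD; do 3!(apply: eq_bigr => ? _).
by rewrite -(count_uniq_mem _ uD) -sum1_count [RHS]big_mkcond; apply: eq_bigr => e _ /=; case: eqP.
Qed.

Theorem theorem1p5 :
  forall (c : R) (d : nat), 0 < c -> (0 < d)%N ->
  exists n0 : nat,
    forall (eps : R) (f : {mpoly R[3]}),
      0 < eps ->
      msize f = d.+1 ->
      (exists (n : nat) (A B C D : seq R),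
          [/\ (n0 < n)%N, uniq A, uniq B, uniq C & uniq D] /\
          [/\ size A = n,
              (size B)%:R = Rpower n%:R (5 / 6 + eps),
              (size C)%:R = Rpower n%:R (5 / 6 + eps),
              size D = n &
              c * Rpower n%:R (8 / 3 + 2 * eps) <= (graph_points f A B C D)%:R]) ->
      exists g k l m : {poly R},
        (forall x y z : R, ev3 f x y z = g.[k.[x] + l.[y] + m.[z]]) \/
        (forall x y z : R, ev3 f x y z = g.[k.[x] * l.[y] * m.[z]]).
Proof.
move=> c d c0 d0; pose N := Num.bound c^-1.
have Nc : 1 <= N%:R * c.
  rewrite -ler_pdivrMr // mul1r; apply/ltW/Num.Theory.archi_boundP.
  by rewrite invr_ge0 ltW.
have [n0 h0] := special_form_of_grid R d N; exists n0 => eps f e0 sf.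
move=> [n [A [B [C [E [[nn uA uB uC uE] [sA sB sC sE G]]]]]]].
apply: special_form_horner.
have n_gt0 : (0 < n)%N by apply: leq_ltn_trans nn.
have CB : size C = size B by apply/eqP; rewrite -(eqr_nat R) sB sC.
set M := size B in sB CB.
have nM : (n ^ 5 <= M ^ 6)%N.
  by apply: leq_exp_Rpower n_gt0 _ sB; rewrite RplusE RdivE !IZRposE !INRE /=; lra.
have M_gt0 : (0 < M)%N.
  by case: M nM {sB CB} => //; rewrite exp0n // leqn0 expn_eq0 andbT; move: n_gt0; case: (n).
have nMM : (n * M * M <= N * graph_points f A B C E)%N.
  (* 8/3 + 2 eps = 1 + 2 (5/6 + eps): the hypothesis says that a proportion c of the triples of A x
     B x C has its value in the fourth set. *)
  have e : Rpower n%:R (8 / 3 + 2 * eps) = (n * M * M)%:R.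
    rewrite !natrM sB -mulrA -expr2 -Rpower_mulrn -[X in X * _](@Rpower_1 n%:R).
      by rewrite -RmultE -Rpower_plus; congr Rpower; rewrite !(RplusE, RdivE, RmultE, IZRposE, INRE) /=; field.
    by apply/RltP; rewrite ltr0n.
  rewrite e in G; rewrite -(ler_nat R) [X in _ <= X]natrM.
  apply: le_trans (ler_wpM2l (ler0n _ N) G); rewrite mulrA -[X in X <= _]mul1r.
  by rewrite ler_wpM2r.
(* For large eps the sets B and C can be larger than A, hence the minimum. *)
pose m := minn n M.
have nm : (n ^ 5 <= m ^ 6)%N.
  by rewrite /m; case: (leqP n M) => // _; rewrite leq_pexp2l.
have [] := @subsample3 _ (fun a b c => ev3 f a b c \in E : nat) A B C m _ _ _ uA uB uC.
- by rewrite sA geq_minl.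
- exact: geq_minr.
- by rewrite CB geq_minr.
move=> A' [B' [C' [[uA' uB' uC'] [sA' sB' sC']]]]; rewrite -graph_pointsE // sA CB -/M => hG.
apply: (h0 f m n A' B' C' E) => //; rewrite ?sf ?geq_minl //.
rewrite -/(ev3 f _ _ _); move: nMM hG; set g := graph_points _ _ _ _ _; set g' := bigop _ _ _ => u1 u2.
have p0 : (0 < n * M * M)%N by rewrite !muln_gt0 n_gt0 M_gt0.
rewrite -(leq_pmul2l p0).
apply: (@leq_trans (m ^ 3 * (N * g))); first by rewrite mulnC leq_mul2l u1 orbT.
by rewrite mulnCA [X in (_ <= X)%N]mulnCA leq_mul2l u2 orbT.
Qed.
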